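(* Let $p>1$, $p'=\frac{p}{p-1}$, and let $g,d,h$ satisfy the hypotheses on reaction, diffusion and convection listed in the context. Put $H(U)=\int_0^U h(s)\,ds$, $h_M=\sup_{0\le t\le 1}h(t)$, and assume $$0<\mu:=\sup_{t\in(0,1)}\frac{(d(t))^{\frac1{p-1}}g(t)}{t^{p'-1}}<+\infty .$$ For $c\in\mathbb{R}$ consider the problem $$(P_c)\qquad (d(U)|U'|^{p-2}U')'+(c-h(U))U'+g(U)=0 \ \text{ on } \mathbb{R},\qquad \lim_{z\to-\infty}U(z)=1,\quad \lim_{z\to+\infty}U(z)=0 ,$$ with solutions understood in the sense defined in the context. In the case $h(0)>H(1)$, there exists a number $$c^*\in\big[h(0),\ h_M+(p')^{\frac1{p'}}p^{\frac1p}\mu^{\frac1{p'}}\big]$$ such that $(P_c)$ has a unique solution (traveling wave) $U=U(z)$, $z\in\mathbb{R}$, normalized by $U(0)=\frac12$ (that is, unique up to translation in $z$), if and only if $c\ge c^*$. In the case $h(0)\le H(1)$, the same result holds with $$c^*\in\big(H(1),\ h_M+(p')^{\frac1{p'}}p^{\frac1p}\mu^{\frac1{p'}}\big].$$ Moreover, $U$ (normalized in this way) has the following properties: (i) There are $-\infty\le z_0<0<z_1\le+\infty$ with $(z_0,z_1)=\{z\in\mathbb{R}:0<U(z)<1\}$ such that $U$ is strictly decreasing in $(z_0,z_1)$, $U(0)=\frac12$, $U(z)=1$ for $z\in(-\infty,z_0]$, and $U(z)=0$ for $z\in[z_1,+\infty)$. (ii) For $i=1,\dots,r$ let $\zeta_i\in(z_0,z_1)$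 be such that $U(\zeta_i)=m_i$, and let $\zeta_0=z_1$, $\zeta_{r+1}=z_0$. Then $U\in C(\mathbb{R})$ is piecewise $C^1$ in the sense that $U|_{(\zeta_{i+1},\zeta_i)}\in C^1(\zeta_{i+1},\zeta_i)$ for $i=0,1,\dots,r$, and the one-sided derivatives $U'(\zeta_i\pm)=\lim_{z\to\zeta_i\pm}U'(z)$, $i=1,\dots,r$, exist and are finite. (iii) $\displaystyle\lim_{z\to z_0+}d(U(z))|U'(z)|^{p-2}U'(z)=\lim_{z\to z_1-}d(U(z))|U'(z)|^{p-2}U'(z)=0$, and for $i=1,\dots,r$ the transition condition $$|U'(\zeta_i-)|^{p-2}U'(\zeta_i-)\lim_{z\to\zeta_i-}d(U(z))=|U'(\zeta_i+)|^{p-2}U'(\zeta_i+)\lim_{z\to\zeta_i+}d(U(z))$$ holds. (iv) $U$ satisfies the differential equation in $(P_c)$ in the classical sense on $\mathbb{R}\setminus(M_U\cup K_U\cup\partial N_U)$, together with the boundary conditions.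
   Context: Hypotheses. Reaction: $g:[0,1]\to\mathbb{R}$ is continuous, $g(0)=g(1)=0$, $g>0$ in $(0,1)$. Diffusion: $d:[0,1]\to\mathbb{R}$ is nonnegative and lower semicontinuous, $d>0$ in $(0,1)$, and there are $0=m_0<m_1<\dots<m_r<m_{r+1}=1$ such that $d$ has a jump discontinuity at $m_i$ (finite one-sided limits), $i=1,\dots,r$, and $d|_{(m_i,m_{i+1})}$ is continuous, $i=0,\dots,r$ ($d$ may be unbounded near $0$ and/or $1$). Convection: $h:[0,1]\to\mathbb{R}$ is continuous at $0$, bounded and piecewise continuous on $[0,1]$: there are $0=k_0<k_1<\dots<k_q<k_{q+1}=1$ such that $h$ has a jump discontinuity at $k_j$ (finite one-sided limits), $j=1,\dots,q$, and $h|_{(k_j,k_{j+1})}$ is continuous, $j=0,\dots,q$. Notation. For $U:\mathbb{R}\to[0,1]$: $M_U=\{z: U(z)=m_i \text{ for some } i=1,\dots,r\}$, $K_U=\{z: U(z)=k_j\text{ for some }j=1,\dots,q\}$, $N_U=\{z:U(z)=0\text{ or }U(z)=1\}$. $\partial$ denotes topological boundary in $\mathbb{R}$. The expression $|s|^{p-2}s$ is $0$ at $s=0$. Definition of solution. A continuous function $U:\mathbb{R}\to[0,1]$ is a solution of $(d(U)|U'|^{p-2}U')'+(c-h(U))U'+g(U)=0$ if: (a) $D_U:=\partial M_U\cup\partial N_U$ is a discrete set in $\mathbb{R}$ and $U\in C^1(\mathbb{R}\setminus D_U)$. (b) For any $z\in\partial M_U$ there exist finite one-sided derivatives $U'(z-),U'(z+)$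 and $$L(z):=|U'(z-)|^{p-2}U'(z-)\lim_{\xi\to z-}d(U(\xi))=|U'(z+)|^{p-2}U'(z+)\lim_{\xi\to z+}d(U(\xi)).$$ (c) The function $v:\mathbb{R}\to\mathbb{R}$ defined by $v(z)=d(U(z))|U'(z)|^{p-2}U'(z)$ for $z\notin\partial M_U\cup\partial N_U$, $v(z)=0$ for $z\in\partial N_U$, $v(z)=L(z)$ for $z\in\partial M_U$, is continuous, and for all $z,\hat z\in\mathbb{R}$ $$v(\hat z)-v(z)+c(U(\hat z)-U(z))-(H(U(\hat z))-H(U(z)))+\int_z^{\hat z}g(U(\tau))\,d\tau=0;$$ moreover $\lim_{z\to\pm\infty}v(z)=0$. A traveling wave (solution of $(P_c)$) is a solution in this sense that also satisfies the boundary conditions at $\pm\infty$. *)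

(* Defs.v *)
(* Functions on [0, 1] are total functions [R -> R] whose values outside [0, 1]
   are never constrained nor used. *)
From HB Require Import structures.
From mathcomp Require Import all_boot all_order all_algebra.
From mathcomp Require Import all_classical all_reals all_analysis.

Set Implicit Arguments.
Unset Strict Implicit.
Unset Printing Implicit Defensive.

Import Order.TTheory GRing.Theory Num.Theory.
Import numFieldNormedType.Exports.

Local Open Scope classical_set_scope.
Local Open Scope ring_scope.

Definition boundary {T : topologicalType} (A : set T) : set T :=
  closure A `\` interior A.

Definition discrete_subset {T : topologicalType} (A : set T) : Prop :=
  A `<=` isolated A.

(* Only meaningful for open [A]: [derive1 U] is a two-sided derivative. *)
Definition C1_on {R : realType} (A : set R) (U : R -> R) : Prop :=
  forall z, A z -> derivable U z 1 /\ {for z, continuous (derive1 U)}.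

Definition oriented_integral {R : realType} (f : R -> R) (a b : R) : R :=
  if a <= b then \int[lebesgue_measure]_(t in `[a, b]) f t
  else - \int[lebesgue_measure]_(t in `[b, a]) f t.

Definition left_quotient_limit {R : realType} (U : R -> R) (z a : R) : Prop :=
  (h^-1 * (U (z + h) - U z)) @[h --> 0^'-] --> a.

Definition right_quotient_limit {R : realType} (U : R -> R) (z a : R) : Prop :=
  (h^-1 * (U (z + h) - U z)) @[h --> 0^'+] --> a.

Definition left_derivative {R : realType} (U : R -> R) (z : R) : R :=
  lim ((h^-1 * (U (z + h) - U z)) @[h --> 0^'-]).

(* One-sided limits of a function of a real variable at an extended real point;
   [ereal_right +oo] and [ereal_left -oo] are not used. *)
Definition ereal_right {R : realType} (a : \bar R) : set_system R :=
  match a with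
  | EFin x => x^'+
  | -oo%E => -oo_R
  | +oo%E => +oo_R
  end.

Definition ereal_left {R : realType} (a : \bar R) : set_system R :=
  match a with
  | EFin x => x^'-
  | -oo%E => -oo_R
  | +oo%E => +oo_R
  end.

Definition ereal_open_itv {R : realType} (a b : \bar R) : set R :=
  [set z : R | (a < z%:E < b)%E].

(* b 0 = 0 < b 1 < ... < b n < b (n + 1) = 1; later values are irrelevant. *)
Definition breakpoints {R : realType} (n : nat) (b : nat -> R) : Prop :=
  [/\ b 0%N = 0, b n.+1 = 1 & forall i, (i <= n)%N -> b i < b i.+1].

Definition jump_discontinuity {R : realType} (f : R -> R) (a : R) : Prop :=
  exists l1 l2 : R,
    [/\ f t @[t --> a^'-] --> l1, f t @[t --> a^'+] --> l2 & l1 != l2].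

Definition piecewise_continuous {R : realType}
    (n : nat) (b : nat -> R) (f : R -> R) : Prop :=
  [/\ breakpoints n b,
      forall i, (0 < i <= n)%N -> jump_discontinuity f (b i) &
      forall i, (i <= n)%N -> {in `]b i, b i.+1[, continuous f}].

Definition reaction_hyp {R : realType} (g : R -> R) : Prop :=
  [/\ {within `[0, 1], continuous g}, g 0 = 0, g 1 = 0 &
      forall t, 0 < t < 1 -> 0 < g t].

Definition diffusion_hyp {R : realType}
    (r : nat) (m : nat -> R) (d : R -> R) : Prop :=
  [/\ forall t, 0 <= t <= 1 -> 0 <= d t,
      lower_semicontinuous (fun t : subspace (`[0, 1] : set R) => (d t)%:E),
      forall t, 0 < t < 1 -> 0 < d t &
      piecewise_continuous r m d].

Definition convection_hyp {R : realType}
    (q : nat) (k : nat -> R) (h : R -> R) : Prop :=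
  [/\ h t @[t --> 0^'+] --> h 0,
      exists M : R, forall t, 0 <= t <= 1 -> `|h t| <= M &
      piecewise_continuous q k h].

Definition conjugate_exponent {R : realType} (p : R) : R := p / (p - 1).

Definition mu_set {R : realType} (p : R) (d g : R -> R) : set R :=
  [set (d t) `^ (1 / (p - 1)) * g t / t `^ (conjugate_exponent p - 1)
     | t in `]0, 1[].

Definition primitive {R : realType} (h : R -> R) (u : R) : R :=
  oriented_integral h 0 u.

(* |s|^{p-2} s; it vanishes at s = 0 whatever p is. *)
Definition signed_power {R : realType} (p s : R) : R := `|s| `^ (p - 2) * s.

(* {z | U z = b i for some i = 1..n}; this is M_U, resp. K_U, when b lists the
   jumps of the diffusion, resp. of the convection. *)
Definition level_set {R : realType}
    (n : nat) (b : nat -> R) (U : R -> R) : set R :=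
  [set z | exists2 i, (0 < i <= n)%N & U z = b i].

Definition end_set {R : realType} (U : R -> R) : set R :=
  [set z | U z = 0 \/ U z = 1].

Definition flux {R : realType} (p : R) (d U : R -> R) (z : R) : R :=
  d (U z) * signed_power p (derive1 U z).

Definition transition_value {R : realType} (p : R) (d U : R -> R) (z : R) : R :=
  signed_power p (left_derivative U z) * lim (d (U x) @[x --> z^'-]).

Definition extended_flux {R : realType}
    (p : R) (d : R -> R) (r : nat) (m : nat -> R) (U : R -> R) (z : R) : R :=
  if z \in boundary (end_set U) then 0
  else if z \in boundary (level_set r m U) then transition_value p d U z
  else flux p d U z.

Record is_solution {R : realType} (p : R) (d g h : R -> R)
    (r : nat) (m : nat -> R) (c : R) (U : R -> R) : Prop := IsSolution {
  sol_range : forall z, 0 <= U z <= 1 ;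
  sol_continuous : continuous U ;
  sol_discrete :
    discrete_subset (boundary (level_set r m U) `|` boundary (end_set U)) ;
  sol_C1 :
    C1_on (~` (boundary (level_set r m U) `|` boundary (end_set U))) U ;
  sol_transition : forall z, boundary (level_set r m U) z ->
    exists a1 a2 l1 l2 : R,
      [/\ left_quotient_limit U z a1, right_quotient_limit U z a2,
          d (U x) @[x --> z^'-] --> l1, d (U x) @[x --> z^'+] --> l2 &
          signed_power p a1 * l1 = signed_power p a2 * l2] ;
  sol_flux_continuous : continuous (extended_flux p d r m U) ;
  sol_integral : forall z z' : R,
    extended_flux p d r m U z' - extended_flux p d r m U z
    + c * (U z' - U z) - (primitive h (U z') - primitive h (U z))
    + oriented_integral (fun t => g (U t)) z z' = 0 ;
  sol_flux_ninfty : extended_flux p d r m U z @[z --> -oo] --> (0 : R) ;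
  sol_flux_pinfty : extended_flux p d r m U z @[z --> +oo] --> (0 : R)
}.

Definition boundary_conditions {R : realType} (U : R -> R) : Prop :=
  U z @[z --> -oo] --> (1 : R) /\ U z @[z --> +oo] --> (0 : R).

Definition traveling_wave {R : realType} (p : R) (d g h : R -> R)
    (r : nat) (m : nat -> R) (c : R) (U : R -> R) : Prop :=
  is_solution p d g h r m c U /\ boundary_conditions U.

Definition normalized_wave {R : realType} (p : R) (d g h : R -> R)
    (r : nat) (m : nat -> R) (c : R) (U : R -> R) : Prop :=
  traveling_wave p d g h r m c U /\ U 0 = 1 / 2.

Definition wave_support {R : realType} (U : R -> R) (z0 z1 : \bar R) : Prop :=
  [/\ (z0 < 0 < z1)%E,
      ereal_open_itv z0 z1 = [set z | 0 < U z < 1],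
      forall x y, ereal_open_itv z0 z1 x -> ereal_open_itv z0 z1 y ->
        x < y -> U y < U x,
      U 0 = 1 / 2 &
      (forall z : R, (z%:E <= z0)%E -> U z = 1) /\
      (forall z : R, (z1 <= z%:E)%E -> U z = 0)].

(* zeta 0 = z1, zeta (r + 1) = z0, and zeta 1, ..., zeta r are the (finite)
   points of (z0, z1) at which U takes the values m 1, ..., m r. *)
Definition wave_nodes {R : realType} (r : nat) (m : nat -> R) (U : R -> R)
    (z0 z1 : \bar R) (zeta : nat -> \bar R) : Prop :=
  [/\ zeta 0%N = z1, zeta r.+1 = z0 &
      forall i, (0 < i <= r)%N ->
        [/\ zeta i \is a fin_num, (z0 < zeta i < z1)%E &
            U (fine (zeta i)) = m i]].

Definition wave_piecewise_C1 {R : realType} (r : nat) (U : R -> R)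
    (zeta : nat -> \bar R) : Prop :=
  [/\ continuous U,
      forall i, (i <= r)%N -> C1_on (ereal_open_itv (zeta i.+1) (zeta i)) U &
      forall i, (0 < i <= r)%N ->
        cvg (derive1 U z @[z --> (fine (zeta i))^'-]) /\
        cvg (derive1 U z @[z --> (fine (zeta i))^'+])].

Definition wave_flux_conditions {R : realType} (p : R) (d : R -> R) (r : nat)
    (U : R -> R) (z0 z1 : \bar R) (zeta : nat -> \bar R) : Prop :=
  [/\ flux p d U z @[z --> ereal_right z0] --> (0 : R),
      flux p d U z @[z --> ereal_left z1] --> (0 : R) &
      forall i, (0 < i <= r)%N -> let x := fine (zeta i) in
        [/\ cvg (d (U z) @[z --> x^'-]), cvg (d (U z) @[z --> x^'+]) &
            signed_power p (lim (derive1 U z @[z --> x^'-]))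
              * lim (d (U z) @[z --> x^'-])
            = signed_power p (lim (derive1 U z @[z --> x^'+]))
              * lim (d (U z) @[z --> x^'+])]].

Definition classical_solution_on {R : realType} (p : R) (d g h : R -> R)
    (c : R) (A : set R) (U : R -> R) : Prop :=
  [/\ C1_on A U, C1_on A (flux p d U) &
      forall z, A z ->
        derive1 (flux p d U) z + (c - h (U z)) * derive1 U z + g (U z) = 0].

Definition wave_properties {R : realType} (p : R) (d g h : R -> R)
    (r : nat) (m : nat -> R) (q : nat) (k : nat -> R) (c : R)
    (U : R -> R) : Prop :=
  exists (z0 z1 : \bar R) (zeta : nat -> \bar R),
    wave_support U z0 z1 /\
    wave_nodes r m U z0 z1 zeta /\
    wave_piecewise_C1 r U zeta /\
    wave_flux_conditions p d r U z0 z1 zeta /\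
    classical_solution_on p d g h c
      (~` (level_set r m U `|` level_set q k U `|` boundary (end_set U))) U /\
    boundary_conditions U.

Definition is_threshold_speed {R : realType} (p : R) (d g h : R -> R)
    (r : nat) (m : nat -> R) (q : nat) (k : nat -> R) (cstar : R) : Prop :=
  (forall c : R,
     (exists! U : R -> R, normalized_wave p d g h r m c U) <-> cstar <= c) /\
  (forall (c : R) (U : R -> R), cstar <= c ->
     normalized_wave p d g h r m c U -> wave_properties p d g h r m q k c U).

(* Main.v *)
Require Import Defs.
From HB Require Import structures.
From mathcomp Require Import all_boot all_order all_algebra.
From mathcomp Require Import all_classical all_reals all_analysis.
From mathcomp Require Import ring lra.

Set Implicit Arguments.
Unset Strict Implicit.
Unset Printing Implicit Defensive.

Import Order.TTheory GRing.Theory Num.Theory.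
Import numFieldNormedType.Exports.

Local Open Scope classical_set_scope.
Local Open Scope ring_scope.

(** Write a = 1 / (p - 1). A decreasing wave U can be described by the flux as
    a function of its own value: with w (U z) = - d (U) |U'|^{p-2} U', the
    equation becomes the singular first-order equation

      w' = c - h - f w^{-a},   f = d^a g,   w > 0 on (0, 1),

    with w vanishing at 0 and at 1; conversely such a w determines the wave up
    to translation, since the inverse Z of U satisfies Z' = - (d / w)^a. The
    hypothesis on the supremum says that 0 < f <= mu t^a, so that f is bounded
    although d may not be.

    The right-hand side increases with w. A positive gap between two solutions
    therefore widens as t grows, so for every speed c there is at most one
    positive solution with w (1) = 0, called a profile below, and it decreases
    when c grows ([profile_le]). Profiles exist for every c
    ([profile_exists]): adding to f a small multiple of e^a and imposing
    w (1) = e makes the constant e a barrier, so the equation stays away from its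
    singularity and Picard iteration applies; the solutions decrease with e, and
    local lower bounds allow the passage to the limit e = 0.

    A wave of speed c exists exactly when the profile of c also vanishes at 0.
    The set of such c is upward closed by monotonicity, and closed because
    w_c <= w_{c'} + (c' - c) for c <= c' ([profile_le_speed]); its minimum is the
    threshold ([threshold_exists]). Near 0 the profile could not stay positive if
    c < h (0); integrating the equation over (0, 1) gives c > P (1), where P is the
    primitive of h that vanishes at 0; and a line kappa t lying above the profile
    gives the upper bound, with the kappa that minimises kappa + mu kappa^{-a}.

    It remains to see that every wave is of the form above. The energy
    v + c U - P (U) has derivative - g (U) <= 0 and tends to 0 at + oo, hence is
    nonnegative. If the flux v were nonnegative at a point where 0 < U < 1, then
    going left one would reach a point where U = v = 0, so that the energy would
    be 0 there and negative further right ([flux_neg]). So U decreases strictly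
    where 0 < U < 1; comparing - v with w (U) towards the left end shows that they
    agree ([profile_on_wave]), and Z (U z) = z then identifies the wave
    ([wave_unique]). Inverting Z conversely gives a wave with all the announced
    properties ([profile_wave_solution], [profile_wave_properties]). *)


(** * Functions with a derivative off a finite set *)

Section RealTools.
Context {R : realType}.
Implicit Types (S : seq R) (u : R -> R) (x y z t a l e : R).

Lemma nearE_dist (P : R -> Prop) t :
  (\forall s \near t, P s) <-> exists2 e, 0 < e & forall s, `|s - t| < e -> P s.
Proof.
split=> [/nbhs_ballP[e e0 H]|[e e0 H]].
  by exists e => // s st; apply: H; rewrite /ball /= distrC.
by apply/nbhs_ballP; exists e => // s; rewrite /ball /= distrC; exact: H.
Qed.

Lemma near_leftE (P : R -> Prop) t :
  (\forall s \near t^'-, P s) <->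
  exists2 e, 0 < e & forall s, t - e < s < t -> P s.
Proof.
split=> [/nearE_dist[e e0 H]|[e e0 H]].
  exists e => // s /andP[es st]; apply: H => //=.
  by rewrite distrC gtr0_norm ?subr_gt0//; lra.
apply/nearE_dist; exists e => // s /= st s_t; apply: H; rewrite s_t andbT.
by move: st; rewrite distrC gtr0_norm ?subr_gt0//; lra.
Qed.

Lemma near_rightE (P : R -> Prop) t :
  (\forall s \near t^'+, P s) <->
  exists2 e, 0 < e & forall s, t < s < t + e -> P s.
Proof.
split=> [/nearE_dist[e e0 H]|[e e0 H]].
  exists e => // s /andP[ts es]; apply: H => //=.
  by rewrite gtr0_norm ?subr_gt0//; lra.
apply/nearE_dist; exists e => // s /= st t_s; apply: H; rewrite t_s /=.
by move: st; rewrite gtr0_norm ?subr_gt0//; lra.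
Qed.

(** By continuity the infimum of the times at which u is at most a is itself
    such a time. *)
Lemma first_time u x y a : x <= y ->
  (forall t, x <= t <= y -> {for t, continuous u}) ->
  a < u x -> u y <= a ->
  exists t, [/\ x < t, t <= y, u t = a & forall s, x <= s < t -> a < u s].
Proof.
move=> xy cu aux uya.
pose T := [set s | x <= s <= y /\ u s <= a].
have Ty : T y by split => //; rewrite xy lexx.
have lbT : lbound T x by move=> s [/andP[]].
have infT : has_inf T by split; [exists y | exists x].
have xt : x <= inf T by apply: lb_le_inf => //; exists y.
have ty : inf T <= y by apply: ge_inf => //; exists x.
set t := inf T in xt ty *.
have cut : {for t, continuous u} by apply: cu; rewrite xt ty.
have uta : u t <= a.
  rewrite leNgt; apply/negP => aut.
  have /nearE_dist[e e0 H] : \forall s \near t, a < u s by apply: (cvgr_gt _ cut).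
  have [s [/andP[xs sy] usa] st] := inf_adherent e0 infT.
  have ts : t <= s by apply: ge_inf; [exists x | split => //; rewrite xs].
  have : a < u s by apply: H; rewrite ger0_norm ?subr_ge0 -/t//; move: st; rewrite -/t; lra.
  by rewrite ltNge usa.
have lt_t s : x <= s < t -> a < u s.
  move=> /andP[xs st]; rewrite ltNge; apply/negP => usa.
  have : t <= s by apply: ge_inf; [exists x | split => //; rewrite xs; lra].
  by lra.
have x_t : x < t by rewrite lt_neqAle xt andbT; apply/eqP => xE; move: uta; rewrite -xE; lra.
exists t; split => //; apply/eqP; rewrite eq_le uta /= leNgt; apply/negP => uat.
have /nearE_dist[e e0 H] : \forall s \near t, u s < a by apply: (cvgr_lt _ cut).
pose s := Num.max x (t - e / 2).
have xs : x <= s by rewrite /s le_max lexx.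
have st : s < t by rewrite /s gt_max x_t /=; lra.
have := lt_t s; rewrite xs st => /(_ isT).
have : u s < a.
  apply: H; rewrite ltr0_norm ?subr_lt0//.
  have : t - e / 2 <= s by rewrite /s le_max lexx orbT.
  by lra.
by lra.
Qed.

Lemma continuous_reflect u t : {for - t, continuous u} ->
  {for t, continuous (u \o -%R)}.
Proof. by move=> cu; apply: continuous_comp; [exact: oppr_continuous|]. Qed.

Lemma last_time u x y a : x <= y ->
  (forall t, x <= t <= y -> {for t, continuous u}) ->
  u x <= a -> a < u y ->
  exists t, [/\ x <= t, t < y, u t = a & forall s, t < s <= y -> a < u s].
Proof.
move=> xy cu uxa auy.
have [||||t [yt tx ut H]] := @first_time (u \o -%R) (- y) (- x) a.
- by rewrite lerN2.
- by move=> t /andP[yt tx]; apply: continuous_reflect; apply: cu; lra.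
- by rewrite /= opprK.
- by rewrite /= opprK.
exists (- t); split; [lra|lra|done|] => s ts.
by have /= := H (- s); rewrite opprK; apply; lra.
Qed.

(** Exceptional points are removed one at a time by cutting the interval
    there; continuity glues the pieces. *)
Lemma ndecr_off S u x y : x <= y ->
  (forall t, x <= t <= y -> {for t, continuous u}) ->
  (forall t, x < t < y -> t \notin S -> exists2 l, is_derive t 1 u l & 0 <= l) ->
  u x <= u y.
Proof.
elim: S x y => [|s S IH] x y xy cu du.
  apply: (@ger0_derive1_le_cc _ u x y) => //.
  - by move=> t; rewrite in_itv /= => /du[]// l [].
  - by move=> t; rewrite in_itv /= => /du[]// l ut l0; rewrite derive1E derive_val.
  - apply: continuous_in_subspaceT => t; rewrite inE /= in_itv /=; exact: cu.
  - by rewrite in_itv /= lexx.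
  - by rewrite in_itv /= lexx andbT.
have [/andP[xs sy]|nxy] := boolP (x < s < y).
  apply: (@le_trans _ _ (u s)); apply: IH; try lra.
  - by move=> t /andP[? ?]; apply: cu; lra.
  - by move=> t /andP[? ?] tS; apply: du; [lra|rewrite inE negb_or tS andbT; apply/eqP; lra].
  - by move=> t /andP[? ?]; apply: cu; lra.
  - by move=> t /andP[? ?] tS; apply: du; [lra|rewrite inE negb_or tS andbT; apply/eqP; lra].
apply: IH => // t xty tS; apply: du => //; rewrite inE negb_or tS andbT.
by apply/eqP => ts; move: nxy; rewrite -ts xty.
Qed.

(** A barrier principle: the sign of the derivative need only be known where u
    is positive, because a first zero would have to come after a stretch on
    which u does not decrease. *)
Lemma persist S u x y :
  (forall t, x <= t <= y -> {for t, continuous u}) -> 0 < u x ->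
  (forall t, x < t < y -> t \notin S -> 0 < u t ->
     exists2 l, is_derive t 1 u l & 0 <= l) ->
  forall t, x <= t <= y -> u x <= u t.
Proof.
move=> cu ux du t0 /andP[xt0 t0y].
have pos t : x <= t -> t <= t0 -> 0 < u t.
  move=> xt tt0; rewrite ltNge; apply/negP => ut0.
  have [|t1 [xt1 t1t ut1 H]] := @first_time u x t 0 xt _ ux ut0.
    by move=> s /andP[? ?]; apply: cu; lra.
  have : u x <= u t1.
    apply: (@ndecr_off S); first exact: ltW.
      by move=> s /andP[? ?]; apply: cu; lra.
    move=> s /andP[? ?] sS; apply: du => //; first lra.
    by apply: H; lra.
  by lra.
apply: (@ndecr_off S) => //.
  by move=> s /andP[? ?]; apply: cu; lra.
by move=> s /andP[? ?] sS; apply: du => //; [lra|apply: pos; lra].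
Qed.

Lemma persist_end S u x y : x <= y ->
  (forall t, x <= t <= y -> {for t, continuous u}) -> 0 < u x ->
  (forall t, x < t < y -> t \notin S -> 0 < u t ->
     exists2 l, is_derive t 1 u l & 0 <= l) ->
  u x <= u y.
Proof. by move=> xy cu ux du; apply: (persist cu ux du); rewrite xy lexx. Qed.

Lemma is_derive_reflect u t l : is_derive (- t) 1 u l ->
  is_derive t 1 (u \o -%R) (- l).
Proof.
move=> du; rewrite -[- l]mulrN1; apply: is_derive1_comp.
Qed.

Lemma persist_left S u x y :
  (forall t, x <= t <= y -> {for t, continuous u}) -> 0 < u y ->
  (forall t, x < t < y -> t \notin S -> 0 < u t ->
     exists2 l, is_derive t 1 u l & l <= 0) ->
  forall t, x <= t <= y -> u y <= u t.
Proof.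
move=> cu uy du t xty.
have := @persist (map -%R S) (u \o -%R) (- y) (- x).
rewrite /= opprK => /(_ _ uy _ (- t)); rewrite /= opprK; apply.
- by move=> s /andP[? ?]; apply: continuous_reflect; apply: cu; lra.
- move=> s /andP[? ?] sS us.
  have [| |l dl l0] := du (- s) _ _ us; first lra.
    by apply: contra sS => sS; apply/mapP; exists (- s) => //; rewrite opprK.
  by exists (- l); [exact: is_derive_reflect|lra].
- lra.
Qed.

(** A local comparison with the left neighbours makes sense also at the jumps
    of the diffusion, where a wave has just one-sided derivatives. The
    argument looks at the first time at which the value at y is reached. *)
Lemma left_incr u x y : x < y ->
  (forall t, x <= t <= y -> {for t, continuous u}) ->
  (forall t, x < t <= y -> \forall s \near t^'-, u s < u t) -> u x < u y.
Proof.
move=> xy cu lu.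
have wk z : x <= z <= y -> u x <= u z.
  move=> /andP[xz zy]; rewrite leNgt; apply/negP => uzx.
  have [|t [xt tz utz H]] := first_time xz _ uzx (lexx _).
    by move=> t /andP[? ?]; apply: cu; lra.
  have /near_leftE[e e0 He] : \forall s \near t^'-, u s < u t by apply: lu; lra.
  pose s := Num.max x (t - e / 2).
  have xs : x <= s by rewrite /s le_max lexx.
  have es : t - e / 2 <= s by rewrite /s le_max lexx orbT.
  have st : s < t by rewrite /s gt_max xt /=; lra.
  have := H s; rewrite xs st => /(_ isT).
  have := He s; rewrite st andbT utz => /(_ _); lra.
have /near_leftE[e e0 He] : \forall s \near y^'-, u s < u y by apply: lu; lra.
pose s := Num.max x (y - e / 2).
have xs : x <= s by rewrite /s le_max lexx.
have es : y - e / 2 <= s by rewrite /s le_max lexx orbT.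
have sy : s < y by rewrite /s gt_max xy /=; lra.
have := He s; rewrite sy andbT => /(_ _) us.
by apply: (le_lt_trans (wk s _)); [lra|apply: us; lra].
Qed.

(** An epsilon-delta form in which two-sided and one-sided differentiability
    can be compared. *)
Lemma is_deriveE_dist u z l : is_derive z 1 u l <->
  forall e, 0 < e -> exists2 r, 0 < r &
    forall s, `|s - z| < r -> `|u s - u z - l * (s - z)| <= e * `|s - z|.
Proof.
split=> [[du ul] e e0|H].
  move/cvg_ex: (du) => [l' /= ul'].
  have ll' : l' = l by rewrite -ul; apply/esym/cvg_lim.
  rewrite {}ll' {l'} in ul'.
  move/cvgrPdist_le: ul' => /(_ _ e0) /nearE_dist[r r0 Hr]; exists r => // s sr.
  have [->|sz] := eqVneq s z; first by rewrite !subrr mulr0 subrr normr0 mulr0.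
  have sz0 : s - z != 0 by rewrite subr_eq0.
  have := Hr (s - z); rewrite subr0 => /(_ sr sz0) /=.
  rewrite /GRing.scale /= mulr1 subrK distrC => H.
  have -> : u s - u z - l * (s - z) = ((s - z)^-1 * (u s - u z) - l) * (s - z).
    by field.
  by rewrite normrM ler_wpM2r.
have cl : h^-1 *: (u (h *: 1 + z) - u z) @[h --> 0^'] --> l.
  apply/cvgrPdist_le => e e0; have [r r0 Hr] := H e e0.
  apply/nearE_dist; exists r => // s; rewrite subr0 => sr s0.
  have := Hr (s + z); rewrite addrK => /(_ sr) Hs.
  rewrite /GRing.scale /= mulr1 distrC.
  have -> : s^-1 * (u (s + z) - u z) - l = s^-1 * (u (s + z) - u z - l * s).
    by field.
  by rewrite normrM normfV mulrC ler_pdivrMr ?normr_gt0.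
by split; [apply/cvg_ex; exists l | apply/cvg_lim].
Qed.

Lemma left_quotientE u z l : left_quotient_limit u z l <->
  forall e, 0 < e -> exists2 r, 0 < r &
    forall s, z - r < s < z -> `|u s - u z - l * (s - z)| <= e * (z - s).
Proof.
split=> [/cvgrPdist_le H e e0|H].
  have /near_leftE[r r0 Hr] := H e e0; exists r => // s /andP[rs sz].
  have := Hr (s - z) ltac:(lra); rewrite (_ : z + (s - z) = s); last ring.
  rewrite distrC => Hs.
  have sz0 : s - z != 0 by rewrite subr_eq0; apply/eqP; lra.
  have -> : u s - u z - l * (s - z) = ((s - z)^-1 * (u s - u z) - l) * (s - z).
    by field.
  rewrite normrM [X in _ * X <= _]ltr0_norm ?opprB; last lra.
  by rewrite ler_wpM2r //; lra.
apply/cvgrPdist_le => e e0; have [r r0 Hr] := H e e0.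
apply/near_leftE; exists r => // s /andP[rs s0].
have := Hr (z + s) ltac:(lra); rewrite (_ : z + s - z = s) => [Hs|]; last ring.
rewrite distrC.
have s0' : s != 0 by apply/eqP; lra.
have -> : s^-1 * (u (z + s) - u z) - l = s^-1 * (u (z + s) - u z - l * s).
  by field.
rewrite normrM normfV mulrC ler_pdivrMr ?normr_gt0// [X in _ <= _ * X]ltr0_norm//.
by apply: (le_trans Hs); rewrite ler_pM2l//; lra.
Qed.

Lemma right_quotientE u z l : right_quotient_limit u z l <->
  forall e, 0 < e -> exists2 r, 0 < r &
    forall s, z < s < z + r -> `|u s - u z - l * (s - z)| <= e * (s - z).
Proof.
split=> [/cvgrPdist_le H e e0|H].
  have /near_rightE[r r0 Hr] := H e e0; exists r => // s /andP[rs sz].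
  have := Hr (s - z) ltac:(lra); rewrite (_ : z + (s - z) = s); last ring.
  rewrite distrC => Hs.
  have sz0 : s - z != 0 by rewrite subr_eq0; apply/eqP; lra.
  have -> : u s - u z - l * (s - z) = ((s - z)^-1 * (u s - u z) - l) * (s - z).
    by field.
  rewrite normrM [X in _ * X <= _]gtr0_norm; last lra.
  by rewrite ler_wpM2r //; lra.
apply/cvgrPdist_le => e e0; have [r r0 Hr] := H e e0.
apply/near_rightE; exists r => // s /andP[s0 rs].
have := Hr (z + s) ltac:(lra); rewrite (_ : z + s - z = s) => [Hs|]; last ring.
rewrite distrC.
have s0' : s != 0 by apply/eqP; lra.
have -> : s^-1 * (u (z + s) - u z) - l = s^-1 * (u (z + s) - u z - l * s).
  by field.
by rewrite normrM normfV mulrC ler_pdivrMr ?normr_gt0// [X in _ <= _ * X]gtr0_norm.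
Qed.

Lemma is_derive_quotients u z l : is_derive z 1 u l ->
  left_quotient_limit u z l /\ right_quotient_limit u z l.
Proof.
move=> /is_deriveE_dist H; split.
  apply/left_quotientE => e /H[r r0 Hr]; exists r => // s zs.
  have sz : `|s - z| = z - s by rewrite ltr0_norm ?opprB//; lra.
  by rewrite -[X in _ <= _ * X]sz; apply: Hr; rewrite sz; lra.
apply/right_quotientE => e /H[r r0 Hr]; exists r => // s zs.
have sz : `|s - z| = s - z by rewrite gtr0_norm//; lra.
by rewrite -[X in _ <= _ * X]sz; apply: Hr; rewrite sz; lra.
Qed.

(** By the mean value theorem a limit of derivatives is a one-sided
    derivative. *)
Lemma left_derivative_limit u z l : {for z, continuous u} ->
  (\forall s \near z^'-, derivable u s 1) ->
  derive1 u s @[s --> z^'-] --> l -> left_quotient_limit u z l.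
Proof.
move=> cu /near_leftE[r1 r10 du] /cvgrPdist_le cl; apply/left_quotientE => e e0.
have /near_leftE[r2 r20 Hr] := cl e e0.
exists (Num.min r1 r2); first by rewrite lt_min r10.
move=> s /andP[]; rewrite ltrBlDr => zs sz.
have [m1 m2] : Num.min r1 r2 <= r1 /\ Num.min r1 r2 <= r2.
  by rewrite !ge_min !lexx orbT.
have [||c] := @MVT _ u (derive1 u) s z sz.
- move=> x; rewrite in_itv /= => /andP[? ?].
  have dx : derivable u x 1 by apply: du; lra.
  by rewrite derive1E; exact: DeriveDef.
- apply: continuous_in_subspaceT => t; rewrite inE /= in_itv /= => /andP[st tz].
  have [->//|tz'] := eqVneq t z.
  have dx : derivable u t 1 by apply: du; move: tz; rewrite le_eqVlt (negbTE tz') /= => tz; lra.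
  exact/differentiable_continuous/derivable1_diffP.
rewrite in_itv /= => /andP[sc cz] E.
have -> : u s - u z - l * (s - z) = (l - derive1 u c) * (z - s).
  by rewrite -[u s - u z]opprB E; ring.
rewrite normrM [X in _ * X](gtr0_norm) ?subr_gt0//.
by rewrite ler_pM2r ?subr_gt0//; apply: Hr; lra.
Qed.

Lemma right_derivative_limit u z l : {for z, continuous u} ->
  (\forall s \near z^'+, derivable u s 1) ->
  derive1 u s @[s --> z^'+] --> l -> right_quotient_limit u z l.
Proof.
move=> cu /near_rightE[r1 r10 du] /cvgrPdist_le cl; apply/right_quotientE => e e0.
have /near_rightE[r2 r20 Hr] := cl e e0.
exists (Num.min r1 r2); first by rewrite lt_min r10.
move=> s /andP[zs sz].
have [m1 m2] : Num.min r1 r2 <= r1 /\ Num.min r1 r2 <= r2.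
  by rewrite !ge_min !lexx orbT.
have [||c] := @MVT _ u (derive1 u) z s zs.
- move=> x; rewrite in_itv /= => /andP[? ?].
  have dx : derivable u x 1 by apply: du; lra.
  by rewrite derive1E; exact: DeriveDef.
- apply: continuous_in_subspaceT => t; rewrite inE /= in_itv /= => /andP[st tz].
  have [->//|tz'] := eqVneq t z.
  have dx : derivable u t 1.
    by apply: du; move: st; rewrite le_eqVlt eq_sym (negbTE tz') /= => st; lra.
  exact/differentiable_continuous/derivable1_diffP.
rewrite in_itv /= => /andP[sc cz] E.
have -> : u s - u z - l * (s - z) = (derive1 u c - l) * (s - z).
  by rewrite E; ring.
rewrite normrM [X in _ * X](gtr0_norm) ?subr_gt0//.
by rewrite ler_pM2r ?subr_gt0// distrC; apply: Hr; lra.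
Qed.

Lemma derivative_continuous u z l : is_derive z 1 u l -> {for z, continuous u}.
Proof. by case=> du _; exact/differentiable_continuous/derivable1_diffP. Qed.

(** The derivative only has to be identified, near each point, with a function
    that is continuous at that point. *)
Lemma C1_criterion (A : set R) (u phi : R -> R) :
  (forall z, A z -> {for z, continuous phi} /\ (\forall s \near z, is_derive (s : R) (1 : R) u (phi s))) ->
  C1_on A u.
Proof.
move=> Au z /Au[pC uD]; split.
  by have [] := nbhs_singleton uD.
have E : \forall s \near z, phi s = derive1 u s.
  by apply: filterS uD => s [_ us]; rewrite derive1E us.
rewrite /prop_for /continuous_at -(nbhs_singleton E).
by apply: cvg_trans pC; exact: near_eq_cvg.
Qed.

Lemma C1_on_union (u : R -> R) (A B : set R) : C1_on A u -> C1_on B u ->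
  C1_on (A `|` B) u.
Proof. by move=> uA uB z [/uA|/uB]. Qed.

Lemma C1_on_sub (u : R -> R) (A B : set R) : A `<=` B -> C1_on B u -> C1_on A u.
Proof. by move=> AB uB z /AB /uB. Qed.

End RealTools.

(** * Integrals of locally bounded functions *)

Section Integral.
Context {R : realType}.
Implicit Types (S : seq R) (k : R -> R) (x y z t l M : R).
Notation mu := lebesgue_measure.

(** Removing a point from an open set keeps it open, and a single point is
    harmless for measurability. *)
Lemma continuous_off_measurable S (A : set R) k : open A ->
  (forall t, A t -> t \notin S -> {for t, continuous k}) -> measurable_fun A k.
Proof.
elim: S A => [|s S IH] A oA ck.
  by apply: measurable_realfun.open_continuous_measurable_fun => // t; rewrite inE => At; exact: ck.
have oAs : open (A `\ s) by rewrite setDE; apply: openI => //; apply: closed_openC;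
    exact: (accessible_closed_set1 (hausdorff_accessible (@Rhausdorff R))).
have mAs : measurable_fun (A `\ s) k.
  apply: IH => // t [At /= /eqP ts] tS; apply: ck => //.
  by rewrite inE negb_or ts.
apply: (@measurable_funS _ _ _ _ ((A `\ s) `|` [set s])).
- by apply: measurableU; [exact: measurable_realfun.open_measurable|].
- by move=> t At; have [->|/eqP ts] := eqVneq t s; [right|left].
- apply/measurable_funU => //; first exact: measurable_realfun.open_measurable.
  by split => //; exact: measurable_fun_set1.
Qed.

Definition bounded_measurable k x y :=
  measurable_fun `[x, y] k /\ exists M, forall t, x <= t <= y -> `|k t| <= M.

Lemma continuous_off_bounded_measurable S k x y M :
  (forall t, x < t < y -> t \notin S -> {for t, continuous k}) ->
  (forall t, x <= t <= y -> `|k t| <= M) -> bounded_measurable k x y.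
Proof.
move=> ck kM; split; last by exists M.
apply: (@measurable_funS _ _ _ _ ((`]x, y[ `|` [set x]) `|` [set y])).
- by do 2 (apply: measurableU => //).
- move=> t /=; rewrite !in_itv /= => /andP[].
  rewrite !le_eqVlt => /orP[/eqP ->|xt]; first by left; right.
  by move=> /orP[/eqP ->|ty]; [right|left; left; apply/andP].
apply/measurable_funU => //; first exact: measurableU.
split; last exact: measurable_fun_set1.
apply/measurable_funU => //; split; last exact: measurable_fun_set1.
by apply: (@continuous_off_measurable S) => // t /=; rewrite in_itv /= => ?; exact: ck.
Qed.

Lemma bounded_measurable_integrable k x y :
  bounded_measurable k x y -> mu.-integrable `[x, y] (EFin \o k).
Proof.
move=> [mk [M kM]]; apply: measurable_bounded_integrable => //.
  by rewrite /= lebesgue_measure_itv /=; case: ifP => // _; rewrite -EFinB ltry.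
exists M; split; first exact: num_real.
move=> N MN t /=; rewrite in_itv /= => xty.
by apply: le_trans (ltW MN); exact: kM.
Qed.

Lemma Rintegral_bounds k x y l M : x <= y -> bounded_measurable k x y ->
  (forall t, x <= t <= y -> l <= k t <= M) ->
  l * (y - x) <= \int[mu]_(t in `[x, y]) k t <= M * (y - x).
Proof.
move=> xy bk lkM.
have muE : fine (mu `[x, y]) = y - x.
  rewrite lebesgue_measure_itv /= lte_fin.
  by move: xy; rewrite le_eqVlt => /orP[/eqP ->|->//]; rewrite ltxx subrr.
have icst (c : R) : mu.-integrable `[x, y] (EFin \o cst c).
  apply: bounded_measurable_integrable; split; first exact: measurable_cst.
  by exists `|c|.
have ik := bounded_measurable_integrable bk.
rewrite -!muE -!Rintegral_cst//; apply/andP; split; apply: le_Rintegral => //;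
  by [exact: icst | move=> t; rewrite /= in_itv /= => /lkM /andP[]].
Qed.

(** I is meant to be an interval. Bounds may blow up at its missing ends, as
    they do for the derivative of the position of a wave, which may fail to be
    integrable up to 0 or 1. *)
Definition locally_bounded_measurable (I : set R) k :=
  forall x y, I x -> I y -> x <= y -> bounded_measurable k x y.

Section LocallyBounded.
Variables (I : set R) (k : R -> R).
Hypothesis Ik : locally_bounded_measurable I k.

Lemma Rintegral_cat x y z : I x -> I y -> I z -> x <= y -> y <= z ->
  \int[mu]_(t in `[x, z]) k t =
  \int[mu]_(t in `[x, y]) k t + \int[mu]_(t in `[y, z]) k t.
Proof.
move=> Ix Iy Iz xy yz.
have ixz : mu.-integrable `[x, z] (EFin \o k).
  by apply: bounded_measurable_integrable; apply: Ik => //; lra.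
have iyz : mu.-integrable `[y, z] (EFin \o k).
  by apply: bounded_measurable_integrable; apply: Ik => //; lra.
rewrite -(@Rintegral_itv_obnd_cbnd _ y (BRight z)); last first.
  apply: integrableS iyz => // t /=; rewrite !in_itv /= => /andP[yt ->].
  by rewrite ltW.
rewrite -(@Rintegral_itvB _ k (BLeft x) (BRight z) y) ?bnd_simp//.
by rewrite addrC subrK.
Qed.

Lemma oriented_integral_cat x y z : I x -> I y -> I z ->
  oriented_integral k x z = oriented_integral k x y + oriented_integral k y z.
Proof.
move=> Ix Iy Iz; rewrite /oriented_integral.
have [xz|zx] := leP x z; have [xy|yx] := leP x y; have [yz|zy] := leP y z; try lra.
- by rewrite (@Rintegral_cat x y z).
- by rewrite (@Rintegral_cat x z y) //; [ring | lra].
- by rewrite (@Rintegral_cat y x z) //; [ring | lra].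
- by rewrite (@Rintegral_cat z x y) //; [ring | lra].
- by rewrite (@Rintegral_cat y z x) //; [ring | lra].
- by rewrite (@Rintegral_cat z y x) //; [ring | lra | lra].
Qed.

(** With l = 0 this bounds the integral; with l = k x it says that k is the
    derivative of the integral at its points of continuity. *)
Lemma oriented_integral_near x y l M : I x -> I y ->
  (forall t, (x <= t <= y) || (y <= t <= x) -> `|k t - l| <= M) ->
  `|oriented_integral k x y - l * (y - x)| <= M * `|y - x|.
Proof.
move=> Ix Iy kM; rewrite /oriented_integral; have [xy|yx] := leP x y.
  have /(_ _)/andP[] := @Rintegral_bounds k x y (l - M) (l + M) xy (Ik Ix Iy xy).
    by move=> t xty; have := kM t; rewrite xty => /(_ isT); rewrite ler_norml; lra.
  by move=> h1 h2; rewrite (ger0_norm (x := y - x)) ?subr_ge0// ler_norml; nra.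
have /(_ _)/andP[] := @Rintegral_bounds k y x (l - M) (l + M) (ltW yx) (Ik Iy Ix (ltW yx)).
  by move=> t xty; have := kM t; rewrite xty orbT => /(_ isT); rewrite ler_norml; lra.
by move=> h1 h2; rewrite (ltr0_norm (x := y - x)) ?subr_lt0// ler_norml; nra.
Qed.

Lemma oriented_integral_continuous x t : I x -> (\forall s \near t, I s) ->
  {for t, continuous (oriented_integral k x)}.
Proof.
move=> Ix /nearE_dist[e e0 It].
have It' s : `|s - t| < e -> I s := It s.
have I1 : I (t - e / 2) by apply: It'; rewrite ltr0_norm; lra.
have I2 : I (t + e / 2) by apply: It'; rewrite gtr0_norm; lra.
have It0 : I t by apply: It'; rewrite subrr normr0.
have [|_ [M kM]] := Ik I1 I2; first lra.
have M0 : 0 <= M by apply: (le_trans (normr_ge0 (k t))); apply: kM; lra.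
apply/cvgrPdist_le => d d0; apply/nearE_dist.
exists (Num.min (e / 2) (d / (M + 1))).
  by rewrite lt_min !divr_gt0//; lra.
move=> s; rewrite lt_min => /andP[s1 s2].
have Is : I s by apply: It'; lra.
rewrite (oriented_integral_cat Ix It0 Is) opprD addNKr normrN.
have := @oriented_integral_near t s 0 M It0 Is.
rewrite mul0r subr0 => /(_ _) H.
apply: le_trans (H _) _.
  move=> u tu; rewrite subr0; apply: kM.
  by move: s1; rewrite ltr_norml; move: tu => /orP[]; lra.
rewrite ltr_pdivlMr in s2; last lra.
by have := normr_ge0 (s - t); nra.
Qed.

Lemma oriented_integral_derive x t : I x -> (\forall s \near t, I s) ->
  {for t, continuous k} -> is_derive t 1 (oriented_integral k x) (k t).
Proof.
move=> Ix /nearE_dist[e e0 It] ck; apply/is_deriveE_dist => d d0.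
have It' s : `|s - t| < e -> I s := It s.
have It0 : I t by apply: It'; rewrite subrr normr0.
move/cvgrPdist_le: (ck) => /(_ _ d0) /nearE_dist[e1 e10 He1].
exists (Num.min e e1); first by rewrite lt_min e0.
move=> s; rewrite lt_min => /andP[s1 s2].
have Is : I s by apply: It'.
rewrite (oriented_integral_cat Ix It0 Is) [X in X - _ * _]addrAC subrr add0r.
apply: oriented_integral_near => // u tu; rewrite distrC; apply: He1.
by move: s2; rewrite !ltr_norml; move: tu => /orP[]; lra.
Qed.

End LocallyBounded.

Lemma oriented_integral_eq k k' x y :
  (forall t, (x <= t <= y) || (y <= t <= x) -> k t = k' t) ->
  oriented_integral k x y = oriented_integral k' x y.
Proof.
move=> kk'; rewrite /oriented_integral; case: ifPn => [xy|_]; [|congr (- _)];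
  apply: eq_Rintegral => t; rewrite inE /= in_itv /= => xty; apply: kk';
  by rewrite xty ?orbT.
Qed.

Lemma oriented_integral_xx k x : oriented_integral k x x = 0.
Proof. by rewrite /oriented_integral lexx set_itv1 Rintegral_set1. Qed.

Lemma continuous_locally_bounded_measurable k : continuous k ->
  locally_bounded_measurable setT k.
Proof.
move=> ck x y _ _ xy; split.
  apply: measurable_funTS; exact: measurable_realfun.continuous_measurable_fun.
have [||c _ Hc] := @EVT_max R (fun t => `|k t|) x y; first exact: xy.
  by apply: continuous_subspaceT => t; apply: continuous_comp; [exact: ck|exact: norm_continuous].
by exists `|k c| => t xty; apply: Hc; rewrite in_itv.
Qed.

End Integral.

(** * Real powers and Picard iteration *)

Section Powers.
Context {R : realType}.
Implicit Types (u v a b M : R).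

Lemma is_derive_powR u b : 0 < u ->
  is_derive u 1 (fun x => x `^ b) (b * u `^ (b - 1)).
Proof.
move=> u0; have ui : u \in `]0, +oo[ by rewrite in_itv /= u0.
have := powR_derive1 b ui; rewrite derive1E => <-.
by apply: DeriveDef => //; exact: derivable_powR.
Qed.

Lemma powR_continuous u b : 0 < u -> {for u, continuous (fun x : R => x `^ b)}.
Proof. by move=> /(is_derive_powR b)/derivative_continuous. Qed.

Lemma ler_powRN u v b : 0 <= b -> 0 < u -> u <= v -> v `^ (- b) <= u `^ (- b).
Proof.
move=> b0 u0 uv; rewrite !powRN lef_pV2 ?posrE ?powR_gt0//; last lra.
by apply: ge0_ler_powR => //; rewrite nnegrE; lra.
Qed.

(** The singularity of w^{-a} that repels small solutions. *)
Lemma powRN_unbounded b M : 0 < b ->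
  exists2 d, 0 < d & forall u, 0 < u -> u <= d -> M <= u `^ (- b).
Proof.
move=> b0; pose N := Num.max M 1.
have N0 : 0 < N by rewrite lt_max ltr01 orbT.
exists (N `^ (- b^-1)); first exact: powR_gt0.
move=> u u0 ud; apply: (@le_trans _ _ N); first by rewrite le_max lexx.
apply: le_trans (ler_powRN (ltW b0) u0 ud).
by rewrite -powRrM mulrNN mulVf ?powRr1 ?lt0r_neq0// ltW.
Qed.

Lemma powR_lipschitz a d u v : 0 <= a -> 0 < d -> d <= u -> d <= v ->
  `|u `^ (- a) - v `^ (- a)| <= a * d `^ (- a - 1) * `|u - v|.
Proof.
move=> a0 d0; wlog uv : u v / u <= v => [H du dv|].
  by have [/H|/ltW/H] := leP u v; [exact|rewrite distrC [`|v - u|]distrC; exact].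
move: uv; rewrite le_eqVlt => /orP[/eqP -> _ _|uv du dv].
  by rewrite !subrr normr0 mulr0.
have [||c] := @MVT _ (fun x : R => x `^ (- a)) (fun x => - a * x `^ (- a - 1)) u v uv.
- by move=> x; rewrite in_itv /= => /andP[? ?]; apply: is_derive_powR; lra.
- apply: continuous_in_subspaceT => t; rewrite inE /= in_itv /= => /andP[? ?].
  by apply: powR_continuous; lra.
rewrite in_itv /= => /andP[uc cv] E.
rewrite distrC E !normrM normrN (ger0_norm a0) [`|v - u|]distrC.
rewrite ler_wpM2r// ler_wpM2l// ger0_norm ?powR_ge0//.
by rewrite -opprD; apply: ler_powRN; lra.
Qed.

End Powers.

Section Picard.
Context {R : realType}.
Implicit Types (x y : R -> R) (s t c : R) (n : nat).

Lemma le_half_expn (a b z : R) :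
  (forall n : nat, a <= b + z * 2^-1 ^+ n) -> a <= b.
Proof.
move=> H; apply/ler_addgt0Pr => e e0.
pose n := Num.bound (z / e).
apply: (le_trans (H n)); rewrite lerD2l.
have [z0|z0] := leP z 0.
  by apply: le_trans (ltW e0); rewrite mulr_le0_ge0// exprn_ge0// invr_ge0.
have : z / e < n%:R.
  have := archi_boundP (divr_ge0 (ltW z0) (ltW e0)); exact.
rewrite ltr_pdivrMr// => zn.
have n2 : (n%:R <= 2 ^+ n :> R) by rewrite -natrX ler_nat ltnW// ltn_expl.
rewrite exprVn ler_pdivrMr ?exprn_gt0//.
by have := ltW e0; nra.
Qed.

Variables (A B psi : R -> R) (S : seq R) (K L Q w1 : R).
Hypothesis AC : forall t, t \notin S -> {for t, continuous A}.
Hypothesis BC : forall t, t \notin S -> {for t, continuous B}.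
Hypothesis AK : forall t, `|A t| <= K.
Hypothesis BK : forall t, `|B t| <= K.
Hypothesis A0 : forall t, 1 <= t -> A t = 0.
Hypothesis B0 : forall t, 1 <= t -> B t = 0.
Hypothesis psiL : forall u v, `|psi u - psi v| <= L * `|u - v|.
Hypothesis psiQ : forall u, `|psi u| <= Q.

Let K0 : 0 <= K. Proof. exact: le_trans (AK 0). Qed.
Let Q0 : 0 <= Q. Proof. exact: le_trans (psiQ 0). Qed.
Let L0 : 0 <= L.
Proof. by have := le_trans (normr_ge0 _) (psiL 1 0); rewrite subr0 normr1 mulr1. Qed.

Let psiC : continuous psi.
Proof.
move=> u; apply/cvgrPdist_le => e e0; apply/nearE_dist.
have L0' := L0; exists (e / (L + 1)); first by rewrite divr_gt0//; lra.
move=> v; rewrite ltr_pdivlMr; last lra.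
by move=> uv; have := psiL u v; rewrite distrC [`|u - v|]distrC; have := normr_ge0 (v - u); nra.
Qed.

Let G (x : R -> R) t := A t + B t * psi (x t).
Let M := K + K * Q.
Let M0 : 0 <= M. Proof. by rewrite addr_ge0// mulr_ge0. Qed.

Let GM x t : `|G x t| <= M.
Proof.
rewrite /G; apply: le_trans (ler_normD _ _) _; apply: lerD => //.
by rewrite normrM ler_pM.
Qed.

Let GC x t : continuous x -> t \notin S -> {for t, continuous (G x)}.
Proof.
move=> cx tS; apply: cvgD; first exact: AC.
apply: cvgM; first exact: BC.
by apply: continuous_comp; [exact: cx|exact: psiC].
Qed.

Let GI x : continuous x -> locally_bounded_measurable setT (G x).
Proof.
move=> cx y z _ _ yz.
by apply: (@continuous_off_bounded_measurable _ S _ _ _ M) => // t _; exact: GC.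
Qed.

Let T x t := w1 - oriented_integral (G x) 1 t.

Let TC x : continuous x -> continuous (T x).
Proof.
move=> cx t; apply: cvgB; first exact: cvg_cst.
by apply: (@oriented_integral_continuous _ _ _ (GI cx) 1 t I); exact: filterT. 
Qed.

Let TD x t : continuous x -> t \notin S -> is_derive t 1 (T x) (- G x t).
Proof.
move=> cx tS; rewrite -[- G x t]add0r; apply: is_deriveB.
by apply: (oriented_integral_derive (GI cx)) => //; [exact: filterT|exact: GC].
Qed.

Let TL x s t : continuous x -> `|T x s - T x t| <= M * `|s - t|.
Proof.
move=> cx; rewrite /T (@oriented_integral_cat _ _ _ (GI cx) 1 s t)//.
have -> : forall p q r : R, p - q - (p - (q + r)) = r by move=> *; ring.
have := @oriented_integral_near _ _ _ (GI cx) s t 0 M I I.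
rewrite mul0r subr0 distrC [`|s - t|]distrC; apply.
by move=> u _; rewrite subr0.
Qed.

Let T1 x t : continuous x -> 1 <= t -> T x t = w1.
Proof.
move=> cx t1; rewrite /T; suff -> : oriented_integral (G x) 1 t = 0 by rewrite subr0.
have := @oriented_integral_near _ _ _ (GI cx) 1 t 0 0 I I.
rewrite mul0r subr0 mul0r normr_le0 => H; apply/eqP/H => u.
move=> /orP[/andP[u1 _]|/andP[tu u1]]; rewrite subr0 /G A0 ?B0 ?mul0r ?addr0 ?normr0//; lra.
Qed.

Let lam := K * L + 1.
(** The weight for which the integral operator halves distances; it dominates
    the initial error because expR s >= s. *)
Let E t : R := expR (2 * lam * (1 - t)).
Let lam1 : 1 <= lam. Proof. by have := mulr_ge0 K0 L0; rewrite /lam; lra. Qed.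
Let E0 t : 0 < E t. Proof. exact: expR_gt0. Qed.

Let ED (t : R) : is_derive t (1:R) E (- (2 * lam * E t)).
Proof.
have -> : - (2 * lam * E t) = E t * (2 * lam * (- 1)) by ring.
apply: (@is_derive1_comp R expR (fun s : R => 2 * lam * (1 - s)) t (expR (2 * lam * (1 - t)))).
apply: is_deriveZ; rewrite -[-1]add0r; exact: is_deriveB.
Qed.

Let Thalf x y c : continuous x -> continuous y ->
  (forall t, `|x t - y t| <= c * E t) ->
  forall t, `|T x t - T y t| <= c * 2^-1 * E t.
Proof.
move=> cx cy xy t.
have c0 : 0 <= c.
  by have := le_trans (normr_ge0 _) (xy 0); rewrite pmulr_lge0.
have [t1|t1] := leP 1 t.
  by rewrite !T1// subrr normr0 !mulr_ge0// ltW.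
pose b t := c * 2^-1 * E t.
have bD s : is_derive s 1 b (- (c * lam * E s)).
  have -> : - (c * lam * E s) = c * 2^-1 * (- (2 * lam * E s)) by field.
  exact: is_deriveZ.
have bC : continuous b by move=> s; exact: (derivative_continuous (bD s)).
have GL s : `|G x s - G y s| <= c * lam * E s.
  have -> : G x s - G y s = B s * (psi (x s) - psi (y s)) by rewrite /G; ring.
  rewrite normrM; have := psiL (x s) (y s); have := xy s; have := BK s.
  have := normr_ge0 (x s - y s); have := normr_ge0 (B s).
  have := normr_ge0 (psi (x s) - psi (y s)); have := E0 s.
  rewrite /lam; set p := `|_|; set q := `|_|; set r := `|_|; set e := E s.
  move=> ? ? ? ? ? ? ?.
  have : q * p <= K * (L * (c * e)).
    apply: ler_pM => //; apply: (le_trans (y := L * r)) => //.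
    by rewrite ler_wpM2l.
  have : 0 <= c * e by rewrite mulr_ge0// ltW.
  lra.
rewrite ler_norml; apply/andP; split.
- have : (- T x + T y - b) t <= (- T x + T y - b) 1.
    apply: (@ndecr_off _ S); first exact: ltW.
      move=> s _; apply: cvgB; last exact: bC.
      by apply: cvgD; [apply: cvgN|]; exact: TC.
    move=> s /andP[_ s1] sS; exists (- (- G x s) + - G y s - (- (c * lam * E s))).
      by apply: is_deriveB; apply: is_deriveD; [apply: is_deriveN|]; exact: TD.
    by have := GL s; rewrite ler_norml; lra.
  rewrite !fctE (T1 cx (lexx 1)) (T1 cy (lexx 1)).
  have : 0 <= b 1 by rewrite /b !mulr_ge0// ltW.
  by rewrite /b; lra.
- have : (T x - T y - b) t <= (T x - T y - b) 1.
    apply: (@ndecr_off _ S); first exact: ltW.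
      move=> s _; apply: cvgB; last exact: bC.
      by apply: cvgB; exact: TC.
    move=> s /andP[_ s1] sS; exists (- G x s - - G y s - (- (c * lam * E s))).
      by apply: is_deriveB; apply: is_deriveB; exact: TD.
    by have := GL s; rewrite ler_norml; lra.
  rewrite !fctE (T1 cx (lexx 1)) (T1 cy (lexx 1)).
  have : 0 <= b 1 by rewrite /b !mulr_ge0// ltW.
  by rewrite /b; lra.
Qed.

Let X n := iter n T (cst w1).

Let XC n : continuous (X n).
Proof. by elim: n => [|n IH]; [exact: cst_continuous|exact: TC]. Qed.

Let Xstep n t : `|X n.+1 t - X n t| <= M * 2^-1 ^+ n * E t.
Proof.
elim: n t => [|n IH] t; last first.
  by rewrite exprSr mulrA; exact: (@Thalf (X n.+1) (X n) _ (@XC n.+1) (@XC n) IH).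
rewrite expr0 mulr1 /X /=.
have [t1|t1] := leP 1 t.
  by rewrite T1 ?subrr ?normr0 ?mulr_ge0// ?ltW//; exact: cst_continuous.
have := @TL (cst w1) t 1 (@cst_continuous _ _ _).
rewrite (@T1 _ 1)//; last exact: cst_continuous.
move/le_trans; apply; rewrite ler_wpM2l// distrC ger0_norm; last lra.
apply: le_trans (expR_ge1Dx _).
by have := lam1; nra.
Qed.

(** Y increases and Z decreases with n, and they squeeze the fixed point, which
    can therefore be defined as a supremum. *)
Let Y n t := X n t - 2 * M * 2^-1 ^+ n * E t.
Let Z n t := X n t + 2 * M * 2^-1 ^+ n * E t.

Let YS n t : Y n t <= Y n.+1 t.
Proof. by have := Xstep n t; rewrite /Y exprSr ler_norml; lra. Qed.
Let ZS n t : Z n.+1 t <= Z n t.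
Proof. by have := Xstep n t; rewrite /Z exprSr ler_norml; lra. Qed.
Let YZ n t : Y n t <= Z n t.
Proof.
have : 0 <= 2 * M * 2^-1 ^+ n * E t.
  by rewrite !mulr_ge0// ?exprn_ge0// ?invr_ge0// ltW.
by rewrite /Y /Z; lra.
Qed.

Let YZmn m n t : Y m t <= Z n t.
Proof.
have Yh p q : (p <= q)%N -> Y p t <= Y q t.
  elim: q => [|q IH]; first by rewrite leqn0 => /eqP ->.
  rewrite leq_eqVlt => /orP[/eqP ->//|]; rewrite ltnS => /IH pq.
  exact: le_trans (YS _ _).
have Zh p q : (p <= q)%N -> Z q t <= Z p t.
  elim: q => [|q IH]; first by rewrite leqn0 => /eqP ->.
  rewrite leq_eqVlt => /orP[/eqP ->//|]; rewrite ltnS => /IH pq.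
  exact: le_trans (ZS _ _) _.
apply: (le_trans (Yh m (maxn m n) (leq_maxl _ _))).
apply: (le_trans (YZ _ _)); exact: (Zh _ _ (leq_maxr _ _)).
Qed.

Let x t := sup (range (fun n => Y n t)).

Let xX n t : `|x t - X n t| <= 2 * M * 2^-1 ^+ n * E t.
Proof.
have h1 : Y n t <= x t.
  apply: ub_le_sup; last by exists n.
  by exists (Z 0%N t) => _ [m _ <-].
have h2 : x t <= Z n t.
  by apply: ge_sup; [exists (Y 0%N t), 0%N | move=> _ [m _ <-]].
by move: h1 h2; rewrite /Y /Z ler_norml; lra.
Qed.

Let xL s t : `|x s - x t| <= M * `|s - t|.
Proof.
apply: (@le_half_expn _ _ (2 * M * E s + 2 * M * E t + M * `|s - t|)) => -[|n].
  rewrite expr0 mulr1.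
  have h1 := xX 0 s; have h2 := xX 0 t; rewrite expr0 mulr1 in h1 h2.
  have : `|X 0 s - X 0 t| <= 0 by rewrite /X /= subrr normr0.
  have : 0 <= M * `|s - t| by rewrite mulr_ge0.
  by move: h1 h2; rewrite !ler_norml; lra.
have h1 := xX n.+1 s; have h2 := xX n.+1 t.
have h3 := @TL _ s t (@XC n).
have h4 : 0 <= M * `|s - t| * 2^-1 ^+ n.+1.
  by rewrite mulr_ge0 ?mulr_ge0// ?exprn_ge0// invr_ge0.
rewrite -/(X n.+1) in h3.
have -> : x s - x t = (x s - X n.+1 s) - (x t - X n.+1 t) + (X n.+1 s - X n.+1 t).
  by ring.
apply: le_trans (ler_normD _ _) _.
have := ler_normB (x s - X n.+1 s) (x t - X n.+1 t).
by move: h1 h2 h3 h4; rewrite /X /= ; lra.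
Qed.

Let xC : continuous x.
Proof.
move=> t; apply/cvgrPdist_le => e e0; apply/nearE_dist.
have M0' := M0; exists (e / (M + 1)); first by rewrite divr_gt0//; lra.
move=> s; rewrite ltr_pdivlMr; last lra.
by move=> st; have := xL t s; rewrite [`|t - s|]distrC; have := normr_ge0 (s - t); nra.
Qed.

Let xfix t : T x t = x t.
Proof.
apply/eqP; rewrite -subr_eq0 -normr_le0.
apply: (@le_half_expn _ _ (2 * M * E t)) => n; rewrite add0r.
have h1 := xX n.+1 t.
have h2 := @Thalf x (X n) _ xC (@XC n) (xX n) t.
have -> : T x t - x t = (T x t - T (X n) t) - (x t - X n.+1 t) by rewrite /X /=; ring.
apply: le_trans (ler_normB _ _) _.
by move: h1 h2; rewrite exprSr; lra.
Qed.

(** The equation is solved backwards from t = 1. All data vanish for t >= 1,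
    so that the iterates are constant there. In the weighted supremum norm
    below the integral operator halves distances. *)
Lemma picard : exists x : R -> R, [/\ continuous x, x 1 = w1 &
  forall t, t \notin S -> is_derive t 1 x (- (A t + B t * psi (x t)))].
Proof.
exists x; split; first exact: xC.
- by rewrite -xfix T1.
- move=> t tS; have := TD xC tS.
  have -> : T x = x by apply/funext => s; exact: xfix.
  exact.
Qed.

End Picard.

(** * Profiles: the singular first-order problem *)

Section Truncation.
Context {R : realType}.

Lemma continuous_cut (k : R -> R) (t : R) : t != 0 -> t != 1 ->
  (0 < t < 1 -> {for t, continuous k}) ->
  {for t, continuous (fun s : R => if 0 < s < 1 then k s else 0)}.
Proof.
move=> t0 t1 kC; have [t01|nt01] := boolP (0 < t < 1).
  have cE : \forall s \near t, k s = if 0 < s < 1 then k s else 0.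
    apply/nearE_dist; exists (Num.min t (1 - t)); first by rewrite lt_min; lra.
    move=> s; rewrite lt_min !ltr_norml => st; have -> // : 0 < s < 1; lra.
  have := kC t01; rewrite /prop_for /continuous_at t01 => kt.
  by apply: cvg_trans kt; exact: near_eq_cvg.
have cE : \forall s \near t, 0 = if 0 < s < 1 then k s else 0.
  move: nt01; rewrite negb_and -!leNgt => /orP[tle|tge].
    have tlt : t < 0 by rewrite lt_neqAle t0.
    apply/nearE_dist; exists (- t); first lra.
    move=> s; rewrite ltr_norml => st; case: ifP => //; lra.
  have tgt : 1 < t by rewrite lt_neqAle eq_sym t1.
  apply/nearE_dist; exists (t - 1); first lra.
  move=> s; rewrite ltr_norml => st; case: ifP => //; lra.
rewrite /prop_for /continuous_at (negbTE nt01).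
by apply: (cvg_trans (near_eq_cvg cE)); exact: cvg_cst.
Qed.

Lemma max_lipschitz (u v e : R) : `|Num.max u e - Num.max v e| <= `|u - v|.
Proof.
have h1 := ler_norm (u - v); have h2 := ler_norm (v - u).
rewrite distrC in h2.
by have [ue|eu] := leP u e; have [ve|ev] := leP v e; rewrite ?subrr ?normr0// ler_norml; lra.
Qed.

(** A mean value inequality that ignores finitely many points. *)
Lemma lipschitz_off (S : seq R) (u : R -> R) (K x y : R) : x <= y ->
  (forall t, x <= t <= y -> {for t, continuous u}) ->
  (forall t, x < t < y -> t \notin S -> exists2 l, is_derive t 1 u l & `|l| <= K) ->
  `|u y - u x| <= K * (y - x).
Proof.
move=> xy uC uD.
have lin (t : R) : is_derive t (1 : R) (fun s : R => K * s) K.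
  by rewrite -{2}[K]mulr1; exact: is_deriveZ.
have linC : continuous (fun s : R => K * s).
  by move=> t; exact: (derivative_continuous (lin t)).
have h1 : ((fun s => K * s) - u) x <= ((fun s => K * s) - u) y.
  apply: (@ndecr_off _ S); first exact: xy.
    by move=> t xty; apply: cvgB; [exact: linC|exact: uC].
  move=> t xty tS; have [l ul lK] := uD t xty tS.
  by exists (K - l); [exact: is_deriveB|move: lK; rewrite ler_norml; lra].
have h2 : ((fun s => K * s) + u) x <= ((fun s => K * s) + u) y.
  apply: (@ndecr_off _ S); first exact: xy.
    by move=> t xty; apply: cvgD; [exact: linC|exact: uC].
  move=> t xty tS; have [l ul lK] := uD t xty tS.
  by exists (K + l); [exact: is_deriveD|move: lK; rewrite ler_norml; lra].
by move: h1 h2; rewrite !fctE ler_norml; lra.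
Qed.

Lemma lipschitz_off_dist (S : seq R) (u : R -> R) (K r s t : R) :
  continuous u -> `|s - t| < r ->
  (forall x, `|x - t| < r -> x \notin S -> exists2 l, is_derive x 1 u l & `|l| <= K) ->
  `|u s - u t| <= K * `|s - t|.
Proof.
move=> uC sr uD; rewrite ltr_norml in sr.
have [ts|st] := leP t s.
  rewrite [`|s - t|]ger0_norm ?subr_ge0//.
  apply: (@lipschitz_off S) => //; first by move=> x _; exact: uC.
  by move=> x xs; apply: uD; rewrite ltr_norml; lra.
rewrite distrC [`|s - t|]distrC [`|t - s|]gtr0_norm ?subr_gt0//.
apply: (@lipschitz_off S); [exact: ltW|by move=> x _; exact: uC|].
by move=> x xs; apply: uD; rewrite ltr_norml; lra.
Qed.

(** Near t the derivatives of all W e with small e are close to l; pointwise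
    convergence transports the resulting bounds on increments to w. *)
Lemma limit_is_derive (S : seq R) (W : R -> R -> R) (w : R -> R) (t l r : R) :
  0 < r -> (forall e, 0 < e -> continuous (W e)) ->
  (forall s, `|s - t| < r -> forall x, 0 < x ->
     exists2 e1, 0 < e1 & forall e, 0 < e -> e <= e1 -> `|W e s - w s| <= x) ->
  (forall x, 0 < x -> exists r1 e1, [/\ 0 < r1, 0 < e1 &
     forall e u, 0 < e -> e <= e1 -> `|u - t| < r1 -> u \notin S ->
       exists2 l', is_derive u 1 (W e) l' & `|l' - l| <= x]) ->
  is_derive t 1 w l.
Proof.
move=> r0 WC Ww WD; apply/is_deriveE_dist => x x0.
have [r1 [e1 [r10 e10 HD]]] := WD x x0.
exists (Num.min r r1); first by rewrite lt_min r0.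
move=> s; rewrite lt_min => /andP[sr sr1]; apply/ler_addgt0Pr => y y0.
have y20 : 0 < y / 2 by rewrite divr_gt0.
have [e2 e20 H2] := Ww s sr _ y20.
have [|e3 e30 H3] := Ww t _ _ y20; first by rewrite subrr normr0.
pose e := Num.min e1 (Num.min e2 e3).
have e0 : 0 < e by rewrite !lt_min e10 e20.
have [ee1 ee2 ee3] : [/\ e <= e1, e <= e2 & e <= e3] by rewrite !ge_min !lexx !orbT.
have linD (u : R) : is_derive u (1 : R) (fun s : R => l * s) l.
  by rewrite -{2}[l]mulr1; exact: is_deriveZ.
have : `|(W e - (fun s : R => l * s)) s - (W e - (fun s : R => l * s)) t| <= x * `|s - t|.
  apply: (@lipschitz_off_dist S _ x r1) => //.
    move=> u; apply: cvgB; first exact: WC.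
    exact: (derivative_continuous (linD u)).
  move=> u ur uS; have [l' Wl' l'x] := HD e u e0 ee1 ur uS.
  by exists (l' - l) => //; exact: is_deriveB.
rewrite !fctE; have := H2 e e0 ee2; have := H3 e e0 ee3.
by rewrite !ler_norml; lra.
Qed.

End Truncation.

Section Profile.
Context {R : realType}.
Variables (a B F : R) (S : seq R) (h f : R -> R).
Implicit Types (w : R -> R) (t s c e phi x : R).

Record profile c w : Prop := Profile {
  profile_gt0 : forall t, 0 < t < 1 -> 0 < w t ;
  profile_continuous : forall t, 0 < t < 1 -> {for t, continuous w} ;
  profile_derive : forall t, 0 < t < 1 -> t \notin S ->
    is_derive t 1 w (c - h t - f t * w t `^ (- a)) ;
  profile_at1 : w t @[t --> 1^'-] --> (0 : R) }.

Hypothesis a_gt0 : 0 < a.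
Hypothesis hB : forall t, 0 < t < 1 -> `|h t| <= B.
Hypothesis fF : forall t, 0 < t < 1 -> f t <= F.
Hypothesis f_lb : forall t, 0 < t < 1 ->
  exists2 phi, 0 < phi & \forall s \near t, phi <= f s.
Hypothesis hC : forall t, 0 < t < 1 -> t \notin S -> {for t, continuous h}.
Hypothesis fC : forall t, 0 < t < 1 -> t \notin S -> {for t, continuous f}.

Let half01 : 0 < (1 / 2 : R) < 1. Proof. by lra. Qed.

Lemma B_ge0 : 0 <= B.
Proof. exact: le_trans (hB half01). Qed.

Lemma f_gt0 t : 0 < t < 1 -> 0 < f t.
Proof.
by move=> /f_lb[phi phi0 /nbhs_singleton]; apply: lt_le_trans.
Qed.

Lemma F_gt0 : 0 < F.
Proof. exact: lt_le_trans (f_gt0 half01) (fF half01). Qed.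

Section Regularized.
Variable c : R.

Definition drift_size := `|c| + B + 1.

Lemma drift_size_ge1 : 1 <= drift_size.
Proof. by have := B_ge0; have := normr_ge0 c; rewrite /drift_size; lra. Qed.

(** The multiple of e^a is chosen so that source_lift e divided by e^a is
    drift_size, which exceeds the size of c - h: the constant e is then a
    strict barrier for the solution that equals e at t = 1. *)
Definition source_lift (e : R) := drift_size * e `^ a.

Lemma source_liftE e : 0 < e -> source_lift e * e `^ (- a) = drift_size.
Proof.
by move=> e0; rewrite /source_lift -mulrA powRN divff ?mulr1// gt_eqF// powR_gt0.
Qed.

Lemma source_lift_ge0 e : 0 <= source_lift e.
Proof. by rewrite mulr_ge0 ?powR_ge0//; have := drift_size_ge1; lra. Qed.

Lemma ler_source_lift e e' : 0 < e -> e <= e' -> source_lift e <= source_lift e'.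
Proof.
move=> e0 ee'; rewrite /source_lift ler_wpM2l//; first by have := drift_size_ge1; lra.
by apply: (ge0_ler_powR (ltW a_gt0)); rewrite ?nnegrE //; [exact: ltW|exact: le_trans (ltW e0) ee'].
Qed.

Lemma source_lift_small x : 0 < x -> exists2 e1, 0 < e1 &
  forall e, 0 < e -> e <= e1 -> source_lift e < x.
Proof.
move=> x0; have d0 : 0 < drift_size := lt_le_trans ltr01 drift_size_ge1.
have xd : 0 < x / drift_size by rewrite divr_gt0.
have /cvgrPdist_lt/(_ _ xd)[r r0 Hr] := powR_cvg0 a_gt0.
exists (r / 2); first by rewrite divr_gt0.
move=> e e0 er; have := Hr e; rewrite /= sub0r normrN gtr0_norm// => /(_ _ e0).
rewrite sub0r normrN ger0_norm ?powR_ge0// ltr_pdivlMr// mulrC; apply.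
by apply: (le_lt_trans er); rewrite gtr_pMr// invf_lt1// ltr1n.
Qed.

Lemma ch_bound t : 0 < t < 1 -> `|c - h t| <= drift_size - 1.
Proof.
move=> /hB ht; have := ler_normB c (h t); rewrite /drift_size; lra.
Qed.

Record regular e w : Prop := Regular {
  regular_continuous : continuous w ;
  regular_at1 : w 1 = e ;
  regular_ge : forall t, 0 <= t <= 1 -> e <= w t ;
  regular_derive : forall t, 0 < t < 1 -> t \notin S ->
    is_derive t 1 w (c - h t - (f t + source_lift e) * w t `^ (- a)) }.

(** Picard iteration applies to the equation with w^{-a} truncated at w = e;
    the truncation is not felt because a solution below e would have a
    negative derivative and could not return to e at t = 1. *)
Lemma regular_exists e : 0 < e -> exists w, regular e w.
Proof.
move=> e0.
(* The truncation makes the nonlinearity Lipschitz on the whole line. *)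
pose psi u := (Num.max u e) `^ (- a).
pose A t := if 0 < t < 1 then h t - c else 0.
pose D t := if 0 < t < 1 then f t + source_lift e else 0.
have l0 := source_lift_ge0 e; have ls1 := drift_size_ge1; have F0 := F_gt0.
pose K := drift_size + F + source_lift e.
have [||||||||w [wC w1 wD]] := @picard R A D psi (0 :: 1 :: S) K
    (a * e `^ (- a - 1)) (e `^ (- a)) e.
- move=> t; rewrite !inE !negb_or => /and3P[t0 t1 tS].
  apply: continuous_cut => // t01; apply: cvgB; [exact: hC|exact: cvg_cst].
- move=> t; rewrite !inE !negb_or => /and3P[t0 t1 tS].
  apply: continuous_cut => // t01; apply: cvgD; [exact: fC|exact: cvg_cst].
- move=> t; rewrite /A /K; case: ifPn => [/ch_bound|_]; last by rewrite normr0; lra.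
  by rewrite distrC; lra.
- move=> t; rewrite /D /K; case: ifPn => [t01|_]; last by rewrite normr0; lra.
  by have f1 := f_gt0 t01; have f2 := fF t01; rewrite ger0_norm; lra.
- by move=> t t1; rewrite /A; case: ifPn => //; lra.
- by move=> t t1; rewrite /D; case: ifPn => //; lra.
- move=> u v; apply: le_trans (powR_lipschitz (ltW a_gt0) e0 _ _) _;
    rewrite ?le_max ?lexx ?orbT//.
  rewrite ler_wpM2l ?mulr_ge0 ?powR_ge0// ?(ltW a_gt0)//.
  exact: max_lipschitz.
- move=> u; rewrite ger0_norm ?powR_ge0//; apply: ler_powRN => //; first exact: ltW.
  by rewrite le_max lexx orbT.
have wge t : 0 <= t <= 1 -> e <= w t.
  move=> /andP[t0 t1]; rewrite leNgt; apply/negP => we.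
  have : (cst e - w) t <= (cst e - w) 1; last by rewrite !fctE w1; lra.
  apply: (@persist_end _ (0 :: 1 :: S)).
  - lra.
  - by move=> s _; apply: cvgB; [exact: cvg_cst|exact: wC].
  - rewrite !fctE; lra.
  - move=> s st sS; rewrite !fctE subr_gt0 => wse.
    exists (0 - - (A s + D s * psi (w s))).
      by apply: is_deriveB; exact: wD.
    have s01 : 0 < s < 1 by lra.
    rewrite /psi /A /D s01 (max_idPr (ltW wse)) mulrDl (source_liftE e0).
    have := ch_bound s01; rewrite ler_norml.
    have : 0 <= f s * e `^ (- a) by rewrite mulr_ge0 ?powR_ge0// ltW// f_gt0.
    lra.
exists w; split => // t t01 tS.
have := wD t; rewrite !inE !negb_or tS andbT /A /D t01 /psi => /(_ _).
have wt := wge t ltac:(lra).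
rewrite (max_idPl wt) => H.
have -> : c - h t - (f t + source_lift e) * w t `^ (- a) =
  - (h t - c + (f t + source_lift e) * w t `^ (- a)) by ring.
by apply: H; apply/andP; split; apply/eqP; lra.
Qed.

(** The singular right-hand side increases with the unknown, so a positive gap
   between two solutions can only widen up to t = 1. *)
Lemma regular_le e e' w w' : 0 < e -> e <= e' -> regular e w -> regular e' w' ->
  forall t, 0 <= t <= 1 -> w t <= w' t.
Proof.
move=> e0 ee' rw rw' t /andP[t0 t1]; rewrite leNgt; apply/negP => ww'.
have : (w - w') t <= (w - w') 1; last by rewrite !fctE (regular_at1 rw) (regular_at1 rw'); lra.
apply: (@persist_end _ S).
- lra.
- by move=> s _; apply: cvgB; [exact: (regular_continuous rw)|exact: (regular_continuous rw')].
- rewrite !fctE; lra.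
- move=> s st sS; rewrite !fctE subr_gt0 => wse.
  have s01 : 0 < s < 1 by lra.
  exists ((c - h s - (f s + source_lift e) * w s `^ (- a)) -
          (c - h s - (f s + source_lift e') * w' s `^ (- a))).
    by apply: is_deriveB; [exact: (regular_derive rw)|exact: (regular_derive rw')].
  have w'0 : 0 < w' s by apply: lt_le_trans (regular_ge rw' _); lra.
  have := ler_powRN (ltW a_gt0) w'0 (ltW wse).
  have := ler_source_lift e0 ee'; have := powR_ge0 (w s) (- a); have := source_lift_ge0 e.
  have := powR_ge0 (w' s) (- a); have := f_gt0 s01.
  set p := w s `^ _; set q := w' s `^ _ => f0 q0 l0 p0 ll pq.
  have : (f s + source_lift e) * p <= (f s + source_lift e') * q by apply: ler_pM; lra.
  lra.
Qed.

Definition ceiling_slope (th : R) := drift_size + (F + drift_size) * th `^ (- a).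

(** Above the level th the slope is bounded, uniformly in e. As th is
    arbitrary this forces the limit to vanish at t = 1. *)
Lemma regular_ub e w th : 0 < e -> e <= 1 -> 0 < th -> regular e w ->
  forall t, 0 < t < 1 -> w t <= th + e + ceiling_slope th * (1 - t).
Proof.
move=> e0 e1 th0 rw t /andP[t0 t1]; rewrite leNgt; apply/negP => wt.
set K := ceiling_slope th in wt *.
have K0 : 0 <= K.
  have := drift_size_ge1; have := F_gt0; have := powR_ge0 th (- a) => *.
  by rewrite /K /ceiling_slope addr_ge0 ?mulr_ge0//; lra.
have linD (s : R) : is_derive s (1 : R) (fun s : R => th + e + K * (1 - s)) (0 + K * (- 1)).
  apply: is_deriveD; apply: is_deriveZ.
  rewrite -[-1]add0r; exact: is_deriveB.
have : (w - (fun s => th + e + K * (1 - s))) t <= (w - (fun s => th + e + K * (1 - s))) 1; last by rewrite !fctE (regular_at1 rw) /=; lra.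
apply: (@persist_end _ S).
- lra.
- move=> s _; apply: cvgB; first exact: (regular_continuous rw).
  exact: (derivative_continuous (linD s)).
- rewrite !fctE; lra.
- move=> s st sS; rewrite !fctE subr_gt0 => wse.
  have s01 : 0 < s < 1 by lra.
  exists ((c - h s - (f s + source_lift e) * w s `^ (- a)) - (0 + K * -1)).
    by apply: is_deriveB; exact: (regular_derive rw).
  have Ks : 0 <= K * (1 - s) by apply: mulr_ge0 => //; lra.
  have ws : th <= w s by move: wse => /=; lra.
  have := ler_powRN (ltW a_gt0) th0 ws.
  have := ler_source_lift e0 e1; rewrite {2}/source_lift powR1 mulr1.
  have := source_lift_ge0 e; have := f_gt0 s01; have := fF s01.
  have := powR_ge0 (w s) (- a); have := powR_ge0 th (- a).
  have := ch_bound s01; rewrite ler_norml /K /ceiling_slope.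
  set p := w s `^ _; set q := th `^ _ => hch q0 p0 fs f0 l0 ll pq.
  have : (f s + source_lift e) * p <= (F + drift_size) * q by apply: ler_pM; lra.
  lra.
Qed.

(** Near t0 the source is bounded below. A solution that is too small would
    decrease so steeply that it would reach zero before leaving the
    neighbourhood. *)
Lemma regular_lb t0 : 0 < t0 < 1 -> exists r d, [/\ 0 < r, 0 < d &
  forall e w t, 0 < e -> e <= 1 -> regular e w -> `|t - t0| < r ->
    0 < t < 1 /\ d <= w t].
Proof.
move=> t001; have [phi phi0 /nearE_dist[r' r'0 phif]] := f_lb t001.
pose r := Num.min r' (Num.min t0 (1 - t0)).
have r0 : 0 < r by rewrite !lt_min r'0; lra.
have [rr' rt0 rt1] : [/\ r <= r', r <= t0 & r <= 1 - t0].
  by rewrite /r !ge_min !lexx !orbT.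
(* The neighbourhood extends at least r / 4 beyond t, so a slope rho produces
   there a gap of size 1, which exceeds d. *)
pose rho := 4 / r.
have rho0 : 0 < rho by rewrite divr_gt0.
have [d' d'0 Hd] := powRN_unbounded ((drift_size + rho) / phi) a_gt0.
pose d := Num.min d' 1.
have d0 : 0 < d by rewrite lt_min d'0 ltr01.
have [dd' d1] : d <= d' /\ d <= 1 by rewrite !ge_min !lexx orbT.
exists (r / 2), d; split => //; first by rewrite divr_gt0.
move=> e w t e0 e1 rw tr; split; first by move: tr; rewrite ltr_norml; lra.
rewrite leNgt; apply/negP => wtd.
pose y := t0 + r * 3 / 4.
have ty : t < y by move: tr; rewrite ltr_norml /y; lra.
have y1 : y < 1 by rewrite /y; lra.
have tpos : 0 < t by move: tr; rewrite ltr_norml; lra.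
have gapD s : t < s < y -> s \notin S -> 0 < d - w s -> exists2 l,
    is_derive s 1 (cst d - w) l & rho <= l.
  move=> st sS ws; have s01 : 0 < s < 1 by lra.
  exists (0 - (c - h s - (f s + source_lift e) * w s `^ (- a))).
    by apply: is_deriveB; exact: (regular_derive rw).
  have phis : phi <= f s.
    by apply: phif; move: tr; rewrite !ltr_norml; rewrite /y in st; lra.
  have w0 : 0 < w s by apply: lt_le_trans (regular_ge rw _); lra.
  have := Hd (w s) w0 ltac:(lra); rewrite ler_pdivrMr// => Hw.
  have := ch_bound s01; rewrite ler_norml => hch.
  have l0 := source_lift_ge0 e.
  have := powR_ge0 (w s) (- a); move: Hw; set p := w s `^ _ => Hw p0.
  have : p * phi <= p * (f s + source_lift e) by rewrite ler_wpM2l//; lra.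
  lra.
have gapC s : t <= s <= y -> {for s, continuous (cst d - w)}.
  by move=> _; apply: cvgB; [exact: cvg_cst|exact: (regular_continuous rw)].
have gap s : t <= s <= y -> 0 < d - w s.
  move=> sty; have : (cst d - w) t <= (cst d - w) s; last by rewrite !fctE; lra.
  apply: (@persist _ S _ t y gapC _ _ s sty); first by rewrite !fctE subr_gt0.
  move=> u tu uS; rewrite fctE => wu; have [l ul rl] := gapD u tu uS wu.
  by exists l => //; lra.
have linD (s : R) : is_derive s (1 : R) (fun s : R => rho * s) rho.
  by rewrite -{2}[rho]mulr1; exact: is_deriveZ.
have : (cst d - w - (fun s => rho * s)) t <= (cst d - w - (fun s => rho * s)) y.
  apply: (@ndecr_off _ S); first exact: ltW.
    move=> s sty; apply: cvgB; first exact: gapC.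
    exact: (derivative_continuous (linD s)).
  move=> s sty sS; have [|l ul rl] := gapD s sty sS; first by apply: gap; lra.
  by exists (l - rho); [exact: is_deriveB|lra].
rewrite !fctE.
have wy : 0 < w y by apply: lt_le_trans (regular_ge rw _); lra.
have : 1 < rho * (y - t).
  have ryt : r / 4 < y - t by move: tr; rewrite ltr_norml /y; lra.
  have r1 : rho * (r / 4) = 1 by rewrite /rho; field; rewrite gt_eqF.
  by rewrite -r1 ltr_pM2l.
lra.
Qed.

(** Used to pass to the limit in the source term, where both factors vary. *)
Lemma joint_continuity (x u e : R) : 0 < u -> 0 < e -> exists2 d, 0 < d &
  forall y v, `|y - x| < d -> `|v - u| < d ->
    `|y * v `^ (- a) - x * u `^ (- a)| <= e.
Proof.
move=> u0 e0.
have : (fun z : R * R => z.1 * z.2 `^ (- a)) z @[z --> (x, u)] -->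
       (fun z : R * R => z.1 * z.2 `^ (- a)) (x, u).
  apply: cvgM; first exact: cvg_fst.
  by apply: (@continuous_comp _ _ _ snd (fun v : R => v `^ (- a)));
    [exact: cvg_snd|exact: powR_continuous].
move=> /cvgrPdist_le/(_ _ e0) /nbhs_ballP[d d0 Hd]; exists d => // y v yd vd.
by rewrite distrC; apply: (Hd (y, v)); split; rewrite /ball /= distrC.
Qed.

Section VanishingRegularization.
Variable W : R -> R -> R.
Hypothesis rW : forall e, 0 < e -> regular e (W e).

(** The regular solutions decrease with e, so this infimum is their pointwise
    limit. *)
Definition limit_profile t := inf [set W e t | e in [set e : R | 0 < e <= 1]].
Notation w := limit_profile.

Let values_lb t : 0 < t < 1 -> lbound [set W e t | e in [set e : R | 0 < e <= 1]] 0.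
Proof.
move=> /andP[t0 t1] _ [e /andP[e0 _] <-]; apply: ltW.
by apply: (lt_le_trans e0); apply: (regular_ge (rW e0)); rewrite !ltW.
Qed.

Lemma limit_profile_le t e : 0 < t < 1 -> 0 < e -> e <= 1 -> w t <= W e t.
Proof.
move=> t01 e0 e1; apply: ge_inf; first by exists 0; exact: values_lb.
by exists e => //=; rewrite e0.
Qed.

Lemma limit_profile_ge t x : (forall e, 0 < e -> e <= 1 -> x <= W e t) -> x <= w t.
Proof.
move=> xW; apply: lb_le_inf; first by exists (W 1 t), 1 => //=; rewrite ltr01 lexx.
by move=> _ [e /andP[e0 e1] <-]; exact: xW.
Qed.

Lemma limit_profile_approx t x : 0 < t < 1 -> 0 < x -> exists e1, [/\ 0 < e1, e1 <= 1 &
  forall e, 0 < e -> e <= e1 -> `|W e t - w t| <= x].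
Proof.
move=> t01 x0; have /andP[t0 t1] := t01.
have iT : has_inf [set W e t | e in [set e : R | 0 < e <= 1]].
  split; last by exists 0; exact: values_lb.
  by exists (W 1 t), 1 => //=; rewrite ltr01 lexx.
have [_ [e1 /andP[e10 e11] <-] We1] := inf_adherent x0 iT.
exists e1; split => // e e0 ee1.
have h1 := limit_profile_le t01 e0 (le_trans ee1 e11).
rewrite ger0_norm ?subr_ge0// lerBlDl; apply: le_trans (ltW We1).
by apply: (regular_le e0 ee1 (rW e0) (rW e10)); rewrite !ltW.
Qed.

Definition local_slope (x : R) := drift_size + (F + drift_size) * x `^ (- a).

Lemma family_lipschitz t : 0 < t < 1 -> exists r x, [/\ 0 < r, 0 < x &
  forall e s, 0 < e -> e <= 1 -> `|s - t| < r ->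
    [/\ 0 < s < 1, x <= W e s & `|W e s - W e t| <= local_slope x * `|s - t|]].
Proof.
move=> t01; have [r [x [r0 x0 Hr]]] := regular_lb t01.
exists r, x; split => // e s e0 e1 sr; have [s01 xs] := Hr _ _ s e0 e1 (rW e0) sr.
split => //; apply: (@lipschitz_off_dist _ S _ _ r) => //.
  exact: (regular_continuous (rW e0)).
move=> u ur uS; have [u01 xu] := Hr _ _ u e0 e1 (rW e0) ur.
exists (c - h u - (f u + source_lift e) * W e u `^ (- a)).
  exact: (regular_derive (rW e0)).
have pq := ler_powRN (ltW a_gt0) x0 xu; have p0 := powR_ge0 (W e u) (- a).
have ll : source_lift e <= drift_size by apply: le_trans (ler_source_lift e0 e1) _; rewrite /source_lift powR1 mulr1.
have l0 := source_lift_ge0 e; have f0 := f_gt0 u01; have fu := fF u01.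
have hu := ch_bound u01; have fl0 : 0 <= f u + source_lift e by rewrite addr_ge0// ltW.
have : (f u + source_lift e) * W e u `^ (- a) <= (F + drift_size) * x `^ (- a).
  by apply: ler_pM => //; rewrite lerD.
have := mulr_ge0 fl0 p0.
by move: hu; rewrite !ler_norml /local_slope; lra.
Qed.

Lemma limit_profile_gt0 t : 0 < t < 1 -> 0 < w t.
Proof.
move=> t01; have [r [x [r0 x0 Hr]]] := family_lipschitz t01.
apply: (lt_le_trans x0); apply: limit_profile_ge => e e0 e1.
by have [] := Hr e t e0 e1; rewrite // subrr normr0.
Qed.

Lemma limit_profile_continuous t : 0 < t < 1 -> {for t, continuous w}.
Proof.
move=> t01; have [r [x [r0 x0 Hr]]] := family_lipschitz t01.
have L0 : 0 <= local_slope x.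
  have d0 := le_trans ler01 drift_size_ge1.
  by rewrite addr_ge0// mulr_ge0 ?powR_ge0// addr_ge0// ltW// F_gt0.
have wL s : `|s - t| < r -> `|w s - w t| <= local_slope x * `|s - t|.
  move=> sr; apply/ler_addgt0Pr => y y0; have y20 : 0 < y / 2 by rewrite divr_gt0.
  have [s01 _ _] := Hr 1 s ltr01 (lexx 1) sr.
  have [e1 [e10 e11 H1]] := limit_profile_approx s01 y20.
  have [e2 [e20 e21 H2]] := limit_profile_approx t01 y20.
  pose e := Num.min e1 e2; have e0 : 0 < e by rewrite lt_min e10.
  have [ee1 ee2] : e <= e1 /\ e <= e2 by rewrite !ge_min !lexx orbT.
  have [_ _] := Hr e s e0 (le_trans ee1 e11) sr.
  have := H1 e e0 ee1; have := H2 e e0 ee2.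
  by rewrite !ler_norml; lra.
apply/cvgrPdist_le => e e0; apply/nearE_dist.
have L1 : 0 < local_slope x + 1 by apply: ltr_wpDl.
exists (Num.min r (e / (local_slope x + 1))); first by rewrite lt_min r0 divr_gt0.
move=> s; rewrite lt_min ltr_pdivlMr// => /andP[sr se].
rewrite distrC; apply: (le_trans (wL s sr)); apply: le_trans (ltW se).
by rewrite mulrC ler_wpM2l// lerDl.
Qed.

Lemma limit_profile_derive t : 0 < t < 1 -> t \notin S ->
  is_derive t 1 w (c - h t - f t * w t `^ (- a)).
Proof.
move=> t01 tS; have [r [x [r0 x0 Hr]]] := family_lipschitz t01.
apply: (@limit_is_derive _ S W w t _ r r0).
- by move=> e e0; exact: (regular_continuous (rW e0)).
- move=> s sr y y0; have [s01 _ _] := Hr 1 s ltr01 (lexx 1) sr.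
  by have [e1 [e10 _ H1]] := limit_profile_approx s01 y0; exists e1.
move=> y y0; have y20 : 0 < y / 2 by rewrite divr_gt0.
have w0 := limit_profile_gt0 t01.
have [z z0 Hz] := joint_continuity (f t) w0 y20.
have z20 : 0 < z / 2 by rewrite divr_gt0.
have /cvgrPdist_le/(_ _ y20) /nearE_dist[r1 r10 H1] := hC t01 tS.
have /cvgrPdist_lt/(_ _ z20) /nearE_dist[r2 r20 H2] := fC t01 tS.
have [e1 [e10 e11 He1]] := limit_profile_approx t01 z20.
have [e2 e20 He2] := source_lift_small z20.
have L1 : 0 < local_slope x + 1.
  have d0 := le_trans ler01 drift_size_ge1.
  by rewrite ltr_wpDl// addr_ge0// mulr_ge0 ?powR_ge0// addr_ge0// ltW// F_gt0.
exists (Num.min (Num.min r1 r2) (Num.min r (z / 2 / (local_slope x + 1)))).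
exists (Num.min e1 e2); split.
- by rewrite !lt_min r10 r20 r0 divr_gt0.
- by rewrite lt_min e10.
move=> e u e0; rewrite le_min !lt_min ltr_pdivlMr// => /andP[ee1 ee2].
move=> /andP[/andP[ur1 ur2] /andP[ur uL]] uS.
have [u01 _ Wu] := Hr e u e0 (le_trans ee1 e11) ur.
exists (c - h u - (f u + source_lift e) * W e u `^ (- a)).
  exact: (regular_derive (rW e0)).
have h1 := H1 u ur1.
have h2 : `|f u + source_lift e - f t| < z.
  have := H2 u ur2; have := He2 e e0 ee2; have := source_lift_ge0 e.
  by rewrite !ltr_norml; lra.
have h3 : `|W e u - w t| < z.
  have := He1 e e0 ee1; have Wu' : `|W e u - W e t| < z / 2.
    apply: le_lt_trans Wu _; apply: le_lt_trans uL.
    by rewrite mulrC ler_wpM2l// lerDl.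
  by move: Wu'; rewrite ler_norml !ltr_norml; lra.
have := Hz _ _ h2 h3; move: h1; rewrite !ler_norml; lra.
Qed.

Lemma limit_profile_at1 : w t @[t --> 1^'-] --> (0 : R).
Proof.
apply/cvgrPdist_le => e e0; apply/near_leftE.
have e40 : 0 < e / 4 by rewrite divr_gt0.
set K := ceiling_slope (e / 4).
have K0 : 0 <= K.
  have d0 := le_trans ler01 drift_size_ge1.
  by rewrite addr_ge0// mulr_ge0 ?powR_ge0// addr_ge0// ltW// F_gt0.
have K1 : 0 < K + 1 by apply: ltr_wpDl.
pose r := Num.min 1 (e / 4 / (K + 1)).
have r0 : 0 < r by rewrite lt_min ltr01 !divr_gt0.
have [rr1 rr2] : r <= 1 /\ r <= e / 4 / (K + 1) by rewrite /r !ge_min !lexx orbT.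
exists r => // t tr.
have t01 : 0 < t < 1 by move: tr rr1; lra.
rewrite sub0r normrN ger0_norm; last exact/ltW/limit_profile_gt0.
pose x := Num.min 1 (e / 4).
have x0 : 0 < x by rewrite lt_min ltr01.
have [x1 xe] : x <= 1 /\ x <= e / 4 by rewrite /x !ge_min !lexx orbT.
apply: le_trans (limit_profile_le t01 x0 x1) _.
apply: le_trans (regular_ub x0 x1 e40 (rW x0) t01) _; rewrite -/K.
have t1K : (1 - t) * (K + 1) < e / 4.
  by rewrite -ltr_pdivlMr//; move: tr rr2; lra.
have : K * (1 - t) <= (1 - t) * (K + 1).
  by rewrite mulrC ler_wpM2l ?lerDl//; move: t01; lra.
by move: t1K xe e0; lra.
Qed.

End VanishingRegularization.

Lemma profile_exists : exists w, profile c w.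
Proof.
have /choice[W rW] : forall e : R, exists w, 0 < e -> regular e w.
  move=> e; have [e0|e0] := ltP 0 e; last first.
    by exists (fun=> 0).
  by have [w rw] := regular_exists e0; exists w.
exists (limit_profile W); split.
- exact: limit_profile_gt0.
- exact: limit_profile_continuous.
- exact: limit_profile_derive.
- exact: limit_profile_at1.
Qed.

End Regularized.

End Profile.

(** * The threshold speed *)

(** A strict inequality between the two end limits of a monotone function that
    increases strictly somewhere, with approximations in place of the limits. *)
Lemma lt_of_increase {R : realType} (u : R -> R) :
  (forall s t, 0 < s -> s <= t -> t < 1 -> u s <= u t) ->
  forall x y, 0 < x -> x < y -> y < 1 -> u x < u y -> forall A B,
  (forall e, 0 < e -> exists s, 0 < s < x /\ A - e <= u s) ->
  (forall e, 0 < e -> exists t, y < t < 1 /\ u t <= B + e) -> A < B.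
Proof.
move=> uI x y x0 xy y1 uxy A B uA uB; pose e := (u y - u x) / 3.
have e0 : 0 < e by rewrite divr_gt0// subr_gt0.
have [s [sx As]] := uA e e0; have [t [yt tB]] := uB e e0.
have := uI s x ltac:(lra) ltac:(lra) ltac:(lra).
have := uI y t ltac:(lra) ltac:(lra) ltac:(lra).
by move: As tB; rewrite /e; lra.
Qed.

Section Threshold.
Context {R : realType}.
Variables (a B F : R) (S : seq R) (h f : R -> R).
Implicit Types (w : R -> R) (t s c e phi : R).
Notation profile := (profile a S h f).
Hypothesis a_gt0 : 0 < a.
Hypothesis hB : forall t, 0 < t < 1 -> `|h t| <= B.
Hypothesis fF : forall t, 0 < t < 1 -> f t <= F.
Hypothesis f_lb : forall t, 0 < t < 1 ->
  exists2 phi, 0 < phi & \forall s \near t, phi <= f s.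
Hypothesis hC : forall t, 0 < t < 1 -> t \notin S -> {for t, continuous h}.
Hypothesis fC : forall t, 0 < t < 1 -> t \notin S -> {for t, continuous f}.

Lemma profile_small c w t e : profile c w -> 0 < t < 1 -> 0 < e ->
  exists y, [/\ t < y, y < 1 & w y < e].
Proof.
move=> pw t01 e0.
have /cvgrPdist_lt/(_ _ e0)/near_leftE[r r0 Hr] := profile_at1 pw.
have y1 : t < Num.max ((t + 1) / 2) (1 - r / 2) by rewrite lt_max; apply/orP; left; lra.
have y2 : 1 - r / 2 <= Num.max ((t + 1) / 2) (1 - r / 2) by rewrite le_max lexx orbT.
have y3 : Num.max ((t + 1) / 2) (1 - r / 2) < 1 by rewrite gt_max; apply/andP; lra.
exists (Num.max ((t + 1) / 2) (1 - r / 2)); split => //.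
have := Hr (Num.max ((t + 1) / 2) (1 - r / 2)) ltac:(lra).
by rewrite sub0r normrN ltr_norml; lra.
Qed.

(** Two profiles vanish together at t = 1, and a gap in favour of the faster one
   would widen towards t = 1. *)
Lemma profile_le c c' w w' : c <= c' -> profile c w -> profile c' w' ->
  forall t, 0 < t < 1 -> w' t <= w t.
Proof.
move=> cc' pw pw' t t01; rewrite leNgt; apply/negP => ww'.
have [y [ty y1 wy]] := @profile_small c' w' t (w' t - w t) pw' t01 ltac:(lra).
have y0 := profile_gt0 pw (t := y) ltac:(lra).
have : (w' - w) t <= (w' - w) y; last by rewrite !fctE; lra.
apply: (@persist_end _ S); first lra.
- move=> s st; apply: cvgB; first by apply: (profile_continuous pw'); lra.
  by apply: (profile_continuous pw); lra.
- rewrite !fctE; lra.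
- move=> s st sS; rewrite !fctE subr_gt0 => wse.
  have s01 : 0 < s < 1 by lra.
  exists ((c' - h s - f s * w' s `^ (- a)) - (c - h s - f s * w s `^ (- a))).
    by apply: is_deriveB; [exact: (profile_derive pw')|exact: (profile_derive pw)].
  have := ler_powRN (ltW a_gt0) (profile_gt0 pw s01) (ltW wse).
  have := f_gt0 f_lb s01; set p := w' s `^ _; set q := w s `^ _ => f0 pq.
  have : f s * p <= f s * q by rewrite ler_wpM2l// ltW.
  lra.
Qed.

(** The gap between the profiles of two speeds decreases at most at rate c' -
    c, and it vanishes at t = 1. This quantitative form makes the set of
    admissible speeds closed. *)
Lemma profile_le_speed c c' w w' : c <= c' -> profile c w -> profile c' w' ->
  forall t, 0 < t < 1 -> w t <= w' t + (c' - c).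
Proof.
move=> cc' pw pw' t t01; rewrite leNgt; apply/negP => ww'.
have [y [ty y1 wy]] := @profile_small c w t (w t - w' t - (c' - c)) pw t01 ltac:(lra).
have y0 := profile_gt0 pw' (t := y) ltac:(lra).
have linD (v : R) : is_derive v (1 : R) (fun s : R => (c' - c) * s) (c' - c).
  by rewrite -{2}[c' - c]mulr1; exact: is_deriveZ.
have : (w - w' + (fun s => (c' - c) * s)) t <= (w - w' + (fun s => (c' - c) * s)) y.
  apply: (@ndecr_off _ S); first lra.
    move=> s st; apply: cvgD; last exact: (derivative_continuous (linD s)).
    apply: cvgB; first by apply: (profile_continuous pw); lra.
    by apply: (profile_continuous pw'); lra.
  move=> s st sS; have s01 : 0 < s < 1 by lra.
  exists ((c - h s - f s * w s `^ (- a)) - (c' - h s - f s * w' s `^ (- a)) + (c' - c)).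
    apply: is_deriveD; apply: is_deriveB.
      exact: (profile_derive pw).
    exact: (profile_derive pw').
  have := ler_powRN (ltW a_gt0) (profile_gt0 pw' s01) (profile_le cc' pw pw' s01).
  have := f_gt0 f_lb s01; set p := w' s `^ _; set q := w s `^ _ => f0 pq.
  have : f s * q <= f s * p by rewrite ler_wpM2l// ltW.
  lra.
rewrite !fctE => H.
have : (c' - c) * (y - t) <= (c' - c) * 1 by rewrite ler_wpM2l//; lra.
lra.
Qed.

(** A lower limit is enough: vanishes_bound turns it into a linear bound. *)
Definition vanishes_at0 w := forall e, 0 < e ->
  exists s, [/\ 0 < s, s < e, s < 1 & w s < e].

(** The slope of a profile is at most c - h, so small values near 0 can only
    grow linearly. *)
Lemma vanishes_bound c w : profile c w -> vanishes_at0 w ->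
  forall t, 0 < t < 1 -> w t <= (`|c| + B) * t.
Proof.
move=> pw w0 t t01; apply/ler_addgt0Pr => e e0.
have [s [s0 se s1 ws]] := w0 (Num.min e t) ltac:(by rewrite lt_min e0; lra).
move: se ws; rewrite !lt_min => /andP[se st] /andP[ws _].
have linD (v : R) : is_derive v (1 : R) (fun s : R => (`|c| + B) * s) (`|c| + B).
  by rewrite -{2}[`|c| + B]mulr1; exact: is_deriveZ.
have : ((fun s => (`|c| + B) * s) - w) s <= ((fun s => (`|c| + B) * s) - w) t.
  apply: (@ndecr_off _ S); first lra.
    move=> u ut; apply: cvgB; first exact: (derivative_continuous (linD u)).
    by apply: (profile_continuous pw); lra.
  move=> u ut uS; have u01 : 0 < u < 1 by lra.
  exists ((`|c| + B) - (c - h u - f u * w u `^ (- a))).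
    by apply: is_deriveB; exact: (profile_derive pw).
  have : 0 <= f u * w u `^ (- a) by rewrite mulr_ge0 ?powR_ge0// ltW// (f_gt0 f_lb).
  have := hB u01; rewrite ler_norml; have := ler_norm c; lra.
rewrite !fctE.
have : 0 <= (`|c| + B) * s by rewrite mulr_ge0 ?addr_ge0 ?(B_ge0 hB)// ltW.
lra.
Qed.

Lemma vanishes_le c c' w w' : c <= c' -> profile c w -> profile c' w' ->
  vanishes_at0 w -> vanishes_at0 w'.
Proof.
move=> cc' pw pw' w0 e e0; have [s [s0 se s1 ws]] := w0 e e0.
exists s; split => //; apply: le_lt_trans ws.
by apply: (profile_le cc' pw pw'); rewrite s0.
Qed.

Lemma vanishes_limit c w : profile c w ->
  (forall e, 0 < e -> exists c' w', [/\ c <= c', c' < c + e, profile c' w' & vanishes_at0 w']) ->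
  vanishes_at0 w.
Proof.
move=> pw H e e0.
have [c' [w' [cc' c'e pw' w'0]]] := H (e / 2) ltac:(by rewrite divr_gt0).
have [s [s0 se s1 ws]] := w'0 (e / 2) ltac:(by rewrite divr_gt0).
exists s; split => //; first lra.
apply: le_lt_trans (profile_le_speed cc' pw pw' _) _; first by rewrite s0.
lra.
Qed.

(** If c < h (0), a profile decreases near 0 and cannot start from 0. *)
Lemma vanishes_ge c w h0 : h t @[t --> 0^'+] --> h0 -> profile c w ->
  vanishes_at0 w -> h0 <= c.
Proof.
move=> hh0 pw w0; rewrite leNgt; apply/negP => ch0.
have : \forall t \near 0^'+, c < h t by apply: (cvgr_gt _ hh0).
move=> /near_rightE[r r0 Hr].
pose t := Num.min (r / 2) (1 / 2).
have t0 : 0 < t by rewrite lt_min; lra.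
have [tr t1] : t <= r / 2 /\ t <= 1 / 2 by rewrite /t !ge_min !lexx !orbT.
clearbody t; have wt := profile_gt0 pw (t := t) ltac:(lra).
have [s [s0 se s1 ws]] := w0 (Num.min (w t) t) ltac:(by rewrite lt_min wt t0).
move: se ws; rewrite !lt_min => /andP[_ st] /andP[ws _].
have : (- w) s <= (- w) t; last by rewrite !fctE; lra.
apply: (@ndecr_off _ S); first lra.
  by move=> u ut; apply: cvgN; apply: (profile_continuous pw); lra.
move=> u ut uS; have u01 : 0 < u < 1 by lra.
exists (- (c - h u - f u * w u `^ (- a))).
  by apply: is_deriveN; exact: (profile_derive pw).
have : 0 <= f u * w u `^ (- a) by rewrite mulr_ge0 ?powR_ge0// ltW// (f_gt0 f_lb).
by have := Hr u ltac:(lra); lra.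
Qed.

(** The mass gained by c t - P t - w t over (0, 1) is the integral of f / w ^ a,
   which is positive. *)
Lemma vanishes_gt c w (P : R -> R) : continuous P ->
  (forall t, 0 < t < 1 -> t \notin S -> is_derive t 1 P (h t)) ->
  profile c w -> vanishes_at0 w -> P 1 - P 0 < c.
Proof.
move=> PC PD pw w0.
have linD (k s : R) : is_derive s (1 : R) (fun s : R => k * s) k.
  by rewrite -{2}[k]mulr1; exact: is_deriveZ.
pose u := (fun s : R => c * s) - P - w.
have uC t : 0 < t < 1 -> {for t, continuous u}.
  move=> t01; apply: cvgB; last exact: (profile_continuous pw).
  by apply: cvgB; [exact: (derivative_continuous (linD c t))|exact: PC].
have uD t : 0 < t < 1 -> t \notin S -> is_derive t 1 u (f t * w t `^ (- a)).
  move=> t01 tS; have -> : f t * w t `^ (- a) = c - h t - (c - h t - f t * w t `^ (- a)) by ring.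
  by apply: is_deriveB; [apply: is_deriveB; exact: PD|exact: (profile_derive pw)].
have uI s t : 0 < s -> s <= t -> t < 1 -> u s <= u t.
  move=> s0 st t1; apply: (@ndecr_off _ S); first exact: st.
    by move=> x xt; apply: uC; lra.
  move=> x xt xS; have x01 : 0 < x < 1 by lra.
  exists (f x * w x `^ (- a)); first exact: uD.
  by rewrite mulr_ge0 ?powR_ge0// ltW// (f_gt0 f_lb).
have half01 : 0 < (1 / 2 : R) < 1 by lra.
have [phi phi0 /nearE_dist[r1 r10 Hr1]] := f_lb half01.
have W0 := profile_gt0 pw half01.
have : \forall s \near (1 / 2 : R), w s < w (1 / 2) + 1.
  by apply: (cvgr_lt _ (profile_continuous pw half01)); lra.
move=> /nearE_dist[r2 r20 Hr2].
pose r := Num.min (1 / 4) (Num.min r1 r2).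
have r0 : 0 < r by rewrite !lt_min r10 r20; lra.
have [ra rr1 rr2] : [/\ r <= 1 / 4, r <= r1 & r <= r2].
  by rewrite /r !ge_min !lexx !orbT.
pose rho := phi * (w (1 / 2) + 1) `^ (- a).
have rho0 : 0 < rho by rewrite mulr_gt0 ?powR_gt0//; lra.
pose y := 1 / 2 + r / 2.
have gap : u (1 / 2) + rho * (r / 2) <= u y.
  have : (u - (fun s => rho * s)) (1 / 2) <= (u - (fun s => rho * s)) y.
    apply: (@ndecr_off _ S); first by rewrite /y; lra.
      move=> s sy; apply: cvgB; last exact: (derivative_continuous (linD _ s)).
      by apply: uC; rewrite /y in sy; lra.
    move=> s sy sS; have s01 : 0 < s < 1 by rewrite /y in sy; lra.
    exists (f s * w s `^ (- a) - rho); first by apply: is_deriveB; exact: uD.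
    have sr : `|s - 1 / 2| < r by rewrite ger0_norm; rewrite /y in sy; lra.
    have ws := Hr2 s ltac:(lra); have fs := Hr1 s ltac:(lra).
    have := ler_powRN (ltW a_gt0) (profile_gt0 pw s01) (ltW ws) => pq.
    rewrite subr_ge0 /rho; apply: ler_pM => //; first exact: ltW.
    exact: powR_ge0.
  by rewrite !fctE /= /y; lra.
have gap' : u (1 / 2) < u y by apply: lt_le_trans gap; rewrite ltrDl mulr_gt0// divr_gt0.
have QC : continuous ((fun s : R => c * s) - P).
  by move=> s; apply: cvgB; [exact: (derivative_continuous (linD c s))|exact: PC].
have y12 : 1 / 2 < y by rewrite ltrDl divr_gt0.
have y1 : y < 1 by rewrite /y; lra.
have := lt_of_increase uI (divr_gt0 ltr01 (ltr0n _ 2)) y12 y1 gap'.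
move=> /(_ (- P 0) (c - P 1)) lt0; suff : - P 0 < c - P 1 by lra.
apply: lt0 => e e0; have e20 : 0 < e / 2 by rewrite divr_gt0.
- have /cvgrPdist_lt/(_ _ e20)/nearE_dist[r3 r30 Hr3] := QC 0.
  have [|s [s0 se s1 ws]] := w0 (Num.min (Num.min r3 (1 / 2)) (e / 2)).
    by rewrite !lt_min r30 e20 divr_gt0.
  move: se ws; rewrite !lt_min => /andP[/andP[sr3 s12] _] /andP[_ wse].
  exists s; rewrite s0; split => //.
  have := Hr3 s; rewrite subr0 gtr0_norm// => /(_ sr3).
  by rewrite /u !fctE /= mulr0 ltr_norml; move: wse; lra.
- have /cvgrPdist_lt/(_ _ e0)/nearE_dist[r4 r40 Hr4] := QC 1.
  pose t := Num.max ((y + 1) / 2) (1 - r4 / 2).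
  have [ty tr] : (y + 1) / 2 <= t /\ 1 - r4 / 2 <= t by rewrite !le_max !lexx orbT.
  have t1 : t < 1 by rewrite gt_max; lra.
  have t01 : 0 < t < 1 by lra.
  exists t; split; first lra.
  have := Hr4 t ltac:(rewrite ltr_norml; lra).
  rewrite /u !fctE /= mulr1 ltr_norml.
  by have := profile_gt0 pw t01; lra.
Qed.

(** The line kap t is a supersolution of the first-order problem. *)
Lemma vanishes_fast c w kap nu : 0 < kap ->
  (forall t, 0 < t < 1 -> f t <= nu * t `^ a) ->
  (forall t, 0 < t < 1 -> kap + nu * kap `^ (- a) <= c - h t) ->
  profile c w -> vanishes_at0 w.
Proof.
move=> kap0 fnu ch pw.
have linD (v : R) : is_derive v (1 : R) (fun s : R => kap * s) kap.
  by rewrite -{2}[kap]mulr1; exact: is_deriveZ.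
have wk t : 0 < t < 1 -> w t <= kap * t.
  move=> t01; rewrite leNgt; apply/negP => kw.
  have [y [ty y1 wy]] := @profile_small c w t (w t - kap * t) pw t01 ltac:(lra).
  have : (w - (fun s => kap * s)) t <= (w - (fun s => kap * s)) y; last first.
    rewrite !fctE /=; have : 0 < kap * y by rewrite mulr_gt0//; lra.
    by lra.
  apply: (@persist_end _ S); first lra.
  - move=> s st; apply: cvgB; last exact: (derivative_continuous (linD s)).
    by apply: (profile_continuous pw); lra.
  - rewrite !fctE /=; lra.
  - move=> s st sS; rewrite !fctE subr_gt0 => wse.
    have s01 : 0 < s < 1 by lra.
    exists ((c - h s - f s * w s `^ (- a)) - kap).
      by apply: is_deriveB; exact: (profile_derive pw).
    have ks : 0 < kap * s by rewrite mulr_gt0//; lra.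
    have := ler_powRN (ltW a_gt0) ks (ltW wse).
    have s0 : 0 < s by lra.
    rewrite powRM ?(ltW kap0) ?(ltW s0)// => pq.
    have : f s * w s `^ (- a) <= (nu * s `^ a) * (kap `^ (- a) * s `^ (- a)).
      apply: ler_pM => //; [exact/ltW/(f_gt0 f_lb)|exact: powR_ge0|exact: fnu].
    have -> : (nu * s `^ a) * (kap `^ (- a) * s `^ (- a)) = nu * kap `^ (- a).
      have sa : s `^ a != 0 by rewrite gt_eqF// powR_gt0.
      by rewrite (powRN s); field.
    by have := ch s s01; lra.
move=> e e0; pose s := Num.min (1 / 2) (Num.min (e / 2) (e / (2 * kap))).
have s0 : 0 < s by rewrite !lt_min !divr_gt0// mulr_gt0.
have [s12 se sk] : [/\ s <= 1 / 2, s <= e / 2 & s <= e / (2 * kap)].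
  by rewrite /s !ge_min !lexx !orbT.
exists s; split; [done|lra|lra|].
apply: le_lt_trans (wk s _) _; first lra.
rewrite ler_pdivlMr in sk; last by rewrite mulr_gt0.
lra.
Qed.

(** The threshold is the infimum of the speeds whose profile vanishes at 0; it
    belongs to that set. *)
Theorem threshold_exists h0 cmax kap nu (P : R -> R) :
  h t @[t --> 0^'+] --> h0 ->
  continuous P ->
  (forall t, 0 < t < 1 -> t \notin S -> is_derive t 1 P (h t)) ->
  0 < kap ->
  (forall t, 0 < t < 1 -> f t <= nu * t `^ a) ->
  (forall t, 0 < t < 1 -> kap + nu * kap `^ (- a) <= cmax - h t) ->
  exists cs, [/\ h0 <= cs, P 1 - P 0 < cs, cs <= cmax &
    forall c w, profile c w -> (vanishes_at0 w <-> cs <= c)].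
Proof.
move=> hh0 PC PD kap0 fnu hcmax.
have ex c := profile_exists a_gt0 hB fF f_lb hC fC c.
pose G := [set c | exists w, profile c w /\ vanishes_at0 w].
have Gmax : G cmax.
  have [w pw] := ex cmax; exists w; split => //; exact: (vanishes_fast kap0 fnu hcmax).
have lbG : lbound G h0.
  by move=> c [w [pw w0]]; exact: (vanishes_ge hh0 pw w0).
have infG : has_inf G by split; [exists cmax|exists h0].
have Ginf w : profile (inf G) w -> vanishes_at0 w.
  move=> pw; apply: (vanishes_limit pw) => e e0.
  have [c' [w' [pw' w'0]] c'e] := inf_adherent e0 infG.
  exists c', w'; split => //; apply: ge_inf; first by exists h0.
  by exists w'.
exists (inf G); split.
- by apply: lb_le_inf => //; exists cmax.
- have [w pw] := ex (inf G); exact: (vanishes_gt PC PD pw (Ginf w pw)).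
- by apply: ge_inf => //; exists h0.
- move=> c w pw; split=> [w0|cs].
    by apply: ge_inf; [exists h0|exists w].
  have [w' pw'] := ex (inf G).
  exact: (vanishes_le cs pw' pw (Ginf w' pw')).
Qed.

End Threshold.

(** * Consequences of the hypotheses on diffusion, reaction and convection *)

Section Setting.
Context {R : realType}.
Implicit Types (t s e : R) (i : nat).

Definition admissible (p : R) (g d h : R -> R) (r : nat) (m : nat -> R)
    (q : nat) (k : nat -> R) : Prop :=
  [/\ 1 < p, reaction_hyp g, diffusion_hyp r m d, convection_hyp q k h &
      has_ubound (mu_set p d g)].

Definition jumps (n : nat) (b : nat -> R) : seq R := [seq b i | i <- iota 1 n].

Definition expo (p : R) : R := 1 / (p - 1).

Definition reduced_source (p : R) (d g : R -> R) t : R := d t `^ expo p * g t.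

Definition clamp t : R := Num.max 0 (Num.min 1 t).

Definition cut01 (h : R -> R) t : R := if 0 <= t <= 1 then h t else 0.

(** It agrees with the primitive of h on [0, 1] and is continuous on the whole
    line, which avoids one-sided statements at 0 and 1. *)
Definition primitive_ext (h : R -> R) : R -> R := oriented_integral (cut01 h) 0.

Lemma clamp_id t : 0 <= t <= 1 -> clamp t = t.
Proof. by move=> /andP[t0 t1]; rewrite /clamp (min_idPr t1) (max_idPr t0). Qed.

Lemma clamp_in t : 0 <= clamp t <= 1.
Proof. by rewrite /clamp le_max lexx /= ge_max ler01 ge_min lexx. Qed.

Lemma clamp_lipschitz t s : `|clamp t - clamp s| <= `|t - s|.
Proof.
have min_lip : `|Num.min 1 t - Num.min 1 s| <= `|t - s|.
  have h1 := ler_norm (t - s); have h2 := ler_norm (s - t); rewrite distrC in h2.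
  by have [t1|t1] := leP 1 t; have [s1|s1] := leP 1 s;
    rewrite ?subrr ?normr0// ler_norml; lra.
apply: le_trans min_lip; rewrite /clamp ![Num.max 0 _]maxC.
exact: max_lipschitz.
Qed.

Lemma continuous_clamp (k : R -> R) : {within `[0, 1], continuous k} ->
  continuous (k \o clamp).
Proof.
move=> /subspace_continuousP kC t; apply/cvgrPdist_le => e e0.
have ct : `[0, 1]%classic (clamp t) by rewrite /= in_itv /=; exact: clamp_in.
have /cvgrPdist_le/(_ _ e0) := kC (clamp t) ct.
move=> /nearE_dist[r r0 Hr]; apply/nearE_dist; exists r => // s st.
apply: Hr; last by rewrite /= in_itv /=; exact: clamp_in.
exact: le_lt_trans (clamp_lipschitz _ _) st.
Qed.

Section Breakpoints.
Variables (n : nat) (b : nat -> R).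
Hypothesis bb : breakpoints n b.

Lemma breakpoints_lt i j : (i < j)%N -> (j <= n.+1)%N -> b i < b j.
Proof.
case: bb => _ _ bS; elim: j => // j IH; rewrite ltnS leq_eqVlt => /orP[/eqP ->|ij] jn.
  exact: bS.
by apply: lt_trans (IH ij (ltnW jn)) _; exact: bS.
Qed.

Lemma breakpoints_in i : (0 < i <= n)%N -> 0 < b i < 1.
Proof.
case: bb => b0 b1 _ /andP[i0 i_n].
by rewrite -b0 -b1 !breakpoints_lt// ltnW.
Qed.

Lemma jumpsP x : reflect (exists2 i, (0 < i <= n)%N & x = b i) (x \in jumps n b).
Proof.
apply: (iffP mapP) => -[i]; rewrite ?mem_iota ?add1n ?ltnS => i1 ->; exists i => //.
by rewrite mem_iota add1n ltnS.
Qed.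

(** Induction on the last breakpoint that lies to the right of t. *)
Lemma breakpoints_gap t : 0 < t < 1 -> t \notin jumps n b ->
  exists2 i, (i <= n)%N & b i < t < b i.+1.
Proof.
move=> /andP[t0 t1] tJ; case: bb => b0 b1 bS.
suff H j : (j <= n.+1)%N -> t < b j -> exists2 i, (i <= n)%N & b i < t < b i.+1.
  by apply: (H n.+1) => //; rewrite b1.
elim: j => [|j IH] jn tj; first by move: tj; rewrite b0; lra.
have [tbj|bjt|tE] := ltgtP t (b j).
- by apply: IH => //; exact: ltnW.
- by exists j => //; rewrite bjt.
- exfalso; case: j => [|j] in IH jn tj tE *; first by move: t0; rewrite tE b0 ltxx.
  by move/negP: tJ; apply; apply/jumpsP; exists j.+1.
Qed.

End Breakpoints.

Lemma piecewise_continuousE n b (k : R -> R) t : piecewise_continuous n b k ->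
  0 < t < 1 -> t \notin jumps n b -> {for t, continuous k}.
Proof.
move=> [bb _ kC] t01 tJ; have [i i_n bt] := breakpoints_gap bb t01 tJ.
by apply: (kC i i_n); rewrite in_itv.
Qed.

Section Consequences.
Variables (p : R) (g d h : R -> R) (r : nat) (m : nat -> R) (q : nat) (k : nat -> R).
Hypothesis H : admissible p g d h r m q k.
Notation a := (expo p).
Notation f := (reduced_source p d g).

Lemma p_gt1 : 1 < p. Proof. by case: H. Qed.

Lemma expo_gt0 : 0 < a.
Proof. by rewrite divr_gt0// subr_gt0; exact: p_gt1. Qed.

Lemma g_gt0 t : 0 < t < 1 -> 0 < g t.
Proof. by case: H => _ [_ _ _ gp] _ _ _; exact: gp. Qed.

Lemma g_ge0 t : 0 <= t <= 1 -> 0 <= g t.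
Proof.
case: H => _ [_ g0 g1 gp] _ _ _ /andP[].
rewrite le_eqVlt => /orP[/eqP <- _|t0]; first by rewrite g0.
rewrite le_eqVlt => /orP[/eqP ->|t1]; first by rewrite g1.
by apply/ltW/gp; rewrite t0.
Qed.

Lemma g_clamp_continuous : continuous (g \o clamp).
Proof. by case: H => _ [gC _ _ _] _ _ _; exact: continuous_clamp. Qed.

Lemma g_continuous t : 0 < t < 1 -> {for t, continuous g}.
Proof.
move=> t01; have := @g_clamp_continuous t.
rewrite /continuous_at /= clamp_id; last by lra.
move=> gt; apply: cvg_trans gt; apply: near_eq_cvg; apply/nearE_dist.
exists (Num.min t (1 - t)); first by rewrite lt_min; lra.
by move=> s; rewrite lt_min !ltr_norml => st; rewrite /= clamp_id//; lra.
Qed.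

Lemma d_gt0 t : 0 < t < 1 -> 0 < d t.
Proof. by case: H => _ _ [_ _ dp _] _ _; exact: dp. Qed.

Lemma d_continuous t : 0 < t < 1 -> t \notin jumps r m -> {for t, continuous d}.
Proof. by case: H => _ _ [_ _ _ dC] _ _; exact: piecewise_continuousE. Qed.

(** Lower semicontinuity and positivity keep d away from 0 near interior
    points, in particular at its jumps; this is why its one-sided limits there
    are positive. *)
Lemma d_lower t : 0 < t < 1 -> exists2 e, 0 < e & \forall s \near t, e <= d s.
Proof.
move=> t01; have dt := d_gt0 t01; exists (d t / 2); first by rewrite divr_gt0.
case: H => _ _ [_ lsc _ _] _ _.
have [|V] := lsc t (d t / 2); first by rewrite lte_fin; lra.
case: (@nbhs_subspaceP _ (`[0, 1]%classic : set R)) => [|]; last first.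
  by move=> Nt; exfalso; apply: Nt; rewrite /= in_itv /=; lra.
move=> _ /nearE_dist[e e0 He] VP; apply/nearE_dist.
exists (Num.min e (Num.min t (1 - t))); first by rewrite !lt_min e0; lra.
move=> s; rewrite !lt_min => /and3P[se st s1].
have /VP : V s.
  by apply: He => //; move: st s1; rewrite /= in_itv /= !ltr_norml; lra.
by rewrite lte_fin => /ltW.
Qed.

Lemma m_breakpoints : breakpoints r m.
Proof. by case: H => _ _ [_ _ _ []]. Qed.

Lemma m_in i : (0 < i <= r)%N -> 0 < m i < 1.
Proof. exact: (breakpoints_in m_breakpoints). Qed.

Lemma d_jump i : (0 < i <= r)%N -> exists l1 l2 : R, [/\ 0 < l1, 0 < l2,
  d t @[t --> (m i)^'-] --> l1 & d t @[t --> (m i)^'+] --> l2].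
Proof.
move=> ir; have [e e0 de] := d_lower (m_in ir).
case: H => _ _ [_ _ _ [_ dj _]] _ _; have [l1 [l2 [dl1 dl2 _]]] := dj i ir.
exists l1, l2; split => //; apply: (lt_le_trans e0).
  apply: (cvgr_to_ge dl1); exact: (@cvg_within _ (nbhs (m i)) _ _ _ de).
apply: (cvgr_to_ge dl2); exact: (@cvg_within _ (nbhs (m i)) _ _ _ de).
Qed.

Lemma expo_conjugate : conjugate_exponent p - 1 = a.
Proof.
have := p_gt1; rewrite /conjugate_exponent /expo => p1.
by field; rewrite subr_eq0 gt_eqF.
Qed.

Lemma source_lower t : 0 < t < 1 -> exists2 e, 0 < e & \forall s \near t, e <= f s.
Proof.
move=> t01; have [e e0 /nearE_dist[r1 r10 H1]] := d_lower t01.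
have gt := g_gt0 t01.
have : \forall s \near t, g t / 2 < g s by apply: (cvgr_gt _ (g_continuous t01)); lra.
move=> /nearE_dist[r2 r20 H2].
exists (e `^ a * (g t / 2)); first by rewrite mulr_gt0 ?powR_gt0// divr_gt0.
apply/nearE_dist; exists (Num.min r1 r2); first by rewrite lt_min r10.
move=> s; rewrite lt_min => /andP[s1 s2]; have de := H1 s s1; have gs := H2 s s2.
apply: ler_pM; [exact: powR_ge0|lra| |exact: ltW].
by apply: (ge0_ler_powR (ltW expo_gt0)) => //; rewrite nnegrE; lra.
Qed.

Lemma source_gt0 t : 0 < t < 1 -> 0 < f t.
Proof. exact: (f_gt0 source_lower). Qed.

Lemma source_continuous t : 0 < t < 1 -> t \notin jumps r m -> {for t, continuous f}.
Proof.
move=> t01 tJ; apply: cvgM; last exact: g_continuous.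
apply: (@continuous_comp _ _ _ d (fun v : R => v `^ a)); first exact: d_continuous.
by apply: powR_continuous; exact: d_gt0.
Qed.

Notation mu := (sup (mu_set p d g)).

Lemma source_le t : 0 < t < 1 -> f t <= mu * t `^ a.
Proof.
move=> t01; have t0 : 0 < t by case/andP: t01.
rewrite -ler_pdivrMr ?powR_gt0//; apply: ub_le_sup; first by case: H.
by exists t; rewrite ?expo_conjugate//= in_itv.
Qed.

Lemma mu_gt0 : 0 < mu.
Proof.
have half01 : 0 < (1 / 2 : R) < 1 by lra.
have := lt_le_trans (source_gt0 half01) (source_le half01).
by rewrite pmulr_lgt0// powR_gt0//; lra.
Qed.

Lemma source_le_mu t : 0 < t < 1 -> f t <= mu.
Proof.
move=> t01; apply: le_trans (source_le t01) _.
rewrite -[leRHS]mulr1 ler_wpM2l ?(ltW mu_gt0)//.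
have := @ge0_ler_powR R _ (ltW expo_gt0) t 1; rewrite powR1 !nnegrE; apply; lra.
Qed.

Lemma h_continuous t : 0 < t < 1 -> t \notin jumps q k -> {for t, continuous h}.
Proof. by case: H => _ _ _ [_ _ hC] _; exact: piecewise_continuousE. Qed.

Lemma h_at0 : h t @[t --> 0^'+] --> h 0.
Proof. by case: H => _ _ _ []. Qed.

Lemma h_bounded : exists M : R, forall t, 0 <= t <= 1 -> `|h t| <= M.
Proof. by case: H => _ _ _ []. Qed.

Lemma cut_locally_bounded_measurable : locally_bounded_measurable setT (cut01 h).
Proof.
have [M hM] := h_bounded => x y _ _ xy.
have M0 : 0 <= M by apply: le_trans (hM 0 _) => //; rewrite lexx ler01.
apply: (@continuous_off_bounded_measurable _ (0 :: 1 :: jumps q k) _ _ _ M).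
  move=> t _; rewrite !inE !negb_or => /and3P[t0 t1 tJ].
  have : {for t, continuous (fun s : R => if 0 < s < 1 then h s else 0)}.
    by apply: continuous_cut => // t01; exact: h_continuous.
  rewrite /prop_for /continuous_at => hc.
  have -> : cut01 h t = if 0 < t < 1 then h t else 0.
    by rewrite /cut01 !le_eqVlt (eq_sym 0) (negbTE t0) (negbTE t1).
  apply: cvg_trans hc; apply: near_eq_cvg; apply/nearE_dist.
  exists (Num.min `|t| `|t - 1|).
    by rewrite lt_min !normr_gt0 t0 subr_eq0.
  move=> s; rewrite lt_min => /andP[s1 s2]; rewrite /cut01.
  have s0 : s != 0 by apply: contraTneq s1 => ->; rewrite sub0r normrN ltxx.
  have s1' : s != 1 by apply: contraTneq s2 => ->; rewrite distrC ltxx.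
  by rewrite ![_ <= _]le_eqVlt (eq_sym 0) (negbTE s0) (negbTE s1').
by move=> t _; rewrite /cut01; case: ifP => [/hM//|]; rewrite normr0.
Qed.

Notation P := (primitive_ext h).

Lemma primitive_extE u : 0 <= u <= 1 -> primitive h u = P u.
Proof.
move=> u01; apply: oriented_integral_eq => t tu; rewrite /cut01.
by case: ifPn => //; move: tu => /orP[]; lra.
Qed.

Lemma primitive_ext0 : P 0 = 0. Proof. exact: oriented_integral_xx. Qed.

Lemma primitive_ext_continuous : continuous P.
Proof.
move=> t; apply: (@oriented_integral_continuous _ _ _ cut_locally_bounded_measurable 0 t I).
exact: filterT.
Qed.

Lemma primitive_ext_derive t : 0 < t < 1 -> t \notin jumps q k ->
  is_derive t 1 P (h t).
Proof.
move=> t01 tJ; have hE : cut01 h t = h t by rewrite /cut01; case: ifPn => //; lra.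
rewrite -hE.
apply: (@oriented_integral_derive _ _ _ cut_locally_bounded_measurable 0 t I).
  exact: filterT.
have := h_continuous t01 tJ; rewrite /prop_for /continuous_at hE => hc.
apply: cvg_trans hc; apply: near_eq_cvg; apply/nearE_dist.
exists (Num.min t (1 - t)); first by rewrite lt_min; lra.
move=> s; rewrite lt_min !ltr_norml => st.
by rewrite /cut01; case: ifPn => //; lra.
Qed.

Lemma primitive_ext_lipschitz : exists2 M : R, 0 <= M &
  forall s t, `|P s - P t| <= M * `|s - t|.
Proof.
have [M hM] := h_bounded.
have M0 : 0 <= M by apply: le_trans (hM 0 _) => //; rewrite lexx ler01.
exists M => // s t.
have := @oriented_integral_near _ _ _ cut_locally_bounded_measurable t s 0 M I I.
rewrite mul0r subr0.
have -> : oriented_integral (cut01 h) t s = P s - P t.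
  rewrite /primitive_ext (@oriented_integral_cat _ _ _ cut_locally_bounded_measurable 0 t s)//.
  by rewrite addrAC subrr add0r.
by apply=> x _; rewrite subr0 /cut01; case: ifP => [/hM//|]; rewrite normr0.
Qed.

Notation S := (jumps r m ++ jumps q k).

Lemma wave_profile_exists c : exists w, profile a S h f c w.
Proof.
have [M hM] := h_bounded.
apply: (@profile_exists _ a M mu) => //.
- exact: expo_gt0.
- by move=> t t01; apply: hM; lra.
- exact: source_le_mu.
- exact: source_lower.
- by move=> t t01; rewrite mem_cat negb_or => /andP[_]; exact: h_continuous.
- by move=> t t01; rewrite mem_cat negb_or => /andP[tm _]; exact: source_continuous.
Qed.

Lemma signed_power0 : signed_power p 0 = 0.
Proof. by rewrite /signed_power mulr0. Qed.

Lemma signed_power_gt0 s : (0 < signed_power p s) = (0 < s).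
Proof.
have [->|s0] := eqVneq s 0; first by rewrite signed_power0.
by rewrite /signed_power pmulr_rgt0// powR_gt0// normr_gt0.
Qed.

Lemma signed_power_lt0 s : (signed_power p s < 0) = (s < 0).
Proof.
have [->|s0] := eqVneq s 0; first by rewrite signed_power0.
by rewrite /signed_power pmulr_rlt0// powR_gt0// normr_gt0.
Qed.

Lemma signed_power_eq0 s : signed_power p s = 0 -> s = 0.
Proof.
move=> s0; have [sn|sp|//] := ltgtP s 0.
  by move: sn; rewrite -signed_power_lt0 s0 ltxx.
by move: sp; rewrite -signed_power_gt0 s0 ltxx.
Qed.

Lemma signed_powerN x : 0 < x -> signed_power p (- x `^ a) = - x.
Proof.
move=> x0; rewrite /signed_power normrN ger0_norm ?powR_ge0// mulrN; congr (- _).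
have xa : 0 < x `^ a by rewrite powR_gt0.
rewrite -[X in _ * X]powRr1 ?powR_ge0// -powRD; last by rewrite (gt_eqF xa) implybT.
rewrite -powRrM (_ : a * (p - 2 + 1) = 1) ?powRr1 ?(ltW x0)// /expo.
by have := p_gt1 => p1; field; rewrite subr_eq0 gt_eqF.
Qed.

Lemma signed_power_lt0E s x : s < 0 -> signed_power p s = - x -> s = - x `^ a.
Proof.
move=> s0 sx; have Ns0 : 0 < - s by rewrite oppr_gt0.
have {sx}-> : x = (- s) `^ (p - 1).
  apply: oppr_inj; rewrite -sx /signed_power ltr0_norm// -[s in _ * s]opprK mulrN.
  congr (- _); rewrite mulrC; have -> : p - 2 = p - 1 - 1 by ring.
  by rewrite mulr_powRB1// ?(ltW Ns0)// subr_gt0; exact: p_gt1.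
rewrite -powRrM (_ : (p - 1) * a = 1) ?powRr1 ?(ltW Ns0) ?opprK// /expo.
by have := p_gt1 => p1; field; rewrite subr_eq0 gt_eqF.
Qed.

End Consequences.
End Setting.

(** * Monotonicity of travelling waves *)

Section Signs.
Context {R : realType}.
Implicit Types (u : R -> R) (z a e : R).

Lemma left_quotient_gt0 u z a : 0 < a -> left_quotient_limit u z a ->
  \forall s \near z^'-, u s < u z.
Proof.
move=> a0 /left_quotientE/(_ (a / 2))[]; first by rewrite divr_gt0.
move=> r r0 Hr; apply/near_leftE; exists r => // s sz.
have := Hr s sz; rewrite ler_norml => /andP[_ us].
have : 0 < a * (z - s) by rewrite mulr_gt0//; lra.
by lra.
Qed.

Lemma left_quotient_lt0 u z a : a < 0 -> left_quotient_limit u z a ->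
  \forall s \near z^'-, u z < u s.
Proof.
move=> a0 /left_quotientE/(_ (- a / 2))[]; first by rewrite divr_gt0// oppr_gt0.
move=> r r0 Hr; apply/near_leftE; exists r => // s sz.
have := Hr s sz; rewrite ler_norml => /andP[us _].
have : 0 < - a * (z - s) by rewrite mulr_gt0//; lra.
by lra.
Qed.

Lemma right_quotient_lt0 u z a : a < 0 -> right_quotient_limit u z a ->
  \forall s \near z^'+, u s < u z.
Proof.
move=> a0 /right_quotientE/(_ (- a / 2))[]; first by rewrite divr_gt0// oppr_gt0.
move=> r r0 Hr; apply/near_rightE; exists r => // s sz.
have := Hr s sz; rewrite ler_norml => /andP[_ us].
have : 0 < - a * (s - z) by rewrite mulr_gt0//; lra.
by lra.
Qed.

Lemma quotients_is_derive u z a : left_quotient_limit u z a ->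
  right_quotient_limit u z a -> is_derive z 1 u a.
Proof.
move=> /left_quotientE ul /right_quotientE ur; apply/is_deriveE_dist => e e0.
have [r1 r10 H1] := ul e e0; have [r2 r20 H2] := ur e e0.
exists (Num.min r1 r2); first by rewrite lt_min r10.
move=> s; rewrite lt_min => /andP[s1 s2].
have [sz|zs|->] := ltgtP s z; last by rewrite !subrr mulr0 subrr normr0 mulr0.
- rewrite [`|s - z|]ltr0_norm ?subr_lt0// opprB.
  by apply: H1; move: s1; rewrite ltr_norml; lra.
- rewrite [`|s - z|]gtr0_norm ?subr_gt0//.
  by apply: H2; move: s2; rewrite ltr_norml; lra.
Qed.

Lemma near_notin (l : seq R) x : x \notin l -> \forall y \near x, y \notin l.
Proof.
elim: l => [|b l IH]; first by move=> _; apply/nearE_dist; exists 1.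
rewrite inE negb_or => /andP[xb /IH /nearE_dist[r r0 Hr]].
apply/nearE_dist; exists (Num.min r `|x - b|).
  by rewrite lt_min r0 normr_gt0 subr_eq0.
move=> y; rewrite lt_min => /andP[yr yb]; rewrite inE negb_or Hr// andbT.
by apply: contraTneq yb => ->; rewrite distrC ltxx.
Qed.

Lemma boundary_out (A : set R) z : (\forall s \near z, ~ A s) -> ~ boundary A z.
Proof. by move=> nA [cA _]; have [s [As nAs]] := cA _ nA. Qed.

End Signs.

Section ContinuousWave.
Context {R : realType}.
Variables (U : R -> R) (r : nat) (m : nat -> R).
Hypothesis UC : continuous U.
Implicit Types (s z : R).
Notation support z := (0 < U z < 1).

Lemma support_near z : support z -> \forall s \near z, support s.
Proof.
move=> /andP[z0 z1]; have Uz : {for z, continuous U} := @UC z.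
have h0 : \forall s \near z, 0 < U s by apply: (cvgr_gt _ Uz).
have h1 : \forall s \near z, U s < 1 by apply: (cvgr_lt _ Uz).
by near=> s; apply/andP; split; near: s.
Unshelve. all: by end_near. Qed.

Lemma support_end z : support z -> ~ boundary (end_set U) z.
Proof.
move=> /support_near Uz; apply: boundary_out; apply: filterS Uz => s Us.
by case=> E; move: Us; rewrite E ?ltxx ?andbF.
Qed.

Lemma notin_level z : U z \notin jumps r m -> ~ boundary (level_set r m U) z.
Proof.
move=> /near_notin Uz; apply: boundary_out.
have : \forall s \near z, U s \notin jumps r m by exact: (@UC z _ Uz).
apply: filterS => s /negP Us [i ir E]; apply: Us; apply/jumpsP; exists i => //.
Qed.

End ContinuousWave.

Section Wave.
Context {R : realType}.
Variables (p : R) (g d h : R -> R) (r : nat) (m : nat -> R) (q : nat) (k : nat -> R).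
Hypothesis H : admissible p g d h r m q k.
Variables (c : R) (U : R -> R).
Hypothesis sol : is_solution p d g h r m c U.
Hypothesis bc : boundary_conditions U.
Implicit Types (t s e x y z : R).
Notation a := (expo p).
Notation f := (reduced_source p d g).
Notation P := (primitive_ext h).
Notation Sm := (jumps r m).
Notation S := (jumps r m ++ jumps q k).
Notation v := (extended_flux p d r m U).
Notation support z := (0 < U z < 1).

Let U01 z : 0 <= U z <= 1. Proof. exact: (sol_range sol). Qed.
Let UC : continuous U. Proof. exact: (sol_continuous sol). Qed.
Let vC : continuous v. Proof. exact: (sol_flux_continuous sol). Qed.

Lemma flux_level z : support z -> boundary (level_set r m U) z ->
  v z = transition_value p d U z.
Proof.
by move=> Uz bz; rewrite /extended_flux memNset ?mem_set//; exact: (support_end UC).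
Qed.

Lemma flux_nolevel z : support z -> ~ boundary (level_set r m U) z ->
  v z = flux p d U z.
Proof.
by move=> Uz bz; rewrite /extended_flux !memNset//; exact: (support_end UC).
Qed.

Lemma flux_derive z : support z -> ~ boundary (level_set r m U) z ->
  exists b, is_derive z 1 U b /\ v z = d (U z) * signed_power p b.
Proof.
move=> Uz nz; rewrite flux_nolevel//; exists (derive1 U z); split => //.
have [] := sol_C1 sol (z := z); first by case=> //; exact: (support_end UC).
by move=> dU _; rewrite derive1E; exact: DeriveDef.
Qed.

(** One statement for all points with 0 < U < 1: at jumps of d it comes from
    the transition condition, elsewhere both quotients are the derivative. The
    positive factors make the sign of the flux the sign of the slope. *)
Lemma flux_quotients z : support z -> exists a1 a2 l1 l2 : R,
  [/\ 0 < l1, 0 < l2, left_quotient_limit U z a1, right_quotient_limit U z a2 &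
      v z = signed_power p a1 * l1 /\ v z = signed_power p a2 * l2].
Proof.
move=> Uz; have [bz|nbz] := pselect (boundary (level_set r m U) z); last first.
  have [b [Ub vb]] := flux_derive Uz nbz; have [ul ur] := is_derive_quotients Ub.
  exists b, b, (d (U z)), (d (U z)); split => //; try exact: (d_gt0 H).
  by rewrite vb mulrC.
have [a1 [a2 [l1 [l2 [ul ur dl1 dl2 E]]]]] := sol_transition sol bz.
have [e e0 de] := d_lower H Uz.
have dU : \forall s \near z, e <= d (U s) by exact: (@UC z _ de).
have l10 : 0 < l1.
  by apply: (lt_le_trans e0); apply: (cvgr_to_ge dl1); exact: (@cvg_within _ (nbhs z) _ _ _ dU).
have l20 : 0 < l2.
  by apply: (lt_le_trans e0); apply: (cvgr_to_ge dl2); exact: (@cvg_within _ (nbhs z) _ _ _ dU).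
exists a1, a2, l1, l2; split => //.
have vE : v z = signed_power p a1 * l1.
  rewrite flux_level// /transition_value /left_derivative.
  by congr (signed_power p _ * _); apply/cvg_lim.
by split => //; rewrite vE.
Qed.

Lemma flux_gt0_left z : support z -> 0 < v z -> \forall s \near z^'-, U s < U z.
Proof.
move=> /flux_quotients[a1 [a2 [l1 [l2 [l10 l20 ul ur [-> _]]]]]].
by rewrite pmulr_lgt0// signed_power_gt0 => a10; exact: left_quotient_gt0 ul.
Qed.

Lemma flux_lt0_left z : support z -> v z < 0 -> \forall s \near z^'-, U z < U s.
Proof.
move=> /flux_quotients[a1 [a2 [l1 [l2 [l10 l20 ul ur [-> _]]]]]].
by rewrite pmulr_llt0// signed_power_lt0 => a10; exact: left_quotient_lt0 ul.
Qed.

(** The integrated left-hand side of the equation, without its reaction term. *)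
Definition energy z := v z + c * U z - P (U z).

Lemma energy_diff x y :
  energy y - energy x = - oriented_integral (g \o clamp \o U) x y.
Proof.
have := sol_integral sol x y; rewrite !(primitive_extE h)//.
rewrite (@oriented_integral_eq _ (fun t => g (U t)) (g \o clamp \o U)); last first.
  by move=> t _; rewrite /= clamp_id.
by rewrite /energy; lra.
Qed.

(** The energy is differentiable everywhere, also where U and the flux are
    not. *)
Lemma energy_derive z : is_derive z 1 energy (- g (U z)).
Proof.
have gUC : continuous (g \o clamp \o U).
  by move=> t; apply: continuous_comp; [exact: UC|exact: (g_clamp_continuous H)].
have -> : energy = (fun y => energy 0 - oriented_integral (g \o clamp \o U) 0 y).
  by apply/funext => y; rewrite -[_ - _ in RHS]/(_ + - _) -energy_diff; ring.
have -> : g (U z) = (g \o clamp \o U) z by rewrite /= clamp_id.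
rewrite -[- _]add0r; apply: is_deriveB.
apply: (@oriented_integral_derive _ _ _ (continuous_locally_bounded_measurable gUC) 0 z I).
  exact: filterT.
exact: gUC.
Qed.

Lemma energy_noninc x y : x <= y -> energy y <= energy x.
Proof.
move=> xy; have : (- energy) x <= (- energy) y; last by rewrite !fctE; lra.
apply: (@ndecr_off _ [::]); first exact: xy.
  move=> t _; apply: cvgN; exact: (derivative_continuous (energy_derive t)).
move=> t _ _; exists (- - g (U t)); first by apply: is_deriveN; exact: energy_derive.
by rewrite opprK (g_ge0 H).
Qed.

Lemma energy_lt x y : x < y -> (forall z, x < z <= y -> support z) ->
  energy y < energy x.
Proof.
move=> xy sup; have : (- energy) x < (- energy) y; last by rewrite !fctE; lra.
have D t : is_derive t 1 (- energy) (- - g (U t)) by apply: is_deriveN; exact: energy_derive.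
apply: left_incr; first exact: xy.
  move=> t _; exact: (derivative_continuous (D t)).
move=> t xt; apply: (@left_quotient_gt0 _ (- energy) _ (- - g (U t))).
  by rewrite opprK (g_gt0 H)// sup.
by have [] := is_derive_quotients (D t).
Qed.

Lemma energy_pinfty : energy z @[z --> +oo] --> (0 : R).
Proof.
rewrite (_ : 0 = 0 + c * 0 - P 0); last by rewrite mulr0 (primitive_ext0 h); ring.
have [_ U0] := bc.
apply: cvgB; last by apply: continuous_cvg => //; exact: (primitive_ext_continuous H).
apply: cvgD; first exact: (sol_flux_pinfty sol).
by apply: cvgM => //; exact: cvg_cst.
Qed.

Lemma energy_ge0 z : 0 <= energy z.
Proof.
apply: (cvgr_to_le energy_pinfty).
by exists z; split; [exact: num_real|move=> x zx; exact/energy_noninc/ltW].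
Qed.

(** At a zero of the flux U has derivative 0, and so has its composition with
    the Lipschitz primitive of h, even at jumps of h; in the equation only the
    reaction term contributes. *)
Lemma flux_zero_derive z : support z -> v z = 0 -> is_derive z 1 v (- g (U z)).
Proof.
move=> Uz vz.
have UD : is_derive z 1 U 0.
  have [a1 [a2 [l1 [l2 [l10 l20 ul ur [E1 E2]]]]]] := flux_quotients Uz.
  have a10 : a1 = 0.
    apply: (@signed_power_eq0 _ p); apply/eqP; move/eqP: E1.
    by rewrite vz eq_sym mulf_eq0 (gt_eqF l10) orbF.
  have a20 : a2 = 0.
    apply: (@signed_power_eq0 _ p); apply/eqP; move/eqP: E2.
    by rewrite vz eq_sym mulf_eq0 (gt_eqF l20) orbF.
  by subst; exact: quotients_is_derive.
have PD : is_derive z 1 (P \o U) 0.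
  apply/is_deriveE_dist => e e0.
  have [M M0 PM] := primitive_ext_lipschitz H.
  have eM : 0 < e / (M + 1) by rewrite divr_gt0//; lra.
  move/is_deriveE_dist: UD => /(_ _ eM)[s s0 Hs]; exists s => // y yz.
  have := Hs y yz; rewrite !mul0r !subr0 => Uy /=.
  apply: (le_trans (PM _ _)).
  apply: (le_trans (ler_wpM2l M0 Uy)).
  rewrite mulrA ler_wpM2r// mulrA ler_pdivrMr; last lra.
  by have := ltW e0; nra.
have -> : v = energy - (fun z => c * U z) + (P \o U).
  by apply/funext => y; rewrite !fctE /energy /=; ring.
have -> : - g (U z) = - g (U z) - c * 0 + 0 by ring.
apply: is_deriveD; apply: is_deriveB; first exact: energy_derive.
Qed.

(** A zero of the flux can be moved slightly left to a positive value. Going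
    further left, U decreases until it reaches 0 with zero flux, and there the
    energy is 0; but the energy is nonnegative everywhere and strictly
    decreases to the right of that point. *)
Lemma flux_neg z : support z -> v z < 0.
Proof.
move=> Uz; rewrite ltNge; apply/negP => vz.
(* At a zero of the flux its derivative - g (U z) is negative, so that the flux
   is positive just to the left. *)
wlog {vz} vz : z Uz / 0 < v z.
  move=> W; move: vz; rewrite le_eqVlt => /orP[/eqP vz|]; last exact: W.
  have vD := flux_zero_derive Uz (esym vz).
  have [vl _] := is_derive_quotients vD.
  have gn : - g (U z) < 0 by rewrite oppr_lt0 (g_gt0 H).
  move: (left_quotient_lt0 gn vl) => /near_leftE[e1 e10 He1].
  have /nearE_dist[e2 e20 He2] := support_near UC Uz.
  pose s := z - Num.min e1 e2 / 2.
  have e0 : 0 < Num.min e1 e2 by rewrite lt_min e10.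
  have [ee1 ee2] : Num.min e1 e2 <= e1 /\ Num.min e1 e2 <= e2 by rewrite !ge_min !lexx orbT.
  apply: (W s).
    by apply: He2; rewrite ltr_norml /s; lra.
  by rewrite {1}vz; apply: He1; rewrite /s; lra.
(* kap is positive exactly where 0 < U < 1 and the flux is positive; y below is
   its last zero before z. *)
pose kap s := Num.min (v s) (Num.min (U s) (1 - U s)).
have kapC : continuous kap.
  move=> s; apply: (@continuous_min R R v (fun x => Num.min (U x) (1 - U x))).
    exact: vC.
  apply: (@continuous_min R R U (fun x => 1 - U x)); first exact: UC.
  by apply: cvgB; [exact: cvg_cst|exact: UC].
have kapP s : 0 < kap s -> support s /\ 0 < v s.
  by rewrite !lt_min => /and3P[-> -> ?]; split => //; lra.
have kz : 0 < kap z by rewrite !lt_min vz; lra.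
have incr x : x < z -> (forall s, x < s <= z -> 0 < kap s) -> U x < U z.
  move=> xz kx; apply: left_incr => //; first by move=> t _; exact: UC.
  by move=> t /kx /kapP[? ?]; exact: flux_gt0_left.
have [[x xz kx]|nk] := pselect (exists2 x, x <= z & kap x <= 0); last first.
  have [U1 _] := bc.
  have /cvgrPdist_lt/(_ (1 - U z)) := U1.
  move=> []; first lra.
  move=> M [_ HM]; pose x := Num.min (M - 1) (z - 1).
  have [xM xz] : x <= M - 1 /\ x <= z - 1 by rewrite !ge_min !lexx orbT.
  have := HM x ltac:(lra); rewrite ltr_norml => UM.
  have : U x < U z.
    apply: incr; first lra.
    by move=> s sz; rewrite ltNge; apply/negP => ks; apply: nk; exists s => //; lra.
  lra.
have [|y [xy yz ky Hy]] := last_time xz _ kx kz; first by move=> t _; exact: kapC.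
have Uyz : U y < U z by apply: incr.
have := lexx (0 : R); rewrite -{2}ky !le_min => /and3P[vy Uy _].
have Uy0 : U y = 0.
  apply/eqP; rewrite eq_le Uy andbT leNgt; apply/negP => Uy'.
  have suy : support y by lra.
  have vy0 : v y = 0.
    apply/eqP; rewrite eq_le vy andbT; move: ky.
    by rewrite /kap /Num.min; case: ltP => [_ ->//|_]; case: ltP; lra.
  have [_ vr] := is_derive_quotients (flux_zero_derive suy vy0).
  have gn : - g (U y) < 0 by rewrite oppr_lt0 (g_gt0 H).
  move: (right_quotient_lt0 gn vr) => /near_rightE[e e0 He].
  pose s := Num.min z (y + e / 2).
  have [sz se] : s <= z /\ s <= y + e / 2 by rewrite !ge_min !lexx orbT.
  have ys : y < s by rewrite lt_min yz; lra.
  have [_] := kapP s (Hy s ltac:(lra)).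
  by have := He s ltac:(lra); rewrite vy0; lra.
have vy0 : v y = 0.
  rewrite /extended_flux mem_set//; split.
    by apply: subset_closure; left.
  move=> /nearE_dist[e e0 He].
  pose s := Num.min z (y + e / 2).
  have [sz se] : s <= z /\ s <= y + e / 2 by rewrite !ge_min !lexx orbT.
  have ys : y < s by rewrite lt_min yz; lra.
  have [/andP[s0 s1] _] := kapP s (Hy s ltac:(lra)).
  have [|E|E] := He s; first by rewrite ltr_norml; lra.
    by rewrite E ltxx in s0.
  by rewrite E ltxx in s1.
have : energy z < energy y.
  by apply: energy_lt => // s /Hy /kapP[].
have := energy_ge0 z; rewrite {3}/energy vy0 Uy0 (primitive_ext0 h) mulr0.
lra.
Qed.

(** An increase would produce a first time at which an intermediate level is
    reached from below, although the flux there is negative. *)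
Lemma wave_noninc x y : x <= y -> U y <= U x.
Proof.
rewrite le_eqVlt => /orP[/eqP ->//|xy]; rewrite leNgt; apply/negP => Uxy.
pose w := (U x + U y) / 2.
have [|||t [xt ty wt Ht]] := @first_time _ (- U) x y (- w) (ltW xy).
- by move=> t _; apply: cvgN; exact: UC.
- by rewrite fctE /w; lra.
- by rewrite fctE /w; lra.
have Ut : U t = w by move: wt; rewrite fctE => /oppr_inj.
have st : support t by have := U01 x; have := U01 y; rewrite Ut /w; lra.
have /near_leftE[e e0 He] := flux_lt0_left st (flux_neg st).
pose s := Num.max x (t - e / 2).
have [xs es] : x <= s /\ t - e / 2 <= s by rewrite !le_max !lexx orbT.
have s_t : s < t by rewrite gt_max xt; lra.
have := Ht s ltac:(lra); have := He s ltac:(lra).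
by rewrite fctE Ut; lra.
Qed.

Lemma wave_decr_right x y : support y -> x < y -> U y < U x.
Proof.
move=> sy xy; have /near_leftE[e e0 He] := flux_lt0_left sy (flux_neg sy).
pose s := Num.max x (y - e / 2).
have [xs es] : x <= s /\ y - e / 2 <= s by rewrite !le_max !lexx orbT.
have s_y : s < y by rewrite gt_max xy; lra.
exact: lt_le_trans (He s ltac:(lra)) (wave_noninc xs).
Qed.

Lemma support_convex x y z : support x -> support y -> x <= z <= y -> support z.
Proof.
move=> sx sy /andP[xz zy]; have := wave_noninc xz; have := wave_noninc zy; lra.
Qed.

(** U is injective on its support, so exceptional values come from finitely many
    points, which the lemmas on derivatives off a finite set can ignore. *)
Lemma wave_preimage (l : seq R) : exists T : seq R,
  forall z, support z -> U z \in l -> z \in T.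
Proof.
elim: l => [|b l [T HT]]; first by exists [::].
have [[z [sz zb]]|nz] := pselect (exists z, support z /\ U z = b); last first.
  exists T => z sz; rewrite inE => /orP[/eqP zb|]; last exact: HT.
  by exfalso; apply: nz; exists z.
exists (z :: T) => y sy; rewrite !inE => /orP[/eqP yb|yl]; last first.
  by rewrite HT ?orbT.
have [yz|zy|//] := ltgtP y z.
  by have := wave_decr_right sz yz; rewrite zb yb ltxx.
by have := wave_decr_right sy zy; rewrite zb yb ltxx.
Qed.

Lemma wave_derive z : support z -> U z \notin Sm ->
  is_derive z 1 U (- (- v z / d (U z)) `^ a).
Proof.
move=> sz Uz; have [b [Ub vb]] := flux_derive sz (notin_level UC Uz).
have d0 := d_gt0 H sz; have v0 := flux_neg sz.
suff <- : b = - (- v z / d (U z)) `^ a by [].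
apply: (signed_power_lt0E H).
  by rewrite -(signed_power_lt0 p) -(pmulr_rlt0 _ d0) -vb.
by rewrite vb; field; rewrite gt_eqF.
Qed.

(** Either U takes the value 1, and its last such point is a boundary point of
    the end set, where the flux is 0 by definition; or it stays below 1 and
    the limits at - oo are used. *)
Lemma left_end z e : support z -> 0 < e ->
  exists x, [/\ x <= z, support x, - v x < e & 1 - e < U x].
Proof.
move=> sz e0; have [[y Uy]|ny] := pselect (exists y, U y = 1).
  have yz : y <= z.
    rewrite leNgt; apply/negP => /ltW /wave_noninc; rewrite Uy; lra.
  have [|||t [yt tz Ut Ht]] := @last_time _ (- U) y z (- 1) yz.
  - by move=> t _; apply: cvgN; exact: UC.
  - by rewrite fctE Uy.
  - by rewrite fctE; lra.
  have {}Ut : U t = 1 by move: Ut; rewrite fctE => /oppr_inj.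
  have supt s : t < s <= z -> support s.
    move=> /[dup] ts /Ht; rewrite fctE => Us.
    have sle : s <= z by case/andP: ts.
    by have := wave_noninc sle; lra.
  have vt : v t = 0.
    rewrite /extended_flux mem_set//; split.
      by apply: subset_closure; right.
    move=> /nearE_dist[e' e'0 He].
    pose s := Num.min z (t + e' / 2).
    have [s_z se] : s <= z /\ s <= t + e' / 2 by rewrite !ge_min !lexx orbT.
    have ts : t < s by rewrite lt_min tz; lra.
    have /andP[s0 s1] := supt s ltac:(lra).
    have [|E|E] := He s; first by rewrite ltr_norml; lra.
      by rewrite E ltxx in s0.
    by rewrite E ltxx in s1.
  have /cvgrPdist_lt/(_ _ e0)/nearE_dist[r1 r10 H1] := @vC t.
  have /cvgrPdist_lt/(_ _ e0)/nearE_dist[r2 r20 H2] := @UC t.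
  pose s := Num.min z (t + Num.min r1 r2 / 2).
  have [s_z se] : s <= z /\ s <= t + Num.min r1 r2 / 2 by rewrite !ge_min !lexx orbT.
  have [rr1 rr2] : Num.min r1 r2 <= r1 /\ Num.min r1 r2 <= r2 by rewrite !ge_min !lexx orbT.
  have rr0 : 0 < Num.min r1 r2 by rewrite lt_min r10.
  have ts : t < s by rewrite lt_min tz; lra.
  exists s; split => //; first by apply: supt; lra.
    have := H1 s ltac:(rewrite ltr_norml; lra); rewrite vt sub0r normrN ltr_norml; lra.
  have := H2 s ltac:(rewrite ltr_norml; lra); rewrite Ut ltr_norml; lra.
have [U1 _] := bc; have v0 := sol_flux_ninfty sol.
have [M1 [_ HM1]] := (cvgrPdist_lt _ _).1 U1 _ e0.
have [M2 [_ HM2]] := (cvgrPdist_lt _ _).1 v0 _ e0.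
pose x := Num.min z (Num.min (M1 - 1) (M2 - 1)).
have [xz x1 x2] : [/\ x <= z, x <= M1 - 1 & x <= M2 - 1] by rewrite !ge_min !lexx !orbT.
exists x; split => //.
- have := wave_noninc xz; have := U01 x => /andP[_].
  rewrite le_eqVlt => /orP[/eqP Ux|]; last lra.
  by exfalso; apply: ny; exists x.
- by have := HM2 x ltac:(lra); rewrite sub0r normrN ltr_norml; lra.
- by have := HM1 x ltac:(lra); rewrite ltr_norml; lra.
Qed.

Lemma right_end z e : support z -> 0 < e ->
  exists x, [/\ z <= x, support x, - v x < e & U x < e].
Proof.
move=> sz e0; have [[y Uy]|ny] := pselect (exists y, U y = 0).
  have zy : z <= y.
    rewrite leNgt; apply/negP => /ltW /wave_noninc; rewrite Uy; lra.
  have [|||t [zt ty Ut Ht]] := @first_time _ U z y 0 zy.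
  - by move=> t _; exact: UC.
  - by case/andP: sz.
  - by rewrite Uy.
  have supt s : z <= s < t -> support s.
    move=> /[dup] ts /Ht Us.
    have sle : z <= s by case/andP: ts.
    by have := wave_noninc sle; lra.
  have vt : v t = 0.
    rewrite /extended_flux mem_set//; split.
      by apply: subset_closure; left.
    move=> /nearE_dist[e' e'0 He].
    pose s := Num.max z (t - e' / 2).
    have [s_z se] : z <= s /\ t - e' / 2 <= s by rewrite !le_max !lexx orbT.
    have ts : s < t by rewrite gt_max zt; lra.
    have /andP[s0 s1] := supt s ltac:(lra).
    have [|E|E] := He s; first by rewrite ltr_norml; lra.
      by rewrite E ltxx in s0.
    by rewrite E ltxx in s1.
  have /cvgrPdist_lt/(_ _ e0)/nearE_dist[r1 r10 H1] := @vC t.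
  have /cvgrPdist_lt/(_ _ e0)/nearE_dist[r2 r20 H2] := @UC t.
  pose s := Num.max z (t - Num.min r1 r2 / 2).
  have [s_z se] : z <= s /\ t - Num.min r1 r2 / 2 <= s by rewrite !le_max !lexx orbT.
  have [rr1 rr2] : Num.min r1 r2 <= r1 /\ Num.min r1 r2 <= r2 by rewrite !ge_min !lexx orbT.
  have rr0 : 0 < Num.min r1 r2 by rewrite lt_min r10.
  have ts : s < t by rewrite gt_max zt; lra.
  exists s; split => //; first by apply: supt; lra.
    have := H1 s ltac:(rewrite ltr_norml; lra); rewrite vt sub0r normrN ltr_norml; lra.
  have := H2 s ltac:(rewrite ltr_norml; lra); rewrite Ut sub0r normrN ltr_norml; lra.
have [_ U0] := bc; have v0 := sol_flux_pinfty sol.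
have [M1 [_ HM1]] := (cvgrPdist_lt _ _).1 U0 _ e0.
have [M2 [_ HM2]] := (cvgrPdist_lt _ _).1 v0 _ e0.
pose x := Num.max z (Num.max (M1 + 1) (M2 + 1)).
have [xz x1 x2] : [/\ z <= x, M1 + 1 <= x & M2 + 1 <= x] by rewrite !le_max !lexx !orbT.
exists x; split => //.
- have := wave_noninc xz; have := U01 x => /andP[+ _].
  rewrite le_eqVlt => /orP[/eqP Ux|]; last lra.
  by exfalso; apply: ny; exists x.
- by have := HM2 x ltac:(lra); rewrite sub0r normrN ltr_norml; lra.
- by have := HM1 x ltac:(lra); rewrite sub0r normrN ltr_norml; lra.
Qed.

End Wave.

(** * Waves determine profiles, and profiles determine waves *)

Lemma powR_div {R : realType} (x y b : R) : 0 < x -> 0 < y ->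
  (x / y) `^ b = x `^ b / y `^ b.
Proof.
move=> x0 y0; rewrite powRM ?invr_ge0 ?ltW//; congr (_ * _).
by rewrite -[y^-1]powR_inv1 ?ltW// -powRrM mulN1r powRN.
Qed.

Section Position.
Context {R : realType}.
Variables (p : R) (g d h : R -> R) (r : nat) (m : nat -> R) (q : nat) (k : nat -> R).
Hypothesis H : admissible p g d h r m q k.
Implicit Types (t s e x y z : R).
Notation a := (expo p).
Notation f := (reduced_source p d g).
Notation Sm := (jumps r m).
Notation S := (jumps r m ++ jumps q k).
Variables (c : R) (w : R -> R).
Hypothesis pw : profile a S h f c w.

Let w0 t : 0 < t < 1 -> 0 < w t. Proof. exact: (profile_gt0 pw). Qed.

(** The abscissa at which the decreasing wave takes the value t. *)
Definition position : R -> R := oriented_integral (fun t => - (d t / w t) `^ a) (1 / 2).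

Lemma slowness_continuous t : 0 < t < 1 -> t \notin Sm ->
  {for t, continuous (fun s => - (d s / w s) `^ a)}.
Proof.
move=> t01 tS; apply: cvgN.
apply: (@continuous_comp _ _ _ (fun s => d s / w s) (fun v : R => v `^ a)).
  apply: cvgM; first exact: (d_continuous H).
  by apply: cvgV; [rewrite gt_eqF// w0|exact: (profile_continuous pw)].
by apply: powR_continuous; rewrite divr_gt0 ?w0 ?(d_gt0 H).
Qed.

(** The possibly unbounded diffusion is controlled through (d / w)^a = f / (g
    w^a) with f bounded and g w^a bounded below on compact intervals. *)
Lemma slowness_locally_bounded :
  locally_bounded_measurable [set t | 0 < t < 1] (fun s => - (d s / w s) `^ a).
Proof.
move=> x y /= x01 y01 xy.
have [||z z01 Hz] := @EVT_min R (fun t => g t * w t `^ a) x y; first exact: xy.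
  apply: continuous_in_subspaceT => t; rewrite inE /= in_itv /= => xty.
  have t01 : 0 < t < 1 by lra.
  apply: cvgM; first exact: (g_continuous H).
  apply: (@continuous_comp _ _ _ w (fun v : R => v `^ a)).
    exact: (profile_continuous pw).
  by apply: powR_continuous; exact: w0.
move: z01; rewrite in_itv /= => xzy; have z01 : 0 < z < 1 by lra.
set M := g z * w z `^ a in Hz.
have M0 : 0 < M by rewrite mulr_gt0 ?(g_gt0 H) ?powR_gt0 ?w0.
apply: (@continuous_off_bounded_measurable _ Sm _ _ _ (sup (mu_set p d g) / M)).
  by move=> t ty tS; apply: slowness_continuous => //; lra.
move=> t ty; have t01 : 0 < t < 1 by lra.
have wt := w0 t01; have dt := d_gt0 H t01; have gt := g_gt0 H t01.
rewrite normrN ger0_norm ?powR_ge0// powR_div//.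
have -> : d t `^ a / w t `^ a = f t / (g t * w t `^ a).
  by rewrite /reduced_source; field; rewrite !gt_eqF// powR_gt0.
apply: ler_pM; rewrite ?invr_ge0 ?mulr_ge0 ?powR_ge0 ?(ltW gt)//.
  exact: (source_le_mu H).
by rewrite lef_pV2 ?posrE// ?mulr_gt0 ?powR_gt0//; apply: Hz; rewrite in_itv.
Qed.

Let half01 : [set t : R | 0 < t < 1] (1 / 2). Proof. by rewrite /=; lra. Qed.

Lemma unit_interval_near t : 0 < t < 1 -> \forall s \near t, [set t : R | 0 < t < 1] s.
Proof.
move=> t01; apply/nearE_dist; exists (Num.min t (1 - t)); first by rewrite lt_min; lra.
by move=> s; rewrite lt_min !ltr_norml /=; lra.
Qed.

Lemma position_continuous t : 0 < t < 1 -> {for t, continuous position}.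
Proof.
move=> t01; apply: (@oriented_integral_continuous _ _ _ slowness_locally_bounded) => //.
exact: unit_interval_near.
Qed.

Lemma position_derive t : 0 < t < 1 -> t \notin Sm ->
  is_derive t 1 position (- (d t / w t) `^ a).
Proof.
move=> t01 tS.
apply: (@oriented_integral_derive _ _ _ slowness_locally_bounded _ t half01).
  exact: unit_interval_near.
exact: slowness_continuous.
Qed.

Lemma position_half : position (1 / 2) = 0. Proof. exact: oriented_integral_xx. Qed.

(** At jumps of d there is no derivative, so the comparison with left
    neighbours is obtained from a lower bound of d / w near the point. *)
Lemma position_decr s t : 0 < s -> s < t -> t < 1 -> position t < position s.
Proof.
move=> s0 st t1; have : (- position) s < (- position) t; last by rewrite !fctE; lra.
apply: left_incr; first exact: st.
  by move=> u su; apply: cvgN; apply: position_continuous; lra.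
move=> u su; have u01 : 0 < u < 1 by lra.
have [e e0 /nearE_dist[r1 r10 H1]] := d_lower H u01.
have wC := profile_continuous pw u01.
have : \forall s \near u, w s < w u + 1 by apply: (cvgr_lt _ wC); lra.
move=> /nearE_dist[r2 r20 H2].
have wu := w0 u01.
pose K := (e / (w u + 1)) `^ a.
have K0 : 0 < K by rewrite powR_gt0// divr_gt0//; lra.
apply/near_leftE; exists (Num.min (Num.min r1 r2) u); first by rewrite !lt_min r10 r20; lra.
move=> y /andP[yu1 yu].
have [ra rb rc] : [/\ Num.min (Num.min r1 r2) u <= r1, Num.min (Num.min r1 r2) u <= r2
    & Num.min (Num.min r1 r2) u <= u] by rewrite !ge_min !lexx !orbT.
have linD (x : R) : is_derive x (1 : R) (fun s : R => K * s) K.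
  by rewrite -{2}[K]mulr1; exact: is_deriveZ.
have : (- position - (fun s => K * s)) y <= (- position - (fun s => K * s)) u.
  apply: (@ndecr_off _ Sm); first lra.
    move=> x yx; apply: cvgB; last exact: (derivative_continuous (linD x)).
    by apply: cvgN; apply: position_continuous; lra.
  move=> x yx xS; have x01 : 0 < x < 1 by lra.
  exists (- - (d x / w x) `^ a - K).
    by apply: is_deriveB; apply: is_deriveN; exact: position_derive.
  rewrite opprK subr_ge0; have wx := w0 x01.
  have dx := H1 x ltac:(rewrite ltr_norml; lra).
  have wx1 := H2 x ltac:(rewrite ltr_norml; lra).
  apply: (ge0_ler_powR (ltW (expo_gt0 H))).
  - by rewrite nnegrE divr_ge0// ltW// ltr_wpDl// ltW.
  - by rewrite nnegrE divr_ge0// ltW// (d_gt0 H).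
  - apply: ler_pM; rewrite ?invr_ge0//; [exact: ltW|exact/ltW/ltr_wpDl/ltr01/ltW|].
    by rewrite lef_pV2 ?posrE ?(ltW wx1)// ltr_wpDl// ltW.
rewrite !fctE /=; have : 0 < K * (u - y) by rewrite mulr_gt0//; lra.
lra.
Qed.

Lemma position_inj s t : 0 < s < 1 -> 0 < t < 1 -> position s = position t -> s = t.
Proof.
move=> s01 t01 E; have [st|ts|//] := ltgtP s t.
  by have := @position_decr s t ltac:(lra) st ltac:(lra); rewrite E ltxx.
by have := @position_decr t s ltac:(lra) ts ltac:(lra); rewrite E ltxx.
Qed.

Section OnWave.
Variable U : R -> R.
Hypothesis sol : is_solution p d g h r m c U.
Hypothesis bc : boundary_conditions U.
Notation P := (primitive_ext h).
Notation v := (extended_flux p d r m U).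
Notation support z := (0 < U z < 1).

Let UC : continuous U. Proof. exact: (sol_continuous sol). Qed.
Let vC : continuous v. Proof. exact: (sol_flux_continuous sol). Qed.

Let gap z := - v z - w (U z).

Let gapC z : support z -> {for z, continuous gap}.
Proof.
move=> sz; apply: cvgB; first by apply: cvgN; exact: vC.
by apply: continuous_comp; [exact: UC|exact: (profile_continuous pw)].
Qed.

Let gapD z : support z -> U z \notin S ->
  is_derive z 1 gap (g (U z) * (1 - ((- v z) / w (U z)) `^ a)).
Proof.
move=> sz; rewrite mem_cat negb_or => /andP[zm zk].
have dz := d_gt0 H sz; have wz := w0 sz; have vz := flux_neg H sol bc sz.
have Nvz : 0 < - v z by rewrite oppr_gt0.
pose b := - (- v z / d (U z)) `^ a.
have UD : is_derive z 1 U b := wave_derive H sol bc sz zm.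
have PD : is_derive z 1 (P \o U) (h (U z) * b).
  by apply: is_derive1_comp; exact: (primitive_ext_derive H).
have wD : is_derive z 1 (w \o U) ((c - h (U z) - f (U z) * w (U z) `^ (- a)) * b).
  by apply: is_derive1_comp; apply: (profile_derive pw) => //; rewrite mem_cat negb_or zm.
have ED := energy_derive H sol z.
have -> : gap = - (energy p d h r m c U - (fun z => c * U z) + (P \o U)) - (w \o U).
  by apply/funext => y; rewrite !fctE /gap /energy /=; ring.
have -> : g (U z) * (1 - ((- v z) / w (U z)) `^ a) =
    - (- g (U z) - c * b + h (U z) * b) -
    (c - h (U z) - f (U z) * w (U z) `^ (- a)) * b.
  rewrite /b !powR_div// powRN /reduced_source; field.
  by rewrite !gt_eqF// powR_gt0.
apply: is_deriveB; apply: is_deriveN; apply: is_deriveD; apply: is_deriveB.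
Qed.

(** A gap between the flux of the wave and the profile does not decrease towards
   the left end of the support, where both vanish. *)
Lemma profile_on_wave z : support z -> w (U z) = - v z.
Proof.
move=> sz; have [T HT] := wave_preimage H sol bc S.
have one : 1 `^ a = 1 by rewrite powR1.
have supp x y : support x -> x <= y <= z -> support y.
  by move=> sx; exact: (support_convex H sol bc sx sz).
have TS y : support y -> y \notin T -> U y \notin S.
  by move=> sy; apply: contra; exact: HT.
have [gz|gz|E] := ltgtP (gap z) 0; last by rewrite /gap in E; lra.
- have gz' : 0 < - gap z by rewrite oppr_gt0.
  have /cvgrPdist_lt/(_ _ gz')/near_leftE[e e0 He] := profile_at1 pw.
  have [x [xz sx _ Ux]] := left_end H sol bc sz e0.
  have : (- gap) z <= (- gap) x.
    apply: (@persist_left _ T _ x z); last by rewrite lexx xz.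
    + by move=> y xy; apply: cvgN; apply: gapC; exact: supp xy.
    + exact: gz'.
    + move=> y xy yT; rewrite fctE oppr_gt0 => gy.
      have sy : support y by apply: (supp x) => //; lra.
      exists (- (g (U y) * (1 - ((- v y) / w (U y)) `^ a))).
        by apply: is_deriveN; apply: gapD => //; exact: TS.
      have wy := w0 sy; have gy0 := g_gt0 H sy.
      have : ((- v y) / w (U y)) `^ a <= 1.
        rewrite -[leRHS]one; apply: (ge0_ler_powR (ltW (expo_gt0 H))).
        * by rewrite nnegrE divr_ge0// ltW// oppr_gt0 (flux_neg H sol bc).
        * by rewrite nnegrE ler01.
        * by rewrite ler_pdivrMr// mul1r; move: gy; rewrite /gap; lra.
      by move=> h1; rewrite oppr_le0 mulr_ge0//; lra.
  have := He (U x) ltac:(lra); rewrite sub0r normrN gtr0_norm ?w0//.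
  have := flux_neg H sol bc sx; rewrite !fctE [gap x]/gap; lra.
- have [x [xz sx vx _]] := left_end H sol bc sz gz.
  have : gap z <= gap x.
    apply: (@persist_left _ T _ x z); last by rewrite lexx xz.
    + by move=> y xy; apply: gapC; exact: supp xy.
    + exact: gz.
    + move=> y xy yT gy.
      have sy : support y by apply: (supp x) => //; lra.
      exists (g (U y) * (1 - ((- v y) / w (U y)) `^ a)).
        by apply: gapD => //; exact: TS.
      have wy := w0 sy; have gy0 := g_gt0 H sy.
      have : 1 <= ((- v y) / w (U y)) `^ a.
        rewrite -[leLHS]one; apply: (ge0_ler_powR (ltW (expo_gt0 H))).
        * by rewrite nnegrE ler01.
        * by rewrite nnegrE divr_ge0// ltW// oppr_gt0 (flux_neg H sol bc).
        * by rewrite ler_pdivlMr// mul1r; move: gy; rewrite /gap; lra.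
      by move=> h1; rewrite mulr_ge0_le0 ?(ltW gy0)//; lra.
  have := w0 sx; rewrite [gap x]/gap; lra.
Qed.

Lemma wave_vanishes z : support z -> vanishes_at0 w.
Proof.
move=> sz e e0; have [x [_ sx vx Ux]] := right_end H sol bc sz e0.
by case/andP: (sx) => U0 U1; exists (U x); split => //; rewrite profile_on_wave.
Qed.

Hypothesis Uhalf : U 0 = 1 / 2.

Let s0 : support 0. Proof. by rewrite Uhalf; lra. Qed.

(** Along the wave the derivative of position (U z) is (d / w)^a (w / d)^a =
    1, and both sides vanish at z = 0. *)
Lemma wave_position z : support z -> position (U z) = z.
Proof.
move=> sz; have [T HT] := wave_preimage H sol bc Sm.
pose u := position \o U - (fun z => z).
have uC y : support y -> {for y, continuous u}.
  move=> sy; apply: cvgB; last exact: cvg_id.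
  by apply: continuous_comp; [exact: UC|exact: position_continuous].
have uD y : support y -> y \notin T -> exists2 l, is_derive y 1 u l & `|l| <= 0.
  move=> sy yT; have yS : U y \notin Sm by apply: contra yT; exact: HT.
  have dy := d_gt0 H sy; have wy := w0 sy; have vy := flux_neg H sol bc sy.
  exists (- (d (U y) / w (U y)) `^ a * (- (- v y / d (U y)) `^ a) - 1).
    apply: is_deriveB; apply: is_derive1_comp; first exact: position_derive.
    exact: (wave_derive H sol bc).
  rewrite -profile_on_wave// mulrNN -powRM ?divr_ge0 ?(ltW dy) ?(ltW wy)//.
  rewrite (_ : _ * _ = 1) ?powR1 ?subrr ?normr0//.
  by field; rewrite !gt_eqF.
have u0 : u 0 = 0 by rewrite /u !fctE /= Uhalf position_half subrr.
suff : u z = u 0 by rewrite u0 /u !fctE /=; lra.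
apply/eqP; rewrite -subr_eq0 -normr_le0.
have [z0|z0] := leP 0 z.
  rewrite -[leRHS](mul0r (z - 0)); apply: (@lipschitz_off _ T); first exact: z0.
  - by move=> y yz; apply: uC; exact: (support_convex H sol bc s0 sz).
  - by move=> y yz; apply: uD; apply: (support_convex H sol bc s0 sz); lra.
rewrite distrC -[leRHS](mul0r (0 - z)); apply: (@lipschitz_off _ T); first exact: ltW.
- by move=> y yz; apply: uC; exact: (support_convex H sol bc sz s0).
- by move=> y yz; apply: uD; apply: (support_convex H sol bc sz s0); lra.
Qed.

End OnWave.
End Position.

Section Uniqueness.
Context {R : realType}.
Variables (p : R) (g d h : R -> R) (r : nat) (m : nat -> R) (q : nat) (k : nat -> R).
Hypothesis H : admissible p g d h r m q k.
Variable c : R.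
Notation S := (jumps r m ++ jumps q k).
Notation wave := (normalized_wave p d g h r m c).

(** Both waves are inverted by the same decreasing position; the remaining
    cases, where one wave has already reached 0 or 1, are excluded by moving
    to a point of its support close to its end. *)
Lemma wave_le (U1 U2 : R -> R) z : wave U1 -> wave U2 -> U1 z <= U2 z.
Proof.
move=> [[sol1 bc1] U10] [[sol2 bc2] U20]; rewrite leNgt; apply/negP => U21.
have [w pw] := wave_profile_exists H c.
have s1 : 0 < U1 0 < 1 by rewrite U10; lra.
have s2 : 0 < U2 0 < 1 by rewrite U20; lra.
have ni1 := wave_noninc H sol1 bc1; have ni2 := wave_noninc H sol2 bc2.
have /andP[U1p U1q] := sol_range sol1 z; have /andP[U2p U2q] := sol_range sol2 z.
have [U1z|U1z] := ltP (U1 z) 1.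
  have sz1 : 0 < U1 z < 1 by lra.
  have E1 := wave_position H pw sol1 bc1 U10 sz1.
  have [x [_ sx2 _ Ux]] := right_end H sol2 bc2 s2 (proj1 (andP sz1)).
  have E2 := wave_position H pw sol2 bc2 U20 sx2.
  have [U2z|U2z] := ltP 0 (U2 z).
    have sz2 : 0 < U2 z < 1 by lra.
    have := position_decr H pw (s := U2 z) (t := U1 z) ltac:(lra) U21 ltac:(lra).
    by rewrite E1 (wave_position H pw sol2 bc2 U20 sz2) ltxx.
  have xz : x < z by rewrite ltNge; apply/negP => /ni2; lra.
  have := position_decr H pw (s := U2 x) (t := U1 z) ltac:(lra) Ux ltac:(lra).
  by rewrite E1 E2; lra.
have z0 : z < 0 by rewrite ltNge; apply/negP => /ni1; lra.
have sz2 : 0 < U2 z < 1 by have := ni2 z 0 (ltW z0); lra.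
have E2 := wave_position H pw sol2 bc2 U20 sz2.
have [x [_ sx1 _ Ux]] := left_end H sol1 bc1 s1 (e := 1 - U2 z) ltac:(lra).
have E1 := wave_position H pw sol1 bc1 U10 sx1.
have zx : z < x by rewrite ltNge; apply/negP => /ni1; lra.
have := position_decr H pw (s := U2 z) (t := U1 x) ltac:(lra) ltac:(lra) ltac:(lra).
by rewrite E1 E2; lra.
Qed.

Lemma wave_unique (U1 U2 : R -> R) : wave U1 -> wave U2 -> U1 = U2.
Proof.
by move=> W1 W2; apply/funext => z; apply/eqP; rewrite eq_le !wave_le.
Qed.

End Uniqueness.

(** * The wave obtained by inverting the position *)

Section InverseWave.
Context {R : realType}.
Variables (p : R) (g d h : R -> R) (r : nat) (m : nat -> R) (q : nat) (k : nat -> R).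
Hypothesis H : admissible p g d h r m q k.
Implicit Types (t s e x y z : R).
Notation a := (expo p).
Notation f := (reduced_source p d g).
Notation P := (primitive_ext h).
Notation Sm := (jumps r m).
Notation S := (jumps r m ++ jumps q k).
Variables (c : R) (w : R -> R).
Hypothesis pw : profile a S h f c w.
Hypothesis w00 : vanishes_at0 w.
Notation Z := (position p d w).

Let w0 t : 0 < t < 1 -> 0 < w t. Proof. exact: (profile_gt0 pw). Qed.
Let ZC t : 0 < t < 1 -> {for t, continuous Z}. Proof. exact: (position_continuous H pw). Qed.
Let Zdecr s t : 0 < s -> s < t -> t < 1 -> Z t < Z s.
Proof. exact: (position_decr H pw). Qed.

(** Values of z beyond the range of the position are sent to 0 or 1 according
    to the sign of z, since the position vanishes at 1/2. *)
Definition profile_wave z : R :=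
  if pselect (exists t, 0 < t < 1 /\ Z t = z) is left ex then projT1 (cid ex)
  else if 0 < z then 0 else 1.

Notation U := profile_wave.
Notation support z := (0 < U z < 1).

Lemma profile_wave_range z : 0 <= U z <= 1.
Proof.
rewrite /profile_wave; case: pselect => [ex|_]; last by case: ifP; rewrite lexx ler01.
by case: (cid ex) => t [/= t01 _]; lra.
Qed.

Lemma profile_wave_position t : 0 < t < 1 -> U (Z t) = t.
Proof.
move=> t01; rewrite /profile_wave; case: pselect => [ex|[]]; last by exists t.
by case: (cid ex) => s [/= s01 /(position_inj H pw s01 t01)].
Qed.

Lemma position_profile_wave z : support z -> Z (U z) = z.
Proof.
rewrite /profile_wave; case: pselect => [ex _|_]; last by case: ifP => _; lra.
by case: (cid ex) => t [].
Qed.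

Lemma position_surjective s t z : 0 < s -> s < t -> t < 1 -> Z t <= z -> z < Z s ->
  exists2 y, 0 < y < 1 & Z y = z.
Proof.
move=> s0 st t1 Ztz zZs.
have [|y [sy yt Zy _]] := first_time (ltW st) _ zZs Ztz.
  by move=> y sty; apply: ZC; lra.
by exists y => //; lra.
Qed.

Lemma profile_wave_notin z : ~ (exists s, 0 < s < 1 /\ Z s = z) ->
  U z = if 0 < z then 0 else 1.
Proof. by rewrite /profile_wave; case: pselect. Qed.

Let half01 : 0 < (1 / 2 : R) < 1. Proof. by lra. Qed.
Let Zhalf : Z (1 / 2) = 0. Proof. exact: position_half. Qed.

Lemma profile_wave_lt t z : 0 < t < 1 -> Z t < z -> U z < t.
Proof.
move=> t01 Ztz; have [[s [s01 sz]]|nz] := pselect (exists s, 0 < s < 1 /\ Z s = z).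
  rewrite -sz profile_wave_position// ltNge; apply/negP.
  rewrite le_eqVlt => /orP[/eqP E|ts]; first by move: Ztz; rewrite -sz E ltxx.
  by have := Zdecr (s := t) (t := s) ltac:(lra) ts ltac:(lra); rewrite sz; lra.
rewrite (profile_wave_notin nz); case: ifPn => [_|]; first by lra.
rewrite -leNgt => z0; exfalso.
have [zE|zneq] := eqVneq z 0.
  by apply: nz; exists (1 / 2); rewrite Zhalf zE.
have zneg : z < 0 by rewrite lt_neqAle zneq.
have th : 1 / 2 < t.
  rewrite ltNge le_eqVlt; apply/negP => /orP[/eqP E|th].
    by move: Ztz; rewrite E Zhalf; lra.
  by have := Zdecr (s := t) (t := 1 / 2) ltac:(lra) th ltac:(lra); rewrite Zhalf; lra.
have [|||y y01 Zy] := @position_surjective (1 / 2) t z _ th _ (ltW Ztz).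
- lra.
- lra.
- by rewrite Zhalf.
by apply: nz; exists y.
Qed.

Lemma profile_wave_gt t z : 0 < t < 1 -> z < Z t -> t < U z.
Proof.
move=> t01 Ztz; have [[s [s01 sz]]|nz] := pselect (exists s, 0 < s < 1 /\ Z s = z).
  rewrite -sz profile_wave_position// ltNge; apply/negP.
  rewrite le_eqVlt => /orP[/eqP E|ts]; first by move: Ztz; rewrite -sz E ltxx.
  by have := Zdecr (s := s) (t := t) ltac:(lra) ts ltac:(lra); rewrite sz; lra.
rewrite (profile_wave_notin nz); case: ifPn => [z0|_]; last by lra.
exfalso.
have th : t < 1 / 2.
  rewrite ltNge le_eqVlt; apply/negP => /orP[/eqP E|th].
    by move: Ztz; rewrite -E Zhalf; lra.
  by have := Zdecr (s := 1 / 2) (t := t) ltac:(lra) th ltac:(lra); rewrite Zhalf; lra.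
have [|||y y01 Zy] := @position_surjective t (1 / 2) z _ th _ _ Ztz.
- lra.
- lra.
- by rewrite Zhalf ltW.
by apply: nz; exists y.
Qed.

(** These two equivalences carry the topology of the inverse function: open
    conditions on U z become open conditions on z. *)
Lemma profile_wave_ltE t z : 0 < t < 1 -> (U z < t) = (Z t < z).
Proof.
move=> t01; apply/idP/idP; last exact: profile_wave_lt.
move=> Ut; rewrite ltNge; apply/negP; rewrite le_eqVlt => /orP[/eqP E|zt].
  by move: Ut; rewrite E profile_wave_position// ltxx.
by have := profile_wave_gt t01 zt; lra.
Qed.

Lemma profile_wave_gtE t z : 0 < t < 1 -> (t < U z) = (z < Z t).
Proof.
move=> t01; apply/idP/idP; last exact: profile_wave_gt.
move=> Ut; rewrite ltNge; apply/negP; rewrite le_eqVlt => /orP[/eqP E|zt].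
  by move: Ut; rewrite -E profile_wave_position// ltxx.
by have := profile_wave_lt t01 zt; lra.
Qed.

Lemma profile_wave_half : U 0 = 1 / 2.
Proof. by rewrite -Zhalf profile_wave_position. Qed.

Lemma profile_wave_noninc x y : x <= y -> U y <= U x.
Proof.
move=> xy; rewrite leNgt; apply/negP => Uxy.
have Ux := profile_wave_range x; have Uy := profile_wave_range y.
pose t := (U x + U y) / 2.
have t01 : 0 < t < 1 by rewrite /t; lra.
have : Z t < x by rewrite -profile_wave_ltE// /t; lra.
have : y < Z t by rewrite -profile_wave_gtE// /t; lra.
lra.
Qed.

Lemma profile_wave_decr x y : support x \/ support y -> x < y -> U y < U x.
Proof.
move=> sxy xy; rewrite lt_neqAle profile_wave_noninc ?ltW// andbT; apply/eqP => E.
have [sx sy] : support x /\ support y by case: sxy; rewrite ?E// -?E.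
by move: xy; rewrite -(position_profile_wave sx) -(position_profile_wave sy) E ltxx.
Qed.

Lemma profile_wave_continuous : continuous U.
Proof.
move=> z; apply/cvgrPdist_lt => e e0; have Uz := profile_wave_range z.
have hi : \forall s \near z, U s < U z + e.
  have [U1|U1] := ltP (U z) 1; last first.
    by apply/nearE_dist; exists 1 => // s _; have := profile_wave_range s; lra.
  pose t := Num.min (U z + e / 2) ((U z + 1) / 2).
  have [te t2] : t <= U z + e / 2 /\ t <= (U z + 1) / 2 by rewrite !ge_min !lexx orbT.
  have Ut : U z < t by rewrite lt_min; lra.
  have t01 : 0 < t < 1 by lra.
  have := Ut; rewrite profile_wave_ltE// => Zt.
  apply/nearE_dist; exists (z - Z t); first lra.
  move=> s; rewrite ltr_norml => sz.
  by have := @profile_wave_lt t s t01 ltac:(lra); lra.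
have lo : \forall s \near z, U z - e < U s.
  have [U1|U1] := ltP 0 (U z); last first.
    by apply/nearE_dist; exists 1 => // s _; have := profile_wave_range s; lra.
  pose t := Num.max (U z - e / 2) (U z / 2).
  have [te t2] : U z - e / 2 <= t /\ U z / 2 <= t by rewrite !le_max !lexx orbT.
  have Ut : t < U z by rewrite gt_max; lra.
  have t01 : 0 < t < 1 by lra.
  have := Ut; rewrite profile_wave_gtE// => Zt.
  apply/nearE_dist; exists (Z t - z); first lra.
  move=> s; rewrite ltr_norml => sz.
  by have := @profile_wave_gt t s t01 ltac:(lra); lra.
move/nearE_dist: hi => [r1 r10 H1]; move/nearE_dist: lo => [r2 r20 H2].
apply/nearE_dist; exists (Num.min r1 r2); first by rewrite lt_min r10.
move=> s; rewrite lt_min => /andP[s1 s2].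
by have := H1 s s1; have := H2 s s2; rewrite ltr_norml; lra.
Qed.

Lemma profile_wave_boundary : boundary_conditions U.
Proof.
split; apply/cvgrPdist_lt => e e0; pose t := Num.min (e / 2) (1 / 2).
  have [te t2] : t <= e / 2 /\ t <= 1 / 2 by rewrite !ge_min !lexx orbT.
  have t0 : 0 < t by rewrite lt_min; lra.
  exists (Z (1 - t)); split; first exact: num_real.
  move=> x xZ; have := @profile_wave_gt (1 - t) x ltac:(lra) xZ.
  by have := profile_wave_range x; rewrite ltr_norml; lra.
have [te t2] : t <= e / 2 /\ t <= 1 / 2 by rewrite !ge_min !lexx orbT.
have t0 : 0 < t by rewrite lt_min; lra.
exists (Z t); split; first exact: num_real.
move=> x xZ; have := @profile_wave_lt t x ltac:(lra) xZ.
by have := profile_wave_range x; rewrite sub0r normrN ltr_norml; lra.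
Qed.

Definition wave_slope t : R := - (w t / d t) `^ a.

Lemma wave_slope_continuous t : 0 < t < 1 -> t \notin Sm ->
  {for t, continuous wave_slope}.
Proof.
move=> t01 tS; apply: cvgN.
apply: (@continuous_comp _ _ _ (fun s => w s / d s) (fun v : R => v `^ a)).
  apply: cvgM; first exact: (profile_continuous pw).
  by apply: cvgV; [rewrite gt_eqF// (d_gt0 H)|exact: (d_continuous H)].
by apply: powR_continuous; rewrite divr_gt0 ?w0 ?(d_gt0 H).
Qed.

Lemma profile_wave_derive z : support z -> U z \notin Sm ->
  is_derive z 1 U (wave_slope (U z)).
Proof.
move=> sz zS; have Zz := position_profile_wave sz.
have wz := w0 sz; have dz := d_gt0 H sz.
have -> : wave_slope (U z) = (- (d (U z) / w (U z)) `^ a)^-1.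
  by rewrite /wave_slope !powR_div// invrN invf_div.
rewrite -{1}Zz; apply: (@is_derive_inverse R Z U).
- by have := unit_interval_near sz; apply: filterS => s; exact: profile_wave_position.
- by have := unit_interval_near sz; apply: filterS => s; exact: ZC.
- exact: (position_derive H pw).
- by rewrite oppr_eq0 gt_eqF// powR_gt0 ?divr_gt0.
Qed.

Lemma profile_wave_support_near z : support z -> \forall s \near z, support s.
Proof. exact: (support_near profile_wave_continuous). Qed.

Lemma profile_wave_notin_near z (l : seq R) : U z \notin l -> \forall s \near z, U s \notin l.
Proof. by move=> /near_notin zl; exact: (@profile_wave_continuous z _ zl). Qed.

(** The values other than U z are avoided near z by continuity, and U z itself
    is taken only once because the position inverts U. *)
Lemma profile_wave_isolated z (l : seq R) : support z ->
  \forall s \near z, support s /\ (U s \in l -> s = z).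
Proof.
move=> sz; pose l' := [seq x <- l | x != U z].
have zl' : U z \notin l' by rewrite mem_filter eqxx.
have h1 := profile_wave_support_near sz; have h2 := profile_wave_notin_near zl'.
near=> s.
have ss : support s by near: s.
have sl' : U s \notin l' by near: s.
split => // sl; move: sl'; rewrite mem_filter sl andbT negbK => /eqP E.
by rewrite -(position_profile_wave ss) -(position_profile_wave sz) E.
Unshelve. all: by end_near. Qed.

Lemma in_level z : U z \in Sm -> boundary (level_set r m U) z.
Proof.
move=> zS; have sz : support z.
  by case/jumpsP: zS => i ir ->; exact: (m_in H ir).
split.
  apply: subset_closure; case/jumpsP: zS => i ir E; by exists i.
move=> zi; have := profile_wave_isolated Sm sz.
move=> /nearE_dist[e1 e10 H1]; move: zi => /nearE_dist[e2 e20 H2].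
pose s := z + Num.min e1 e2 / 2.
have e0 : 0 < Num.min e1 e2 by rewrite lt_min e10.
have [ee1 ee2] : Num.min e1 e2 <= e1 /\ Num.min e1 e2 <= e2 by rewrite !ge_min !lexx orbT.
have sS : U s \in Sm.
  have [|i ir E] := H2 s; first by rewrite ltr_norml /s; lra.
  by apply/jumpsP; exists i.
have [_ /(_ sS)] := H1 s ltac:(rewrite ltr_norml /s; lra).
by rewrite /s; lra.
Qed.

Lemma levelP z : boundary (level_set r m U) z <-> U z \in Sm.
Proof.
split; last exact: in_level.
move=> bz; apply: contrapT => /negP nz.
exact: (notin_level profile_wave_continuous nz).
Qed.

Lemma end_boundary z : boundary (end_set U) z -> U z = 0 \/ U z = 1.
Proof.
move=> bz; have [//|nz] := pselect (U z = 0 \/ U z = 1); exfalso.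
apply: (support_end profile_wave_continuous _ bz).
have /andP[+ +] := profile_wave_range z; rewrite !le_eqVlt.
move=> /orP[/eqP E _|z0]; first by exfalso; apply: nz; left.
by move=> /orP[/eqP E|z1]; [exfalso; apply: nz; right|rewrite z0].
Qed.

Lemma end_interior z : ~ support z -> ~ boundary (end_set U) z ->
  \forall s \near z, U s = U z.
Proof.
move=> nz nb; have Ez : end_set U z.
  have /andP[+ +] := profile_wave_range z; rewrite !le_eqVlt.
  move=> /orP[/eqP E _|z0]; first by left.
  by move=> /orP[/eqP E|z1]; [right|exfalso; apply: nz; rewrite z0].
have : interior (end_set U) z.
  by apply: contrapT => ni; apply: nb; split => //; exact: subset_closure.
move=> /nearE_dist[e1 e10 H1].
have Uz : {for z, continuous U} := @profile_wave_continuous z.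
move/cvgrPdist_lt: Uz => /(_ 1 ltr01)/nearE_dist[e2 e20 H2].
apply/nearE_dist; exists (Num.min e1 e2); first by rewrite lt_min e10.
move=> s; rewrite lt_min => /andP[/H1 s1 /H2 s2].
by case: Ez s1 s2 => -> [->|->] //; rewrite ?sub0r ?subr0 ?normrN ?normr1 ltxx.
Qed.

Lemma end_boundary_unique x y : boundary (end_set U) x -> boundary (end_set U) y ->
  U x = U y -> x = y.
Proof.
suff W u v : u < v -> boundary (end_set U) u -> boundary (end_set U) v -> U u = U v -> False.
  move=> bx by' E; have [xy|yx|//] := ltgtP x y.
    by case: (W x y xy bx by' E).
  by case: (W y x yx by' bx (esym E)).
move=> uv bu bv E; have [u0|u1] := end_boundary bu.
- case: bv => _; apply; apply/nearE_dist; exists (v - u); first lra.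
  move=> s; rewrite ltr_norml => sv; left; apply/eqP; rewrite eq_le.
  have -> : 0 <= U s by have := profile_wave_range s; lra.
  by rewrite andbT -u0; apply: profile_wave_noninc; lra.
- case: bu => _; apply; apply/nearE_dist; exists (v - u); first lra.
  move=> s; rewrite ltr_norml => su; right; apply/eqP; rewrite eq_le.
  have -> : U s <= 1 by have := profile_wave_range s; lra.
  by rewrite /= -u1 E; apply: profile_wave_noninc; lra.
Qed.

(** The opposite of the flux of the wave as a function of its value; the end
    values 0 and 1 are sent to 0. *)
Definition profile01 t : R := if 0 < t < 1 then w t else 0.

(** The linear bound at 0 and the vanishing at 1 make the flux continuous up
    to and across the ends of the support. *)
Lemma profile01_small e : 0 < e -> exists2 y, 0 < y < 1 &
  forall t, 0 <= t <= 1 -> t < y \/ 1 - y < t -> `|profile01 t| < e.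
Proof.
move=> e0; have [B hB] := h_bounded H.
have hB' t : 0 < t < 1 -> `|h t| <= B by move=> t01; apply: hB; lra.
have B0 : 0 <= B by apply: le_trans (hB' _ half01).
pose K := `|c| + B + 1.
have K0 : 0 < K by rewrite /K; have := normr_ge0 c; lra.
have /cvgrPdist_lt/(_ _ e0)/near_leftE[r1 r10 H1] := profile_at1 pw.
pose y := Num.min (1 / 2) (Num.min r1 (e / K)).
have [y1 y2 y3] : [/\ y <= 1 / 2, y <= r1 & y <= e / K] by rewrite !ge_min !lexx !orbT.
have y0 : 0 < y by rewrite !lt_min r10 !divr_gt0.
exists y; first lra.
move=> t t01 ty; rewrite /profile01; case: ifPn => [{}t01|]; last by rewrite normr0.
rewrite gtr0_norm ?w0//; case: ty => ty.
  apply: le_lt_trans (vanishes_bound hB' (source_lower H) pw w00 t01) _.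
  rewrite ler_pdivlMr// in y3; move: y3; rewrite /K.
  have : (`|c| + B) * t <= (`|c| + B) * y by rewrite ler_wpM2l ?addr_ge0// ltW.
  lra.
by have := H1 t ltac:(lra); rewrite sub0r normrN gtr0_norm ?w0.
Qed.

Lemma profile01_wave_continuous : continuous (profile01 \o U).
Proof.
move=> z; have Uz : {for z, continuous U} := @profile_wave_continuous z.
have [sz|nsz] := pselect (support z : Prop).
  have wU : {for z, continuous (w \o U)}.
    by apply: continuous_comp; [exact: Uz|exact: (profile_continuous pw)].
  have E : profile01 (U z) = w (U z) by rewrite /profile01 sz.
  rewrite /prop_for /continuous_at /= E; apply: cvg_trans wU.
  apply: near_eq_cvg; have := profile_wave_support_near sz.
  by apply: filterS => s ss; rewrite /profile01 /= ss.
have E : profile01 (U z) = 0 by rewrite /profile01; case: ifP.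
apply/cvgrPdist_lt => e e0; have [y y01 Hy] := profile01_small e0.
have y0 : 0 < y by lra.
move/cvgrPdist_lt: Uz => /(_ _ y0); apply: filterS => s; rewrite ltr_norml => Us.
rewrite /= E sub0r normrN; apply: Hy; first exact: profile_wave_range.
have /andP[] := profile_wave_range z; rewrite !le_eqVlt.
move=> /orP[/eqP U0 _|U0]; first by left; lra.
by move=> /orP[/eqP U1|U1]; [right; lra|exfalso; apply: nsz; rewrite U0].
Qed.

Lemma profile01_ends :
  (profile01 (U z) @[z --> -oo] --> (0 : R)) /\ (profile01 (U z) @[z --> +oo] --> (0 : R)).
Proof.
have [U1 U0] := profile_wave_boundary.
split; apply/cvgrPdist_lt => e e0; have [y y01 Hy] := profile01_small e0.
  move/cvgrPdist_lt: U1 => /(_ y ltac:(lra)); apply: filterS => s; rewrite ltr_norml => Us.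
  by rewrite sub0r normrN; apply: Hy; [exact: profile_wave_range|right; lra].
move/cvgrPdist_lt: U0 => /(_ y ltac:(lra)); apply: filterS => s; rewrite ltr_norml => Us.
by rewrite sub0r normrN; apply: Hy; [exact: profile_wave_range|left; lra].
Qed.

End InverseWave.

(** * The inverted position solves the equation *)

Section WaveSolution.
Context {R : realType}.
Variables (p : R) (g d h : R -> R) (r : nat) (m : nat -> R) (q : nat) (k : nat -> R).
Hypothesis H : admissible p g d h r m q k.
Implicit Types (t s e l x y z : R).
Notation a := (expo p).
Notation f := (reduced_source p d g).
Notation P := (primitive_ext h).
Notation Sm := (jumps r m).
Notation S := (jumps r m ++ jumps q k).
Variables (c : R) (w : R -> R).
Hypothesis pw : profile a S h f c w.
Hypothesis w00 : vanishes_at0 w.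
Notation Z := (position p d w).
Notation U := (profile_wave p d w).
Notation slope := (wave_slope p d w).
Notation v := (extended_flux p d r m U).
Notation support z := (0 < U z < 1).

Let w0 t : 0 < t < 1 -> 0 < w t. Proof. exact: (profile_gt0 pw). Qed.
Let UC : continuous U. Proof. exact: (profile_wave_continuous H pw). Qed.
Let UD z : support z -> U z \notin Sm -> is_derive z 1 U (slope (U z)).
Proof. exact: (profile_wave_derive H pw). Qed.

Lemma slope_cvg (F : set_system R) (FF : ProperFilter F) t l : 0 < t < 1 -> 0 < l ->
  w s @[s --> F] --> w t -> d s @[s --> F] --> l ->
  slope s @[s --> F] --> - (w t / l) `^ a.
Proof.
move=> t01 l0 wF dF.
have wd : w s / d s @[s --> F] --> w t / l.
  by apply: cvgM => //; apply: cvgV => //; rewrite gt_eqF.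
have qC : {for w t / l, continuous (fun v : R => v `^ a)}.
  by apply: powR_continuous; rewrite divr_gt0 ?w0.
have qa : (w s / d s) `^ a @[s --> F] --> (w t / l) `^ a.
  exact: (cvg_comp (fun s => w s / d s) (fun v : R => v `^ a) wd qC).
exact: cvgN qa.
Qed.

Lemma wave_left_limit z : support z -> U x @[x --> z^'-] --> (U z)^'+.
Proof.
move=> sz A /near_rightE[e e0 HA].
have Uz : {for z, continuous U} := @UC z.
move/cvgrPdist_lt: Uz => /(_ _ e0)/nearE_dist[e1 e10 He1].
apply/near_leftE; exists e1 => // s sz1; apply: HA.
have := He1 s ltac:(rewrite ltr_norml; lra); rewrite ltr_norml.
have := profile_wave_decr H pw (x := s) (y := z) (or_intror sz) ltac:(lra).
lra.
Qed.

Lemma wave_right_limit z : support z -> U x @[x --> z^'+] --> (U z)^'-.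
Proof.
move=> sz A /near_leftE[e e0 HA].
have Uz : {for z, continuous U} := @UC z.
move/cvgrPdist_lt: Uz => /(_ _ e0)/nearE_dist[e1 e10 He1].
apply/near_rightE; exists e1 => // s sz1; apply: HA.
have := He1 s ltac:(rewrite ltr_norml; lra); rewrite ltr_norml.
have := profile_wave_decr H pw (x := z) (y := s) (or_introl sz) ltac:(lra).
lra.
Qed.

Lemma off_node_near z : support z ->
  \forall s \near z, s != z -> is_derive s 1 U (slope (U s)).
Proof.
move=> /(profile_wave_isolated H pw Sm); apply: filterS => s [ss sS] sz.
by apply: UD => //; apply: contra sz => /sS ->.
Qed.

(** One-sided data of the wave at a point where d jumps. A left neighbourhood
    of z is mapped to a right neighbourhood of U z, because U decreases. *)
Record node_limits z l1 l2 : Prop := NodeLimits {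
  node_l1 : 0 < l1 ;
  node_l2 : 0 < l2 ;
  node_d1 : d (U x) @[x --> z^'-] --> l1 ;
  node_d2 : d (U x) @[x --> z^'+] --> l2 ;
  node_U1 : derive1 U x @[x --> z^'-] --> - (w (U z) / l1) `^ a ;
  node_U2 : derive1 U x @[x --> z^'+] --> - (w (U z) / l2) `^ a ;
  node_Q1 : left_quotient_limit U z (- (w (U z) / l1) `^ a) ;
  node_Q2 : right_quotient_limit U z (- (w (U z) / l2) `^ a) }.

Lemma node_limits_exist z : U z \in Sm -> exists l1 l2, node_limits z l1 l2.
Proof.
move=> zS; case/jumpsP: (zS) => i ir Ui; have sz : support z by rewrite Ui (m_in H).
have [l2 [l1 [l20 l10 dl2 dl1]]] := d_jump H ir; rewrite -Ui in dl1 dl2.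
have wC := profile_continuous pw sz.
have U1 : derive1 U x @[x --> z^'-] --> - (w (U z) / l1) `^ a.
  have sl : slope (U x) @[x --> z^'-] --> - (w (U z) / l1) `^ a.
    apply: (cvg_comp _ _ (wave_left_limit sz)).
    by apply: (slope_cvg _ sz l10 _ dl1); apply: cvg_at_right_filter; exact: wC.
  apply: cvg_trans sl; apply: near_eq_cvg.
  have /nearE_dist[e e0 He] := off_node_near sz.
  apply/near_leftE; exists e => // s sze.
  have [||Us E] := He s; first by rewrite ltr_norml; lra.
    by apply/eqP; lra.
  by rewrite derive1E -E.
have U2 : derive1 U x @[x --> z^'+] --> - (w (U z) / l2) `^ a.
  have sl : slope (U x) @[x --> z^'+] --> - (w (U z) / l2) `^ a.
    apply: (cvg_comp _ _ (wave_right_limit sz)).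
    by apply: (slope_cvg _ sz l20 _ dl2); apply: cvg_at_left_filter; exact: wC.
  apply: cvg_trans sl; apply: near_eq_cvg.
  have /nearE_dist[e e0 He] := off_node_near sz.
  apply/near_rightE; exists e => // s sze.
  have [||Us E] := He s; first by rewrite ltr_norml; lra.
    by apply/eqP; lra.
  by rewrite derive1E -E.
have /nearE_dist[e e0 He] := off_node_near sz.
exists l1, l2; split => //.
- exact: (cvg_comp _ _ (wave_left_limit sz) dl1).
- exact: (cvg_comp _ _ (wave_right_limit sz) dl2).
- apply: left_derivative_limit => //; first exact: UC.
  apply/near_leftE; exists e => // s sze.
  have [||//] := He s; first by rewrite ltr_norml; lra.
  by apply/eqP; lra.
- apply: right_derivative_limit => //; first exact: UC.
  apply/near_rightE; exists e => // s sze.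
  have [||//] := He s; first by rewrite ltr_norml; lra.
  by apply/eqP; lra.
Qed.

Lemma signed_power_slope t l : 0 < t < 1 -> 0 < l ->
  signed_power p (- (w t / l) `^ a) * l = - w t.
Proof.
move=> t01 l0; rewrite (signed_powerN H) ?divr_gt0 ?w0// mulNr divfK//.
by rewrite gt_eqF.
Qed.

Lemma flux_support z : support z -> U z \notin Sm -> flux p d U z = - w (U z).
Proof.
move=> sz zS; have [_ E] := UD sz zS.
by rewrite /flux derive1E E mulrC signed_power_slope// (d_gt0 H).
Qed.

Lemma end_derive z : ~ support z -> ~ boundary (end_set U) z ->
  is_derive z 1 U 0.
Proof.
move=> ns nb; have Ue := end_interior H pw ns nb.
have Uc : \forall s \near z, cst (U z) s = U s by apply: filterS Ue => s ->.
by apply: near_eq_is_derive Uc _; exact: is_derive_cst.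
Qed.

Lemma flux_end z : ~ support z -> ~ boundary (end_set U) z -> flux p d U z = 0.
Proof.
move=> ns nb; have [_ E] := end_derive ns nb.
by rewrite /flux derive1E E signed_power0 mulr0.
Qed.

(** All three cases of the extended flux collapse to one continuous function
    of U. *)
Lemma extended_fluxE z : v z = - profile01 w (U z).
Proof.
rewrite /extended_flux; case: ifPn => [|nb].
  rewrite inE => /(end_boundary H pw)[] ->; rewrite /profile01 ?ltxx ?andbF oppr0//.
have {}nb : ~ boundary (end_set U) z by move=> b; move/negP: nb; apply; rewrite inE.
case: ifPn => [|nl].
  rewrite inE => /(levelP H pw) zS; have [l1 [l2 nl]] := node_limits_exist zS.
  have sz : support z by case/jumpsP: zS => i ir ->; exact: (m_in H ir).
  rewrite /transition_value /left_derivative.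
  rewrite (cvg_lim _ (node_Q1 nl))// (cvg_lim _ (node_d1 nl))//.
  by rewrite signed_power_slope ?(node_l1 nl)// /profile01 sz.
have zS : U z \notin Sm.
  by apply: contra nl => zS; rewrite inE; apply/(levelP H pw).
have [sz|ns] := pselect (support z : Prop).
  by rewrite flux_support// /profile01 sz.
by rewrite flux_end// /profile01; case: ifP => //; rewrite oppr0.
Qed.

Lemma wave_C1_support (A : set R) : (forall z, A z -> support z /\ U z \notin Sm) ->
  C1_on A U.
Proof.
move=> HA; apply: (@C1_criterion _ _ _ (slope \o U)) => z /HA[sz zS]; split.
  apply: continuous_comp; first exact: UC.
  exact: (wave_slope_continuous H pw).
have h1 := profile_wave_support_near H pw sz; have h2 := profile_wave_notin_near H pw zS.
near=> s; apply: UD; near: s.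
  exact: h1.
exact: h2.
Unshelve. all: by end_near. Qed.

Lemma end_near_end z : ~ support z -> ~ boundary (end_set U) z ->
  \forall s \near z, ~ support s /\ ~ boundary (end_set U) s.
Proof.
move=> ns nb; have Ue := end_interior H pw ns nb; have Ue' := near_join Ue.
near=> s; have Us : U s = U z by near: s.
have Us' : \forall x \near s, U x = U z by near: s.
split; first by rewrite Us.
move=> [_]; apply; apply: filterS Us' => x Ux.
rewrite /end_set /= Ux; have /andP[+ +] := profile_wave_range p d w z; rewrite !le_eqVlt.
move=> /orP[/eqP E _|z0]; first by left.
by move=> /orP[/eqP E|z1]; [right|exfalso; apply: ns; rewrite z0].
Unshelve. all: by end_near. Qed.

Lemma wave_C1_end (A : set R) :
  (forall z, A z -> ~ support z /\ ~ boundary (end_set U) z) -> C1_on A U.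
Proof.
move=> HA; apply: (@C1_criterion _ _ _ (cst 0)) => z /HA[ns nb]; split.
  exact: cst_continuous.
by apply: filterS (end_near_end ns nb) => s [? ?]; exact: end_derive.
Qed.

Lemma wave_C1 (A : set R) : (forall z, A z -> U z \notin Sm /\ ~ boundary (end_set U) z) ->
  C1_on A U.
Proof.
move=> HA.
apply: (@C1_on_sub _ _ _ ([set z | support z /\ U z \notin Sm] `|`
    [set z | ~ support z /\ ~ boundary (end_set U) z])).
  move=> z /HA[zS nb]; have [sz|ns] := pselect (support z : Prop); by [left|right].
by apply: C1_on_union; [exact: wave_C1_support|exact: wave_C1_end].
Qed.

(** At an end point of the support no other end point is near, since U takes
    there the same value 0 or 1 and is constant beyond. *)
Lemma wave_discrete :
  discrete_subset (boundary (level_set r m U) `|` boundary (end_set U)).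
Proof.
move=> z Dz; split; first by rewrite inE.
case: Dz => [/[dup] bz /(levelP H pw) zS|bz].
  have sz : support z by case/jumpsP: zS => i ir ->; exact: (m_in H ir).
  exists [set s | support s /\ (U s \in Sm -> s = z)].
    exact: (profile_wave_isolated H pw).
  apply/seteqP; split=> [s [[ss sS] [/(levelP H pw)/sS//|bs]]|_ ->].
    by exfalso; exact: (support_end UC ss).
  by split; [split|left].
have zS : U z \notin Sm.
  apply/negP => /jumpsP[i ir E]; have := m_in H ir; rewrite -E.
  by case: (end_boundary H pw bz) => ->; lra.
exists [set s | U s \notin Sm /\ `|U z - U s| < 1].
  have h1 := profile_wave_notin_near H pw zS.
  have Uz : {for z, continuous U} := @UC z.
  move/cvgrPdist_lt: Uz => /(_ 1 ltr01) h2.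
  near=> s; split; near: s; [exact: h1|exact: h2].
apply/seteqP; split=> [s [[sS Us] [/(levelP H pw) sS'|bs]]|_ ->].
- by rewrite sS' in sS.
- apply: (end_boundary_unique H pw bs bz).
  move: Us; case: (end_boundary H pw bs) => ->; case: (end_boundary H pw bz) => -> //.
    by rewrite subr0 normr1 ltxx.
  by rewrite sub0r normrN normr1 ltxx.
- by split; [split => //; rewrite subrr normr0|right].
Unshelve. all: by end_near. Qed.

(** Off these points the wave is either in its support, where the profile
    equation holds, or locally constant. *)
Lemma wave_exceptions : exists T : seq R, forall z, z \notin T ->
  (support z -> U z \notin S) /\ ~ boundary (end_set U) z.
Proof.
(* An end of the support may be infinite; any point then serves as z0. *)
have ex (b : R) : exists z0, forall z, boundary (end_set U) z -> U z = b -> z = z0.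
  have [[z0 [bz0 E]]|nz] := pselect (exists z, boundary (end_set U) z /\ U z = b).
    by exists z0 => z bz Uz; apply: (end_boundary_unique H pw) => //; rewrite Uz.
  by exists 0 => z bz Uz; exfalso; apply: nz; exists z.
have [z0 Hz0] := ex 0; have [z1 Hz1] := ex 1.
exists (z0 :: z1 :: map Z S) => z; rewrite !inE !negb_or => /and3P[zz0 zz1 zS]; split.
  move=> sz; apply: contra zS => zS; apply/mapP; exists (U z) => //.
  by rewrite (position_profile_wave sz).
move=> bz; case: (end_boundary H pw bz) => E.
  by move/eqP: zz0; apply; exact: Hz0.
by move/eqP: zz1; apply; exact: Hz1.
Qed.

Let gUC : continuous (g \o clamp \o U).
Proof. by move=> t; apply: continuous_comp; [exact: UC|exact: (g_clamp_continuous H)]. Qed.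

Lemma profile_identity t : 0 < t < 1 ->
  f t * w t `^ (- a) * slope t = - g t.
Proof.
move=> t01; have wt := w0 t01; have dt := d_gt0 H t01.
rewrite /wave_slope /reduced_source powRN powR_div//; field.
by rewrite !gt_eqF// powR_gt0.
Qed.

(** The difference of the two sides, as a function of the upper end, is
    continuous with zero derivative off finitely many points. *)
Lemma wave_integral z z' :
  v z' - v z + c * (U z' - U z) - (primitive h (U z') - primitive h (U z))
    + oriented_integral (fun t => g (U t)) z z' = 0.
Proof.
rewrite !(primitive_extE h) ?profile_wave_range//.
rewrite (@oriented_integral_eq _ (fun t => g (U t)) (g \o clamp \o U)); last first.
  by move=> t _; rewrite /= clamp_id ?profile_wave_range.
have gUI := continuous_locally_bounded_measurable gUC.
pose E := - (profile01 w \o U) + (fun z => c * U z) - (P \o U)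
  + oriented_integral (g \o clamp \o U) 0.
have EC : continuous E.
  move=> x; apply: cvgD; last first.
    by apply: (@oriented_integral_continuous _ _ _ gUI 0 x I); exact: filterT.
  apply: cvgB; last first.
    by apply: continuous_comp; [exact: UC|exact: (primitive_ext_continuous H)].
  apply: cvgD; first by apply: cvgN; exact: (profile01_wave_continuous H pw w00).
  by apply: cvgM; [exact: cvg_cst|exact: UC].
have [T HT] := wave_exceptions.
have ID x : is_derive x 1 (oriented_integral (g \o clamp \o U) 0) (g (U x)).
  have -> : g (U x) = (g \o clamp \o U) x by rewrite /= clamp_id ?profile_wave_range.
  apply: (@oriented_integral_derive _ _ _ gUI 0 x I); first exact: filterT.
  exact: gUC.
have ED x : x \notin T -> is_derive x 1 E 0.
  move=> /HT[xS nb]; have Ix := ID x.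
  have [sx|ns] := pselect (support x : Prop); last first.
    have Ux := end_derive ns nb.
    have gx : g (U x) = 0.
      case: H => _ [_ g00 g11 _] _ _ _.
      have /andP[+ +] := profile_wave_range p d w x; rewrite !le_eqVlt.
      move=> /orP[/eqP <- _ //|x0].
      by move=> /orP[/eqP -> //|x1]; exfalso; apply: ns; rewrite x0.
    rewrite gx in Ix.
    have Ue := end_interior H pw ns nb.
    have C0 (K : R -> R) : is_derive x 1 (K \o U) 0.
      have Kc : \forall s \near x, cst (K (U x)) s = (K \o U) s.
        by apply: filterS Ue => s /= ->.
      by apply: near_eq_is_derive Kc _; exact: is_derive_cst.
    have h1 := C0 (profile01 w); have h2 := C0 (fun u => c * u); have h3 := C0 P.
    have -> : (0 : R) = - 0 + 0 - 0 + 0 by ring.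
    by apply: is_deriveD; apply: is_deriveB; apply: is_deriveD.
  have xS' := xS sx; move: (xS'); rewrite mem_cat negb_or => /andP[xm xk].
  have Ux := UD sx xm.
  have Px : is_derive x 1 (P \o U) (h (U x) * slope (U x)).
    by apply: is_derive1_comp; exact: (primitive_ext_derive H).
  have wx : is_derive x 1 (profile01 w \o U)
      ((c - h (U x) - f (U x) * w (U x) `^ (- a)) * slope (U x)).
    have Wc : \forall s \near x, (w \o U) s = (profile01 w \o U) s.
      apply: filterS (profile_wave_support_near H pw sx) => s ss.
      by rewrite /profile01 /= ss.
    apply: near_eq_is_derive Wc _.
    by apply: is_derive1_comp; exact: (profile_derive pw).
  have -> : (0 : R) = - ((c - h (U x) - f (U x) * w (U x) `^ (- a)) * slope (U x))
      + c * slope (U x) - h (U x) * slope (U x) + g (U x).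
    by have := profile_identity sx; lra.
  by apply: is_deriveD; apply: is_deriveB; apply: is_deriveD.
have Ec x y : x <= y -> E y - E x = 0.
  move=> xy; apply/eqP; rewrite -normr_le0 -[leRHS](mul0r (y - x)).
  apply: (@lipschitz_off _ T); [exact: xy|by move=> t _; exact: EC|].
  by move=> t _ tT; exists 0; [exact: ED|rewrite normr0].
have Ezz' : E z' - E z = 0.
  have [zz'|z'z] := leP z z'; first exact: Ec.
  by have := Ec _ _ (ltW z'z); lra.
have := @oriented_integral_cat _ _ _ gUI 0 z z' I I I.
rewrite !extended_fluxE; move: Ezz'; rewrite /E !fctE /=; lra.
Qed.

Lemma profile_wave_solution : is_solution p d g h r m c U.
Proof.
have vE : v = (fun z => - profile01 w (U z)) by apply/funext => z; exact: extended_fluxE.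
have [v1 v0] := profile01_ends H pw w00.
split.
- exact: profile_wave_range.
- exact: UC.
- exact: wave_discrete.
- apply: wave_C1 => z nz; split; last by move=> bz; apply: nz; right.
  by apply/negP => zS; apply: nz; left; apply/(levelP H pw).
- move=> z /(levelP H pw) zS; have [l1 [l2 nl]] := node_limits_exist zS.
  have sz : support z by case/jumpsP: zS => i ir ->; exact: (m_in H ir).
  exists (- (w (U z) / l1) `^ a), (- (w (U z) / l2) `^ a), l1, l2; split.
  + exact: (node_Q1 nl).
  + exact: (node_Q2 nl).
  + exact: (node_d1 nl).
  + exact: (node_d2 nl).
  + by rewrite !signed_power_slope ?(node_l1 nl) ?(node_l2 nl).
- rewrite vE => z; apply: cvgN; exact: (profile01_wave_continuous H pw w00).
- exact: wave_integral.
- by rewrite vE -oppr0; exact: cvgN.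
- by rewrite vE -oppr0; exact: cvgN.
Qed.

Lemma profile_wave_normalized : normalized_wave p d g h r m c U.
Proof.
split; last exact: (profile_wave_half H pw).
by split; [exact: profile_wave_solution|exact: (profile_wave_boundary H pw)].
Qed.

End WaveSolution.

(** * Qualitative properties and conclusion *)

Section WaveProperties.
Context {R : realType}.
Variables (p : R) (g d h : R -> R) (r : nat) (m : nat -> R) (q : nat) (k : nat -> R).
Hypothesis H : admissible p g d h r m q k.
Implicit Types (t s e l x y z : R) (i : nat).
Notation a := (expo p).
Notation f := (reduced_source p d g).
Notation Sm := (jumps r m).
Notation S := (jumps r m ++ jumps q k).
Variables (c : R) (w : R -> R).
Hypothesis pw : profile a S h f c w.
Hypothesis w00 : vanishes_at0 w.
Notation Z := (position p d w).
Notation U := (profile_wave p d w).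
Notation slope := (wave_slope p d w).
Notation support z := (0 < U z < 1).

Let UC : continuous U. Proof. exact: (profile_wave_continuous H pw). Qed.

Let rate t := (c - h t - f t * w t `^ (- a)) * slope t.

(** The flux is minus the profile composed with the wave, so its derivative
    comes from the profile equation. *)
Lemma flux_wave_derive z : support z -> U z \notin S ->
  is_derive z 1 (flux p d U) (- rate (U z)).
Proof.
move=> sz; rewrite mem_cat negb_or => /andP[zm zk].
have E : \forall s \near z, (- (w \o U)) s = flux p d U s.
  have h1 := profile_wave_support_near H pw sz.
  have h2 := profile_wave_notin_near H pw zm.
  near=> s; rewrite (flux_support H pw) ?fctE//; near: s; [exact: h1|exact: h2].
apply: near_eq_is_derive E _; apply: is_deriveN; apply: is_derive1_comp.
  by apply: (profile_derive pw); rewrite ?mem_cat ?negb_or ?zm.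
exact: (profile_wave_derive H pw).
Unshelve. all: by end_near. Qed.

Lemma rate_continuous t : 0 < t < 1 -> t \notin S -> {for t, continuous rate}.
Proof.
move=> t01 tS; move: (tS); rewrite mem_cat negb_or => /andP[tm tk].
apply: cvgM; last exact: (wave_slope_continuous H pw).
apply: cvgB.
  by apply: cvgB; [exact: cvg_cst|exact: (h_continuous H)].
apply: cvgM; first exact: (source_continuous H).
apply: (@continuous_comp _ _ _ w (fun v : R => v `^ (- a))).
  exact: (profile_continuous pw).
by apply: powR_continuous; exact: (profile_gt0 pw).
Qed.

Lemma flux_wave_C1 (A : set R) :
  (forall z, A z -> U z \notin S /\ ~ boundary (end_set U) z) -> C1_on A (flux p d U).
Proof.
move=> HA; apply: (@C1_on_sub _ _ _ ([set z | support z /\ U z \notin S] `|`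
    [set z | ~ support z /\ ~ boundary (end_set U) z])).
  move=> z /HA[zS nb]; have [sz|ns] := pselect (support z : Prop); by [left|right].
apply: C1_on_union.
  apply: (@C1_criterion _ _ _ (fun s => - rate (U s))) => z [sz zS]; split.
    apply: cvgN; apply: (@continuous_comp _ _ _ U rate); first exact: UC.
    exact: rate_continuous.
  have h1 := profile_wave_support_near H pw sz.
  have h2 := profile_wave_notin_near H pw zS.
  near=> s; apply: flux_wave_derive; near: s; [exact: h1|exact: h2].
apply: (@C1_criterion _ _ _ (cst 0)) => z [ns nb]; split.
  exact: cst_continuous.
have := near_join (end_near_end H pw ns nb); apply: filterS => s sn.
have E : \forall x \near s, cst 0 x = flux p d U x.
  by apply: filterS sn => x [nsx nbx]; rewrite (flux_end H pw).
by apply: near_eq_is_derive E _; exact: is_derive_cst.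
Unshelve. all: by end_near. Qed.

Lemma wave_classical : classical_solution_on p d g h c
  (~` (level_set r m U `|` level_set q k U `|` boundary (end_set U))) U.
Proof.
set A := ~` _.
have HA z : A z -> U z \notin S /\ ~ boundary (end_set U) z.
  move=> nz; split; last by move=> bz; apply: nz; right.
  rewrite mem_cat negb_or; apply/andP; split; apply/negP => /jumpsP[i ir E].
    by apply: nz; left; left; exists i.
  by apply: nz; left; right; exists i.
split; last first.
- move=> z /HA[zS nb]; have [sz|ns] := pselect (support z : Prop).
    have zm : U z \notin Sm by move: zS; rewrite mem_cat negb_or => /andP[].
    have [_ E1] := flux_wave_derive sz zS.
    have [_ E2] := profile_wave_derive H pw sz zm.
    rewrite !derive1E E1 E2 /rate.
    by have := profile_identity H pw sz; lra.
  have E : \forall x \near z, cst 0 x = flux p d U x.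
    by apply: filterS (end_near_end H pw ns nb) => x [nsx nbx]; rewrite (flux_end H pw).
  have [_ E1] : is_derive z 1 (flux p d U) 0.
    by apply: near_eq_is_derive E _; exact: is_derive_cst.
  have [_ E2] := end_derive H pw ns nb.
  rewrite !derive1E E1 E2 mulr0 !add0r.
  case: H => _ [_ g00 g11 _] _ _ _.
  have /andP[+ +] := profile_wave_range p d w z; rewrite !le_eqVlt.
  move=> /orP[/eqP <- _ //|x0].
  by move=> /orP[/eqP -> //|x1]; exfalso; apply: ns; rewrite x0.
- exact: flux_wave_C1.
- apply: (wave_C1 H pw) => z /HA[]; rewrite mem_cat negb_or => /andP[zm _] nb.
  by split.
Qed.

Definition wave_right : \bar R := ereal_sup [set (Z t)%:E | t in `]0, 1[].
Definition wave_left : \bar R := ereal_inf [set (Z t)%:E | t in `]0, 1[].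

Lemma wave_right_gtP z : (z%:E < wave_right)%E <-> 0 < U z.
Proof.
split.
  move=> /ereal_sup_gt[_ [t + <-]]; rewrite /= in_itv /= lte_fin => t01 zt.
  by have := profile_wave_gt H pw t01 zt; lra.
move=> Uz; have Uz1 := profile_wave_range p d w z.
have t01 : 0 < U z / 2 < 1 by lra.
apply: (@lt_le_trans _ _ (Z (U z / 2))%:E).
  by rewrite lte_fin -(profile_wave_gtE H pw) //; lra.
by apply: ereal_sup_ubound; exists (U z / 2) => //=; rewrite in_itv.
Qed.

Lemma wave_left_ltP z : (wave_left < z%:E)%E <-> U z < 1.
Proof.
split.
  move=> /ereal_inf_lt[_ [t + <-]]; rewrite /= in_itv /= lte_fin => t01 zt.
  by have := profile_wave_lt H pw t01 zt; lra.
move=> Uz; have Uz1 := profile_wave_range p d w z.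
have t01 : 0 < (U z + 1) / 2 < 1 by lra.
apply: (@le_lt_trans _ _ (Z ((U z + 1) / 2))%:E).
  by apply: ereal_inf_lbound; exists ((U z + 1) / 2) => //=; rewrite in_itv.
by rewrite lte_fin -(profile_wave_ltE H pw) //; lra.
Qed.

Lemma wave_supportP z : ereal_open_itv wave_left wave_right z <-> support z.
Proof.
rewrite /ereal_open_itv /=; split=> [/andP[/wave_left_ltP z1 /wave_right_gtP z0]|/andP[z0 z1]].
  by rewrite z0.
by apply/andP; split; [apply/wave_left_ltP|apply/wave_right_gtP].
Qed.

Lemma profile_wave_support : wave_support U wave_left wave_right.
Proof.
have U0 := profile_wave_half H pw.
split.
- by apply/andP; split; [apply/wave_left_ltP|apply/wave_right_gtP]; rewrite U0; lra.
- by apply/seteqP; split => z; rewrite /= => /wave_supportP.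
- move=> x y /wave_supportP sx _ xy.
  exact: (profile_wave_decr H pw (or_introl sx)).
- exact: U0.
- split => z zle.
    have := profile_wave_range p d w z => /andP[_]; rewrite le_eqVlt => /orP[/eqP//|].
    by move=> /wave_left_ltP; rewrite ltNge zle.
  have := profile_wave_range p d w z => /andP[+ _]; rewrite le_eqVlt => /orP[/eqP//|].
  by move=> /wave_right_gtP; rewrite ltNge zle.
Qed.

Definition wave_node i : \bar R :=
  if i == 0%N then wave_right else if i == r.+1 then wave_left else (Z (m i))%:E.

Lemma wave_nodeE i : (0 < i <= r)%N -> wave_node i = (Z (m i))%:E.
Proof.
move=> /andP[i0 ir]; rewrite /wave_node (gtn_eqF i0).
by rewrite (ltn_eqF (n := r.+1)).
Qed.

Lemma node_support i : (0 < i <= r)%N -> support (Z (m i)) /\ U (Z (m i)) = m i.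
Proof.
by move=> ir; have mi := m_in H ir; rewrite (profile_wave_position H pw).
Qed.

Lemma profile_wave_nodes : wave_nodes r m U wave_left wave_right wave_node.
Proof.
split; rewrite /wave_node ?eqxx// => i ir.
rewrite -/(wave_node i) wave_nodeE//=; have [sz Uz] := node_support ir.
by split => //; exact/wave_supportP.
Qed.

Lemma wave_node_gt i z : (i <= r)%N -> (z%:E < wave_node i)%E -> m i < U z.
Proof.
have [m0 _ _] := m_breakpoints H.
case: i => [_ /wave_right_gtP|i ir]; first by rewrite m0.
rewrite wave_nodeE// lte_fin => zZ.
by apply: (profile_wave_gt H pw) => //; exact: (m_in H).
Qed.

Lemma wave_node_lt i z : (i <= r)%N -> (wave_node i.+1 < z%:E)%E -> U z < m i.+1.
Proof.
have [_ m1 _] := m_breakpoints H.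
rewrite leq_eqVlt => /orP[/eqP ->|ir].
  by rewrite /wave_node eqxx m1 => /wave_left_ltP.
rewrite wave_nodeE// lte_fin => zZ.
by apply: (profile_wave_lt H pw) => //; exact: (m_in H).
Qed.

Lemma between_nodes i t : (i <= r)%N -> m i < t -> t < m i.+1 -> 0 < t < 1 /\ t \notin Sm.
Proof.
have bm := m_breakpoints H; have [m0 m1 _] := bm => ir it ti.
have lt0 := breakpoints_lt bm.
split.
  apply/andP; split.
    apply: le_lt_trans it; case: i ir {ti} => [|i] ir; first by rewrite m0.
    by rewrite -m0 ltW// lt0// ltnW.
  apply: (lt_le_trans ti); rewrite -m1; move: ir; rewrite leq_eqVlt => /orP[/eqP ->//|ir].
  by rewrite ltW// lt0.
apply/negP => /jumpsP[j /andP[j0 jr] tE].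
have [ji|ij] := leqP j i.
  have : m j <= m i.
    move: ji; rewrite leq_eqVlt => /orP[/eqP ->//|ji].
    by rewrite ltW// lt0// ltnW.
  by rewrite -tE; lra.
have : m i.+1 <= m j.
  move: ij; rewrite leq_eqVlt => /orP[/eqP ->//|ij].
  by rewrite ltW// lt0// ltnW.
by rewrite -tE; lra.
Qed.

Lemma node_jump i : (0 < i <= r)%N -> U (Z (m i)) \in Sm.
Proof.
move=> ir; have [_ ->] := node_support ir.
by apply/jumpsP; exists i.
Qed.

Lemma profile_wave_piecewise_C1 : wave_piecewise_C1 r U wave_node.
Proof.
split; first exact: UC.
- move=> i ir; apply: (wave_C1_support H pw) => z /andP[iz zi].
  exact: (between_nodes ir (wave_node_gt ir zi) (wave_node_lt ir iz)).
- move=> i ir; rewrite wave_nodeE//=.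
  have [l1 [l2 nl]] := node_limits_exist H pw (node_jump ir).
  by split; [exact: cvgP (node_U1 nl)|exact: cvgP (node_U2 nl)].
Qed.

Lemma flux_profile01 (z : R) : support z -> U z \notin Sm ->
  - profile01 w (U z) = flux p d U z.
Proof. by move=> sz zS; rewrite (flux_support H pw)// /profile01 sz. Qed.

Lemma profile_wave_flux : wave_flux_conditions p d r U wave_left wave_right wave_node.
Proof.
have wC := profile01_wave_continuous H pw w00.
have [wl wr] := profile01_ends H pw w00.
have [/andP[l0 r0] _ _ _ [Ul Ur]] := profile_wave_support.
have bm := m_breakpoints H; have [m0 m1 mS] := bm.
have out t : t = 0 \/ t = 1 -> profile01 w t = 0.
  by rewrite /profile01; case=> ->; rewrite ?ltxx ?andbF.
(* Beyond the last jump the flux is the continuous function - w (U z). *)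
have nearl z : support z -> m r < U z -> - profile01 w (U z) = flux p d U z.
  move=> sz zr; apply: flux_profile01 => //.
  by have [] := between_nodes (leqnn r) zr; rewrite ?m1//; lra.
have nearr z : support z -> U z < m 1 -> - profile01 w (U z) = flux p d U z.
  move=> sz z1; apply: flux_profile01 => //.
  by have [] := @between_nodes 0 (U z) (leq0n r); rewrite ?m0//; lra.
have mr1 : m r < 1 by rewrite -m1 mS.
have m10 : 0 < m 1 by rewrite -m0 mS.
have Nw (F : set_system R) : ProperFilter F -> profile01 w (U z) @[z --> F] --> 0 ->
    - profile01 w (U z) @[z --> F] --> (0 : R).
  by move=> FF wF; rewrite -oppr0; exact: cvgN.
split.
- case E : wave_left l0 Ul => [z0| |] // l0 Ul; rewrite /=.
    have Uz0 : U z0 = 1 by apply: Ul; rewrite lexx.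
    have w1 : profile01 w (U z) @[z --> z0^'+] --> 0.
      by apply: cvg_at_right_filter; rewrite -(out 1 (or_intror erefl)) -Uz0; exact: wC.
    apply: cvg_trans (Nw _ _ w1); apply: near_eq_cvg.
    have Uc : {for z0, continuous U} := @UC z0.
    have e'0 : 0 < Num.min 1 (1 - m r) by rewrite lt_min ltr01; lra.
    move/cvgrPdist_lt: Uc => /(_ _ e'0)/nearE_dist[e e0 He].
    apply/near_rightE; exists e => // s sz.
    have := He s ltac:(rewrite ltr_norml; lra); rewrite Uz0 lt_min !ltr_norml => Hs.
    have s1 : U s < 1 by apply/wave_left_ltP; rewrite E lte_fin; lra.
    by apply: nearl; lra.
  apply: cvg_trans (Nw _ _ wl); apply: near_eq_cvg.
  have [U1 _] := profile_wave_boundary H pw.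
  move/cvgrPdist_lt: U1 => /(_ (Num.min 1 (1 - m r)))/=[].
    by rewrite lt_min ltr01; lra.
  move=> M [_ HM]; exists M; split; first exact: num_real.
  move=> s sM; have := HM s sM; rewrite /= lt_min !ltr_norml => Hs.
  have s1 : U s < 1 by apply/wave_left_ltP; rewrite E ltNyr.
  by apply: nearl; lra.
- case E : wave_right r0 Ur => [z1| |] // r0 Ur; rewrite /=.
    have Uz1 : U z1 = 0 by apply: Ur; rewrite lexx.
    have w1 : profile01 w (U z) @[z --> z1^'-] --> 0.
      by apply: cvg_at_left_filter; rewrite -(out 0 (or_introl erefl)) -Uz1; exact: wC.
    apply: cvg_trans (Nw _ _ w1); apply: near_eq_cvg.
    have Uc : {for z1, continuous U} := @UC z1.
    have e'0 : 0 < Num.min 1 (m 1) by rewrite lt_min ltr01.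
    move/cvgrPdist_lt: Uc => /(_ _ e'0)/nearE_dist[e e0 He].
    apply/near_leftE; exists e => // s sz.
    have := He s ltac:(rewrite ltr_norml; lra); rewrite Uz1 lt_min !ltr_norml => Hs.
    have s1 : 0 < U s by apply/wave_right_gtP; rewrite E lte_fin; lra.
    by apply: nearr; lra.
  apply: cvg_trans (Nw _ _ wr); apply: near_eq_cvg.
  have [_ U0] := profile_wave_boundary H pw.
  move/cvgrPdist_lt: U0 => /(_ (Num.min 1 (m 1)))/=[].
    by rewrite lt_min ltr01.
  move=> M [_ HM]; exists M; split; first exact: num_real.
  move=> s sM; have := HM s sM; rewrite /= lt_min !ltr_norml => Hs.
  have s1 : 0 < U s by apply/wave_right_gtP; rewrite E ltry.
  by apply: nearr; lra.
- move=> i ir; rewrite wave_nodeE//=.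
  have [l1 [l2 nl]] := node_limits_exist H pw (node_jump ir).
  have [sz _] := node_support ir.
  split; [exact: cvgP (node_d1 nl)|exact: cvgP (node_d2 nl)|].
  rewrite (cvg_lim _ (node_U1 nl))// (cvg_lim _ (node_U2 nl))//.
  rewrite (cvg_lim _ (node_d1 nl))// (cvg_lim _ (node_d2 nl))//.
  by rewrite !(signed_power_slope H pw) ?(node_l1 nl) ?(node_l2 nl).
Qed.

Lemma profile_wave_properties : wave_properties p d g h r m q k c U.
Proof.
exists wave_left, wave_right, wave_node; split; first exact: profile_wave_support.
split; first exact: profile_wave_nodes.
split; first exact: profile_wave_piecewise_C1.
split; first exact: profile_wave_flux.
split; first exact: wave_classical.
exact: (profile_wave_boundary H pw).
Qed.

End WaveProperties.

(** The sum is p kap, because mu kap^{-a} = (p - 1) kap for this choice of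
    kap, the minimiser of kap + mu kap^{-a}. *)
Lemma kappa_identity (R : realType) (p mu : R) : 1 < p -> 0 < mu ->
  let p' := conjugate_exponent p in
  let kap := (mu / (p - 1)) `^ (1 / p') in
  kap + mu * kap `^ (- expo p) = p' `^ (1 / p') * p `^ (1 / p) * mu `^ (1 / p').
Proof.
move=> p1 mu0 p' kap; have p0 : 0 < p by lra.
have q0 : 0 < p - 1 by lra.
have p'0 : 0 < p' by rewrite divr_gt0.
have kap0 : 0 < kap by rewrite powR_gt0 ?divr_gt0.
have kapE : kap `^ p' = mu / (p - 1).
  by rewrite /kap -powRrM mul1r mulVf ?gt_eqF// powRr1// divr_ge0 ?ltW.
have -> : mu * kap `^ (- expo p) = (p - 1) * kap.
  have -> : mu = (p - 1) * kap `^ p' by rewrite kapE; field; rewrite gt_eqF.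
  rewrite -mulrA -powRD; last by rewrite (gt_eqF kap0) implybT.
  rewrite (_ : p' + - expo p = 1) ?powRr1 ?(ltW kap0)//.
  by rewrite /p' /expo /conjugate_exponent; field; rewrite gt_eqF.
have -> : kap + (p - 1) * kap = p * kap by ring.
have p'E : p' `^ (1 / p') = p `^ (1 / p') / (p - 1) `^ (1 / p').
  by rewrite -powR_div.
have pE : p = p `^ (1 / p') * p `^ (1 / p).
  rewrite -powRD; last by rewrite (gt_eqF p0) implybT.
  rewrite (_ : 1 / p' + 1 / p = 1) ?powRr1 ?(ltW p0)//.
  by rewrite /p' /conjugate_exponent; field; rewrite !gt_eqF.
by rewrite p'E /kap powR_div// [X in X * _ = _]pE; ring.
Qed.

Theorem theorem2p1 (R : realType) (p : R) (g d h : R -> R)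
    (r : nat) (m : nat -> R) (q : nat) (k : nat -> R)
    (hp : 1 < p)
    (hg : reaction_hyp g)
    (hd : diffusion_hyp r m d)
    (hh : convection_hyp q k h)
    (hmu : has_ubound (mu_set p d g))
    (hmu0 : 0 < sup (mu_set p d g)) :
  let p' := conjugate_exponent p in
  let hM := sup [set h t | t in `[0, 1]] in
  let cmax := hM + p' `^ (1 / p') * p `^ (1 / p)
                * (sup (mu_set p d g)) `^ (1 / p') in
  (primitive h 1 < h 0 ->
     exists cstar : R, h 0 <= cstar <= cmax /\
       is_threshold_speed p d g h r m q k cstar) /\
  (h 0 <= primitive h 1 ->
     exists cstar : R, primitive h 1 < cstar <= cmax /\
       is_threshold_speed p d g h r m q k cstar).
Proof.
move=> p' hM cmax.
have H : admissible p g d h r m q k by split.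
pose mu := sup (mu_set p d g).
have [B hB] := h_bounded H.
have hB' t : 0 < t < 1 -> `|h t| <= B by move=> t01; apply: hB; lra.
have hle t : 0 < t < 1 -> h t <= hM.
  move=> t01; apply: ub_le_sup; last by exists t => //=; rewrite in_itv /=; lra.
  by exists B => _ [s + <-]; rewrite /= in_itv /= => /hB; rewrite ler_norml => /andP[].
pose kap := (mu / (p - 1)) `^ (1 / p').
have kap0 : 0 < kap by rewrite powR_gt0 ?divr_gt0// subr_gt0.
have [||||cs [h0cs Pcs csmax csP]] := @threshold_exists _ (expo p) B mu
    (jumps r m ++ jumps q k) h (reduced_source p d g) (expo_gt0 H) hB' (source_le_mu H)
    (source_lower H) _ _ (h 0) cmax kap mu (primitive_ext h)
    (h_at0 H) (primitive_ext_continuous H) _ kap0 (source_le H) _.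
- by move=> t t01; rewrite mem_cat negb_or => /andP[_]; exact: (h_continuous H).
- by move=> t t01; rewrite mem_cat negb_or => /andP[tm _]; exact: (source_continuous H).
- by move=> t t01; rewrite mem_cat negb_or => /andP[_]; exact: (primitive_ext_derive H).
- by move=> t t01; rewrite (kappa_identity hp hmu0) /cmax; have := hle t t01; rewrite /p'; lra.
have P1 : primitive h 1 < cs.
  by move: Pcs; rewrite primitive_ext0 subr0 (primitive_extE h)// ler01 lexx.
have thr : is_threshold_speed p d g h r m q k cs.
  have solved c : cs <= c -> exists w, profile (expo p) (jumps r m ++ jumps q k) h
      (reduced_source p d g) c w /\ vanishes_at0 w.
    move=> csc; have [w pw] := wave_profile_exists H c.
    by exists w; split => //; apply/(csP c w pw).
  split=> c.
    split=> [[U [W _]]|/solved[w [pw w00]]].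
      have [w pw] := wave_profile_exists H c; apply/(csP c w pw).
      have [[sol bc] U0] := W.
      by apply: (wave_vanishes H pw sol bc (z := 0)); rewrite U0; lra.
    exists (profile_wave p d w); have W := profile_wave_normalized H pw w00.
    by split => // U' W'; exact: (wave_unique H W W').
  move=> U /solved[w [pw w00]] W.
  rewrite (wave_unique H W (profile_wave_normalized H pw w00)).
  exact: profile_wave_properties.
by split=> _; exists cs; split => //; rewrite ?h0cs ?P1.
Qed.
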